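(* For a balanced polygon $P$ (that is, a balanced polytope of dimension $2$) there are only the following possibilities (up to affine-integral equivalence), each of which can in fact be realized and constitutes an $E$-equivalence class (in case (d): one class for each number of column vectors): (a) $P$ is a multiple of the unimodular triangle $P_a=\Delta_2$; hence $\mathrm{Col}(P)=\{\pm u,\pm v,\pm w\}$ and the column vectors are subject to the obvious relations. (b) $P$ is projectively equivalent to the trapezoid $P_b=\mathrm{conv}\bigl((0,0),(2,0),(1,1),(0,1)\bigr)$; hence $\mathrm{Col}(P)=\{u,\pm v,w\}$ and the relations in $\mathrm{Col}(P)$ are $uv=w$ and $w(-v)=u$. (c) $\mathrm{Col}(P)=\{u,v,w\}$ and $uv=w$ is the only relation. (d) $\mathrm{Col}(P)$ has any prescribed number of column vectors, they all have the same base edge (and there are no relations between them). (e) $P$ is projectively equivalent to the unit lattice square $P_e$; hence $\mathrm{Col}(P)=\{\pm u,\pm v\}$ with no relations between the column vectors. (f) $\mathrm{Col}(P)=\{u,v\}$ with $P_u\ne P_v$ and with no relations in $\mathrm{Col}(P)$.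
   Context: All polytopes are convex lattice polytopes $P\subset\mathbb{R}^n$ (vertices in $\mathbb{Z}^n$), $L_P=P\cap\mathbb{Z}^n$. Standing assumption: $\dim P=n$ and $\mathbb{Z}^n$ is the smallest affine sublattice of $\mathbb{R}^n$ containing $L_P$. For a facet $F$ of $P$, $\langle F,-\rangle:\mathbb{Z}^n\to\mathbb{Z}$ is the unique surjective group homomorphism that vanishes on differences of points of $\mathbb{Z}^n\cap\mathrm{Aff}(F)$ and whose minimum on $L_P$ is attained at the lattice points of $F$. A vector $v\in\mathbb{Z}^n$, $v\ne0$, is a column vector of $P$ if there is a facet $F$ with $x+v\in P$ for all $x\in L_P\setminus F$; this $F$ is unique, called the base facet (base edge if $n=2$) of $v$ and denoted $P_v$. $\mathrm{Col}(P)$ is the set of column vectors. Standing assumption: all polytopes considered have at least one column vector. For $u,v\in\mathrm{Col}(P)$ the product $uv$ exists if $u+v\neq0$ and $x+u\notin P_v$ for every $x\in L_P\setminus P_u$; then $uv:=u+v\in\mathrm{Col}(P)$. ''Relations'' in $\mathrm{Col}(P)$ are the existing products. $P$ is balanced if $\langle P_u,v\rangle\le1$ for all $u,v\in\mathrm{Col}(P)$. $\Delta_2=\mathrm{conv}((0,0),(1,0),(0,1))$, with vertices $p_0,p_1,p_2$; its column vectors are the six differences $v_{ij}=p_j-p_i$ ($i\neq j$), and the ''obvious relations'' are $v_{ij}v_{jk}=v_{ik}$ for pairwise distinct $i,j,k$. The unit lattice square is $P_e=\mathrm{conv}((0,0),(1,0),(0,1),(1,1))$. Affine-integral equivalence: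 equivalence under affine automorphisms of $\mathbb{R}^2$ preserving $\mathbb{Z}^2$. Two polytopes in $\mathbb{R}^n$ are projectively equivalent if they have the same normal fan (i.e. same dimension, same combinatorial type, and corresponding faces have parallel affine hulls). Two balanced polytopes $P,Q$ are $E$-equivalent if there is a bijection $\mu:\mathrm{Col}(P)\to\mathrm{Col}(Q)$ identifying (i) the matrices $(\langle F,v\rangle)$ with rows indexed by column vectors $v$ and columns indexed by the base facets $F$ of column vectors, i.e. $\langle P_w,v\rangle=\langle Q_{\mu(w)},\mu(v)\rangle$ for all $v,w\in\mathrm{Col}(P)$, and (ii) the partial product structures on $\mathrm{Col}(P)$ and $\mathrm{Col}(Q)$. *)

(* Defs.v *)
From HB Require Import structures.
From mathcomp Require Import all_boot all_order all_algebra.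
From mathcomp Require Import all_classical all_reals all_analysis.
Set Implicit Arguments.
Unset Strict Implicit.
Unset Printing Implicit Defensive.
Import Order.TTheory GRing.Theory Num.Theory.
Import numFieldNormedType.Exports.
Local Open Scope classical_set_scope.
Local Open Scope ring_scope.

(* Polytopes are sets of real row vectors; lattice points and column vectors
   are integer row vectors, sent into real space by [emb]. *)

Section Polytopes.
Variables (R : realType) (n : nat).
Local Notation E := 'rV[R]_n.
Local Notation Z := 'rV[int]_n.

Definition emb (x : Z) : E := map_mx intr x.

Definition dot (l x : E) : R := \sum_i l 0 i * x 0 i.

Definition conv_hull (A : set E) : set E :=
  [set x | exists (k : nat) (a : 'I_k -> R) (p : 'I_k -> E),
     [/\ forall i, 0 <= a i, \sum_i a i = 1, forall i, A (p i)
       & x = \sum_i a i *: p i]].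

Definition aff_hull (A : set E) : set E :=
  [set x | exists (k : nat) (a : 'I_k -> R) (p : 'I_k -> E),
     [/\ \sum_i a i = 1, forall i, A (p i) & x = \sum_i a i *: p i]].

Definition has_dim (A : set E) (d : nat) : Prop :=
  exists (x : E) (U : {vspace E}),
    \dim U = d /\ aff_hull A = [set x + u | u in [set u | u \in U]].

Definition conv_lat (V : seq Z) : set E := conv_hull [set emb x | x in [set` V]].

(* The lattice points L_P. *)
Definition lat (P : set E) : set Z := [set x | P (emb x)].

(* Translates of discrete subgroups of R^n. *)
Definition affine_lattice (M : set E) : Prop :=
  exists (x : E) (G : set E),
    [/\ G 0, forall g h, G g -> G h -> G (g - h),
        exists2 e : R, 0 < e & forall g, G g -> g != 0 -> e <= `|g|
      & M = [set x + g | g in G]].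

Definition min_face (P : set E) (l : E) : set E :=
  [set x | P x /\ forall y, P y -> dot l x <= dot l y].

Definition is_face (P F : set E) : Prop := exists l, F = min_face P l.

Definition facet (P F : set E) : Prop :=
  is_face P F /\ exists d, has_dim P d.+1 /\ has_dim F d.

Definition is_height (P F : set E) (h : Z -> int) : Prop :=
  [/\ zmod_morphism h, range h = setT,
      forall x y, aff_hull F (emb x) -> aff_hull F (emb y) -> h (x - y) = 0
    & forall x y, lat P x -> F (emb x) -> lat P y -> h x <= h y].

(* <F, - >; [is_height P F] has exactly one element when F is a facet of a
   full-dimensional lattice polytope P. *)
Definition height (P F : set E) : Z -> int := xget (fun=> 0) [set h | is_height P F h].

Definition is_base (P : set E) (v : Z) (F : set E) : Prop :=
  facet P F /\ forall x, lat P x -> ~ F (emb x) -> P (emb (x + v)).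

Definition Col (P : set E) : set Z :=
  [set v | v != 0 /\ exists F, is_base P v F].

(* The base facet P_v; [is_base P v] has exactly one element when v is a
   column vector. *)
Definition base (P : set E) (v : Z) : set E := get [set F | is_base P v F].

Definition prod_exists (P : set E) (u v : Z) : Prop :=
  [/\ Col P u, Col P v, u + v != 0
    & forall x, lat P x -> ~ base P u (emb x) -> ~ base P v (emb (x + u))].

(* The triple (u, v, w) stands for the relation uv = w. *)
Definition relations (P : set E) : set (Z * Z * Z) :=
  [set t | prod_exists P t.1.1 t.1.2 /\ t.2 = t.1.1 + t.1.2].

(* Lattice polytopes satisfying the standing assumptions. *)
Definition lattice_polytope (P : set E) : Prop :=
  [/\ exists V : seq Z, P = conv_lat V,
      has_dim P n,
      forall M, affine_lattice M -> [set emb x | x in lat P] `<=` M ->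
        range emb `<=` M
    & Col P !=set0].

Definition balanced (P : set E) : Prop :=
  lattice_polytope P /\
  forall u v, Col P u -> Col P v -> height P (base P u) v <= 1.

Definition normal_cone (P F : set E) : set E := [set l | F `<=` min_face P l].

Definition normal_fan (P : set E) : set (set E) :=
  [set normal_cone P F | F in is_face P].

Definition proj_equiv (P Q : set E) : Prop := normal_fan P = normal_fan Q.

Definition aff_int_equiv (P Q : set E) : Prop :=
  exists (A : 'M[R]_n) (b : E),
    let f := fun x : E => x *m A + b in
    [/\ A \in unitmx, f @` range emb = range emb & f @` P = Q].

Definition E_equiv (P Q : set E) : Prop :=
  exists mu : Z -> Z,
    [/\ set_bij (Col P) (Col Q) mu,
        forall v w, Col P v -> Col P w ->
          height P (base P w) v = height Q (base Q (mu w)) (mu v),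
        forall u v, Col P u -> Col P v ->
          (prod_exists P u v <-> prod_exists Q (mu u) (mu v))
      & forall u v, prod_exists P u v -> mu (u + v) = mu u + mu v].

End Polytopes.

Definition pt (a b : int) : 'rV[int]_2 := \row_(j < 2) [:: a; b]`_j.

Definition Delta2 (R : realType) : set 'rV[R]_2 :=
  conv_lat [:: pt 0 0; pt 1 0; pt 0 1].

Definition trapezoid (R : realType) : set 'rV[R]_2 :=
  conv_lat [:: pt 0 0; pt 2 0; pt 1 1; pt 0 1].

Definition unit_square (R : realType) : set 'rV[R]_2 :=
  conv_lat [:: pt 0 0; pt 1 0; pt 0 1; pt 1 1].

Arguments Delta2 R _ : clear implicits.
Arguments trapezoid R _ : clear implicits.
Arguments unit_square R _ : clear implicits.

(* v_ij v_jk = v_ik, where v_ij = p_j - p_i. *)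
Definition obvious_relations (p : 'I_3 -> 'rV[int]_2) :
    set ('rV[int]_2 * 'rV[int]_2 * 'rV[int]_2) :=
  [set t | exists i j k : 'I_3, [/\ i != j, j != k, i != k
     & t = (p j - p i, p k - p j, p k - p i)]].

(* [case_d k]: the case with k column vectors sharing one base edge. *)
Inductive polygon_case :=
  case_a | case_b | case_c | case_d of nat | case_e | case_f.

Section Cases.
Variable R : realType.
Implicit Types P Q : set 'rV[R]_2.

Definition col_case (t : polygon_case) P : Prop :=
  match t with
  | case_a => exists p0 p1 p2 : 'rV[int]_2,
      let u := p1 - p0 in let v := p2 - p1 in let w := p2 - p0 in
      let s := [:: u; - u; v; - v; w; - w] in
      [/\ uniq s, Col P = [set` s]
        & relations P = obvious_relations (tnth [tuple p0; p1; p2])]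
  | case_b => exists u v w : 'rV[int]_2,
      let s := [:: u; v; - v; w] in
      [/\ uniq s, Col P = [set` s]
        & relations P = [set` [:: (u, v, w); (w, - v, u)]]]
  | case_c => exists u v w : 'rV[int]_2,
      let s := [:: u; v; w] in
      [/\ uniq s, Col P = [set` s] & relations P = [set` [:: (u, v, w)]]]
  | case_d k =>
      [/\ (Col P #= `I_k)%card, exists F, forall v, Col P v -> base P v = F
        & relations P = set0]
  | case_e => exists u v : 'rV[int]_2,
      let s := [:: u; - u; v; - v] in
      [/\ uniq s, Col P = [set` s] & relations P = set0]
  | case_f => exists u v : 'rV[int]_2,
      [/\ Col P = [set` [:: u; v]], base P u <> base P v
        & relations P = set0]
  end.

(* Cases (a), (b), (e) are defined by the shape of the polygon, the others by
   its column vectors. *)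
Definition in_case (t : polygon_case) P : Prop :=
  match t with
  | case_a => exists2 c : nat, (0 < c)%N &
      aff_int_equiv P [set c%:R *: x | x in Delta2 R]
  | case_b => exists2 Q, aff_int_equiv P Q & proj_equiv Q (trapezoid R)
  | case_e => exists2 Q, aff_int_equiv P Q & proj_equiv Q (unit_square R)
  | _ => col_case t P
  end.

End Cases.

(* Main.v *)
Require Import Defs.
From mathcomp Require Import all_boot all_order all_algebra.
From mathcomp Require Import all_classical all_reals all_analysis.
From mathcomp Require Import zify ring lra.
Set Implicit Arguments.
Unset Strict Implicit.
Unset Printing Implicit Defensive.
Import Order.TTheory GRing.Theory Num.Theory.
Local Open Scope classical_set_scope.
Local Open Scope ring_scope.

(** The lattice polygon P is the intersection of the half-planes of its edges,
    so it is governed by the set N of its primitive inner edge normals: v is a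
    column vector with base normal n iff <n, v> = -1 and <m, v> >= 0 for all
    other m in N, heights are the values <n, v>, and uv exists iff u + v <> 0
    and <n_v, u> > 0.  Since P is bounded, only v = 0 is nonnegative on all of N.

    If v and -v are both column vectors, all edges but two are parallel to v,
    and balancedness leaves the triangles, trapezoids and rectangles of cases
    (a), (b) and (e).  Otherwise <n, v> and <m, u> are not both 1 for columns
    u, v with different base normals n, m, and then a 3 x 3 determinant excludes
    three different bases.  With two bases, the base normals form a basis of the
    dual lattice and the columns are those of (c) or (f); one base is case (d).
    In every case the columns and base normals have fixed coordinates, so that
    two polygons of one case are E-equivalent; the number of columns and the
    existence of relations and of a common base separate the cases. *)

(** * Convex hulls *)

(** A face of a lattice polygon is the hull of the generators on it, so statements about edges can
    be tested at lattice points; the half-plane description needs only that an outside point is cut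
    off by an edge, found by turning a tangent line about its point of contact. Generation of the
    lattice by the lattice points of P is what makes the value of a column vector on its base normal
    -1. Balancedness makes all other pairings 0 or 1, and then the 3 x 3 determinant with -1 on the
    diagonal is -1 plus products over 2-cycles and 3-cycles of pairings: if it vanishes, such a
    cycle exists. The obstacle to comparing polygons is that cases (a), (b), (e) prescribe a shape
    and (c), (d), (f) prescribe column vectors, while E-equivalence compares heights. Hence the
    intermediate notion [config]: the classification gives every balanced polygon a configuration,
    and since the cases exclude each other, it is the one of the case at hand. Projective
    equivalence enters only through the rays of the normal fan, which are the half-lines spanned by
    the edge normals. *)

Lemma sum_ord2 (V : nmodType) (F : 'I_2 -> V) : \sum_i F i = F 0 + F 1.
Proof. by rewrite big_ord_recl big_ord1; congr (_ + F _); exact: val_inj. Qed.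

Lemma rV2P (T : Type) (x y : 'rV[T]_2) :
  x 0 0 = y 0 0 -> x 0 1 = y 0 1 -> x = y.
Proof.
move=> h0 h1; apply/rowP => -[[|[|//]] lti].
- by rewrite (_ : Ordinal lti = 0) //; exact: val_inj.
- by rewrite (_ : Ordinal lti = 1) //; exact: val_inj.
Qed.

Section ConvexHull.
Variables (R : realType) (n : nat).
Local Notation E := 'rV[R]_n.
Implicit Types (S : set E) (x y l : E).

Lemma dotDr l x y : dot l (x + y) = dot l x + dot l y.
Proof.
by rewrite /dot -big_split; apply: eq_bigr => i _; rewrite mxE mulrDr.
Qed.

Lemma dotZr l (a : R) x : dot l (a *: x) = a * dot l x.
Proof.
by rewrite /dot mulr_sumr; apply: eq_bigr => i _; rewrite mxE mulrCA.
Qed.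

Lemma dotZl (a : R) l x : dot (a *: l) x = a * dot l x.
Proof.
by rewrite /dot mulr_sumr; apply: eq_bigr => i _; rewrite mxE mulrA.
Qed.

Lemma dot0r l : dot l 0 = 0.
Proof. by rewrite /dot big1 // => i _; rewrite mxE mulr0. Qed.

Lemma dot0l x : dot 0 x = 0.
Proof. by rewrite /dot big1 // => i _; rewrite mxE mul0r. Qed.

Lemma dotNl l x : dot (- l) x = - dot l x.
Proof. by rewrite -(scaleN1r l) dotZl mulN1r. Qed.

Lemma dotNr l x : dot l (- x) = - dot l x.
Proof. by rewrite -scaleN1r dotZr mulN1r. Qed.

Lemma dotBr l x y : dot l (x - y) = dot l x - dot l y.
Proof. by rewrite dotDr dotNr. Qed.

Lemma dot_sumr l k (a : 'I_k -> R) (p : 'I_k -> E) :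
  dot l (\sum_i a i *: p i) = \sum_i a i * dot l (p i).
Proof.
pose F := fun x => dot l x.
rewrite -[LHS]/(F _) (big_morph F (id1 := 0) (op1 := +%R)) /F.
- by apply: eq_bigr => i _; rewrite dotZr.
- exact: dotDr.
- exact: dot0r.
Qed.

Lemma conv_hull_seq S (s : seq (R * E)) :
  (forall w, w \in s -> 0 <= w.1 /\ S w.2) -> \sum_(w <- s) w.1 = 1 ->
  conv_hull S (\sum_(w <- s) w.1 *: w.2).
Proof.
move=> hs s1; pose w0 : R * E := (0, 0).
exists (size s), (fun i => (nth w0 s i).1), (fun i => (nth w0 s i).2); split.
- by move=> i; case: (hs (nth w0 s i)) => //; rewrite mem_nth.
- by rewrite -s1 (big_nth w0) big_mkord.
- by move=> i; case: (hs (nth w0 s i)) => //; rewrite mem_nth.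
- by rewrite (big_nth w0) big_mkord.
Qed.

Lemma sub_conv_hull S : S `<=` conv_hull S.
Proof.
move=> x Sx; have := @conv_hull_seq S [:: (1, x)].
rewrite !big_seq1 scale1r; apply=> // w; rewrite inE => /eqP -> /=; split=> //.
Qed.

Lemma conv_hull_dot_ge S l c x :
  (forall y, S y -> c <= dot l y) -> conv_hull S x -> c <= dot l x.
Proof.
move=> hS [k [a [p [a0 a1 Sp ->]]]].
rewrite dot_sumr -[leLHS]mul1r -a1 mulr_suml; apply: ler_sum => i _.
by rewrite ler_wpM2l ?hS.
Qed.

Lemma aff_hull_dot S l c x :
  (forall y, S y -> dot l y = c) -> aff_hull S x -> dot l x = c.
Proof.
move=> hS [k [a [p [a1 Sp ->]]]].
rewrite dot_sumr -[RHS]mul1r -a1 mulr_suml; apply: eq_bigr => i _.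
by rewrite hS.
Qed.

Lemma sub_aff_hull S : S `<=` aff_hull S.
Proof.
move=> x Sx; exists 1%N, (fun=> 1), (fun=> x); split=> //.
  by rewrite big_ord1.
by rewrite big_ord1 scale1r.
Qed.

Lemma conv_hull_sub_aff S : conv_hull S `<=` aff_hull S.
Proof. by move=> x [k [a [p [_ a1 Sp ->]]]]; exists k, a, p. Qed.

Lemma aff_hull_neq0 S : aff_hull S !=set0 -> S !=set0.
Proof.
move=> [x [[|k] [a [p [a1 Sp _]]]]]; last by exists (p ord0).
by move: a1; rewrite big_ord0 => /esym/eqP; rewrite oner_eq0.
Qed.

Lemma conv_hull_mono S S' : S `<=` S' -> conv_hull S `<=` conv_hull S'.
Proof.
by move=> sub x [k [a [p [a0 a1 Sp ->]]]]; exists k, a, p; split => // i; exact/sub.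
Qed.

Lemma conv_hull_shift S y x :
  conv_hull [set z - y | z in S] x -> conv_hull S (x + y).
Proof.
move=> [k [a [p [a0 a1 Sp ->]]]]; exists k, a, (fun i => p i + y); split=> //.
  by move=> i; have [z Sz <-] := Sp i; rewrite subrK.
under [RHS]eq_bigr do rewrite scalerDr.
by rewrite big_split /= -scaler_suml a1 scale1r.
Qed.

(* Only the points of minimal value can carry positive weight. *)
Lemma min_face_conv S l x :
  min_face (conv_hull S) l x ->
  conv_hull (S `&` min_face (conv_hull S) l) x.
Proof.
move=> [[k [a [p [a0 a1 Sp xE]]]] xmin].
have h i : a i * (dot l (p i) - dot l x) = 0.
  have pos j : 0 <= a j * (dot l (p j) - dot l x).
    by rewrite mulr_ge0 // subr_ge0 xmin //; exact: sub_conv_hull.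
  apply/eqP; have: \sum_i a i * (dot l (p i) - dot l x) == 0.
    under eq_bigr do rewrite mulrBr.
    by rewrite sumrB -mulr_suml a1 mul1r xE dot_sumr subrr.
  by rewrite psumr_eq0 // => /allP/(_ i); rewrite mem_index_enum => /(_ isT).
have inM i : a i != 0 -> (S `&` min_face (conv_hull S) l) (p i).
  move=> ai; split=> //; split; first exact: sub_conv_hull.
  have /eqP := h i; rewrite mulf_eq0 (negPf ai) subr_eq0 => /eqP -> y.
  exact: xmin.
have [j aj] : exists j, a j != 0.
  apply/existsP; apply: contra_eqT a1 => /existsPn a0'.
  rewrite big1 ?[_ == 1]eq_sym ?oner_eq0 // => i _.
  by apply/eqP; move: (a0' i); rewrite negbK.
exists k, a, (fun i => if a i == 0 then p j else p i); split=> //.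
  by move=> i; case: (eqVneq (a i) 0) => ai; exact: inM.
rewrite xE; apply: eq_bigr => i _.
by case: (eqVneq (a i) 0) => // ->; rewrite !scale0r.
Qed.

End ConvexHull.

(** * Separation in the plane *)

Section Separation.
Variable R : realType.
Local Notation E := 'rV[R]_2.
Implicit Types (l p q u v w x y : E) (V W : seq E).

Definition det2 x y : R := x 0 0 * y 0 1 - x 0 1 * y 0 0.

(** Full-dimensionality in the form used by the proofs: it supplies points off a given line and
    passes to affine images. *)
Definition noncollinear (S : set E) : Prop :=
  forall l c, l != 0 -> exists2 x, S x & dot l x != c.

Lemma dot2 l x : dot l x = l 0 0 * x 0 0 + l 0 1 * x 0 1.
Proof. exact: sum_ord2. Qed.

(** The quarter turn of [x] represents [det2 x] as a linear form, so that results on [dot] apply to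
    determinants. *)
Lemma det2_dot x y :
  det2 x y = dot (\row_j [:: - x 0 1; x 0 0]`_j) y.
Proof. by rewrite dot2 !mxE /= /det2; ring. Qed.

Lemma dot_gt0 x : x != 0 -> 0 < dot x x.
Proof.
move=> x0; rewrite lt_neqAle dot2 addr_ge0 ?sqr_ge0 ?andbT -?expr2 //.
rewrite eq_sym paddr_eq0 ?sqr_ge0 // !sqrf_eq0.
by apply: contra x0 => /andP[/eqP h0 /eqP h1]; apply/eqP/rV2P; rewrite mxE.
Qed.

(** In the plane [dot n n * det2 d y = dot n d * det2 n y - dot n y * det2 n d], so [det2 d y]
    vanishes and [y] equals its projection to the line of [d]. *)
Lemma perp_colinear (n d y : E) : n != 0 -> d != 0 ->
  dot n d = 0 -> dot n y = 0 -> exists t, y = t *: d.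
Proof.
move=> n0 d0 nd ny; have dd := dot_gt0 d0; have nn := dot_gt0 n0.
exists (dot d y / dot d d).
have dd0 : dot d d != 0 by rewrite gt_eqF.
have det0 : det2 d y = 0.
  apply/eqP; rewrite -(mulrI_eq0 _ (mulfI (lt0r_neq0 nn))).
  have -> : dot n n * det2 d y = dot n d * det2 n y - dot n y * det2 n d.
    by rewrite /det2 !dot2; ring.
  by rewrite nd ny !mul0r subrr.
apply: (scalerI dd0); rewrite scalerA mulrC divfK //.
move: det0; rewrite /det2 => det0.
apply/rV2P; rewrite !mxE !dot2.
  by apply/eqP; rewrite -subr_eq0 -(mulr0 (- d 0 1)) -det0; apply/eqP; ring.
by apply/eqP; rewrite -subr_eq0 -(mulr0 (d 0 0)) -det0; apply/eqP; ring.
Qed.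

(** The points may coincide and weights may vanish, so this also serves for two points on opposite
    sides of the origin. *)
Lemma conv_hull0_3 W p q r (a b c : R) :
  p \in W -> q \in W -> r \in W -> 0 <= a -> 0 <= b -> 0 <= c ->
  0 < a + b + c -> a *: p + b *: q + c *: r = 0 -> conv_hull [set` W] 0.
Proof.
move=> pW qW rW a0 b0 c0 s0 e0.
pose s := a + b + c.
have s1 : a / s + (b / s + c / s) = 1.
  by rewrite -!mulrDl addrA mulfV // gt_eqF.
have := @conv_hull_seq _ _ [set` W] [:: (a / s, p); (b / s, q); (c / s, r)].
rewrite !big_cons !big_nil /= !addr0 s1.
rewrite (_ : _ *: p + _ = 0) => [|]; last first.
  by rewrite -(scaler0 _ s^-1) -e0 !scalerDr !scalerA ![_ / s]mulrC addrA.
apply=> // w; rewrite !inE => /or3P[] /eqP -> /=; split=> //;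
by rewrite mulr_ge0 // invr_ge0 ltW.
Qed.

(* [p] spans the clockwise-most ray from the origin through a point of [W],
   and is nearest to the origin on that ray. *)
Lemma tangent W : W != [::] ->
  conv_hull [set` W] 0 \/
  exists p, [/\ p \in W, p != 0 & forall v, v \in W ->
    0 < det2 p v \/ det2 p v = 0 /\ dot p p <= dot p v].
Proof.
elim: W => // w W IH _.
have [->|w0] := eqVneq w 0.
  by left; apply: sub_conv_hull; rewrite /= mem_head.
have [W0|/IH] := eqVneq W [::].
  right; exists w; split; rewrite ?mem_head // => v.
  by rewrite W0 inE => /eqP ->; right; split=> //; rewrite /det2 mulrC subrr.
case=> [c0|[p [pW p0 hp]]].
  left; apply: conv_hull_mono c0 => v /= vW.
  by rewrite inE vW orbT.
have pp := dot_gt0 p0; have ww := dot_gt0 w0.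
have memW v : v \in W -> v \in w :: W by rewrite inE orbC => ->.
(* Two points on a line through the origin, not strictly on the same side of it: the weights are
   [- dot q u] and [dot q q]. *)
have opp q u : q \in w :: W -> u \in w :: W -> q != 0 ->
    det2 q u = 0 -> dot q u <= 0 -> conv_hull [set` w :: W] 0.
  move=> qW uW q0 du nu; have qq := dot_gt0 q0.
  apply: (conv_hull0_3 (a := - dot q u) (b := dot q q) (c := 0) qW uW uW);
    rewrite ?oppr_ge0 // ?ltW //; first by rewrite addr0; lra.
  rewrite scale0r addr0; move: du; rewrite /det2 => du.
  apply/rV2P; rewrite !mxE !dot2.
    by rewrite -[RHS](mulr0 (- q 0 1)) -du; ring.
  by rewrite -[RHS](mulr0 (q 0 0)) -du; ring.
have pW' := memW _ pW.
have [dpw|dpw|dpw] := ltgtP 0 (det2 p w).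
- right; exists p; split=> // v; rewrite inE => /orP[/eqP ->|/hp //].
  by left.
(* Here [w] lies clockwise of [p]. Either it spans the new extreme ray, or some [v] is neither
   clockwise of [p] nor counterclockwise of [w], and the three points surround the origin. *)
- have [h|] := pselect (forall v, v \in W -> 0 < det2 w v).
    right; exists w; split; rewrite ?mem_head // => v; rewrite inE.
    by case/orP => [/eqP ->|/h]; [right; rewrite /det2; split=> //; ring|left].
  move=> /existsNP[v /not_implyP[vW /negP]]; rewrite -leNgt => dwv; left.
  have pv : 0 <= det2 p v by case: (hp _ vW) => [/ltW//|[->]].
  (* The weights come from the planar identity [det2 w v *: p - det2 p v *: w + det2 p w *: v =
     0]. *)
  apply: (conv_hull0_3 (a := - det2 w v) (b := det2 p v) (c := - det2 p w)
    pW' (mem_head _ _) (memW _ vW)); rewrite ?oppr_ge0 // ?ltW //; first lra.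
  by rewrite /det2; apply/rV2P; rewrite !mxE; ring.
- have [le0|gt0] := lerP (dot p w) 0.
    by left; exact: opp pW' (mem_head _ _) p0 (esym dpw) le0.
  right; have [le|lt] := lerP (dot p p) (dot p w).
    exists p; split=> // v; rewrite inE => /orP[/eqP ->|/hp //].
    by right.
  exists w; split; rewrite ?mem_head // => v; rewrite inE.
  case/orP => [/eqP ->|/hp]; first by right; rewrite /det2; split=> //; ring.
  have [s [s0 s1 wE]] : exists s, [/\ 0 < s, s < 1 & w = s *: p].
    exists (dot p w / dot p p); split; first exact: divr_gt0.
      by rewrite ltr_pdivrMr ?mul1r.
    have pp0 : dot p p != 0 by rewrite gt_eqF.
    apply: (scalerI pp0); rewrite scalerA mulrC divfK //.
    move: dpw; rewrite /det2 => dpw.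
    apply/rV2P; rewrite !mxE !dot2.
      by apply/eqP; rewrite -subr_eq0 -(mulr0 (- p 0 1)) dpw; apply/eqP; ring.
    by apply/eqP; rewrite -subr_eq0 -(mulr0 (p 0 0)) dpw; apply/eqP; ring.
  have dE : det2 w v = s * det2 p v by rewrite wE /det2 !mxE; ring.
  rewrite dE wE dotZr !dotZl; case=> [d|[-> d]].
    by left; exact: mulr_gt0.
  by right; rewrite mulr0; split=> //; rewrite ler_pM2l //; nra.
Qed.

Lemma arg_min_seq (T : eqType) (f : T -> R) (s : seq T) (x0 : T) :
  x0 \in s -> exists2 x, x \in s & forall z, z \in s -> f x <= f z.
Proof.
elim: s x0 => // a s IH x0 _.
have [->|] := eqVneq s [::].
  by exists a; rewrite ?mem_head // => z; rewrite inE => /eqP ->.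
case: s IH => // b s IH _; have [x xs hx] := IH b (mem_head _ _).
have [le|lt] := lerP (f a) (f x).
  exists a; rewrite ?mem_head // => z; rewrite inE => /orP[/eqP ->//|/hx].
  exact: le_trans.
exists x; first by rewrite inE xs orbT.
by move=> z; rewrite inE => /orP[/eqP ->|/hx //]; exact: ltW.
Qed.

(* Turn a tangent line from [x] to the hull around its point of contact [p],
   as far as the hull allows: the line reached contains an edge and separates
   [x] from the hull. *)
Lemma edge_separation V x :
  V != [::] -> noncollinear (conv_hull [set` V]) -> ~ conv_hull [set` V] x ->
  exists p q, [/\ p \in V, q \in V,
    forall v, v \in V -> 0 <= det2 (q - p) (v - p) & det2 (q - p) (x - p) < 0].
Proof.
move=> V0 nc nVx.
have [|c0|[p' [pW p0 hp]]] := @tangent [seq v - x | v <- V].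
- by rewrite -size_eq0 size_map size_eq0.
- case: nVx; rewrite -[x]add0r; apply: conv_hull_shift.
  by apply: conv_hull_mono c0 => w /= /mapP[v vV ->]; exists v.
have /mapP[p pV p'E] := pW.
have pp := dot_gt0 p0.
have hV v : v \in V -> 0 < det2 p' (v - p) \/
    det2 p' (v - p) = 0 /\ 0 <= dot p' (v - p).
  move=> vV; have := hp (v - x) (map_f _ vV).
  have -> : v - x = (v - p) + p' by rewrite p'E addrA subrK.
  rewrite dotDr (_ : det2 _ (_ + _) = det2 p' (v - p)).
    by case=> [|[d1 d2]]; [left|right; split=> //; lra].
  by rewrite /det2 !mxE; ring.
have [u uV du] : exists2 u, u \in V & 0 < det2 p' (u - p).
  apply: contrapT => nu.
  have [|y Vy /eqP] := nc (\row_j [:: - p' 0 1; p' 0 0]`_j) (det2 p' p).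
  - apply: contra p0 => /eqP/rowP e0; apply/eqP/rV2P; rewrite mxE.
      by have := e0 1; rewrite !mxE.
    by have := e0 0; rewrite !mxE /= => /eqP; rewrite oppr_eq0 => /eqP.
  case; rewrite det2_dot.
  apply: aff_hull_dot (conv_hull_sub_aff Vy) => v vV; rewrite -!det2_dot.
  apply/eqP; rewrite -subr_eq0; apply/eqP.
  have [d|[d _]] := hV v vV; first by case: nu; exists v.
  by rewrite -d /det2 !mxE; ring.
(* Seen from [p], the hull spans the angles from the direction [p'] up to a largest one below pi,
   and [x] lies at angle pi. The quotient minimised below is the cotangent of the angle, so [q]
   attains the largest angle and the line through [p] and [q] separates. *)
pose U := [seq v <- V | 0 < det2 p' (v - p)].
have [|q] := arg_min_seq (fun v => dot p' (v - p) / det2 p' (v - p))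
  (s := U) (x0 := u); first by rewrite mem_filter du.
rewrite mem_filter => /andP[dq qV] qmin.
have key w : det2 (q - p) w * dot p' p' =
    dot p' (q - p) * det2 p' w - dot p' w * det2 p' (q - p).
  by rewrite !dot2 /det2; ring.
have flip w : det2 (p - q) (w - q) = - det2 (q - p) (w - p).
  by rewrite /det2 !mxE; ring.
exists q, p; split=> // [v vV|]; rewrite flip ?oppr_ge0 ?oppr_lt0.
  rewrite -(pmulr_lle0 _ pp) key subr_le0.
  have [dv|[-> dv]] := hV v vV; last first.
    by rewrite mulr0 mulr_ge0 // ltW.
  have := qmin v; rewrite mem_filter dv vV => /(_ isT).
  by rewrite ler_pdivrMr // mulrAC ler_pdivlMr.
have xp : x - p = - p' by rewrite p'E opprB.
rewrite -(pmulr_lgt0 _ pp) key xp dotNr /det2 !mxE.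
rewrite /det2 !mxE in dq; nra.
Qed.
End Separation.

(** * Integral linear forms and primitive vectors *)

Section IntegerPlane.
Local Notation Z := 'rV[int]_2.
Implicit Types (m n v w d : Z).

Definition ip n v : int := n 0 0 * v 0 0 + n 0 1 * v 0 1.

(** Coprimality of the coordinates in Bezout form: it gives surjectivity of [ip n] at once and can
    be transported along integral maps without a gcd. *)
Definition primitive n : Prop := exists m, ip n m = 1.

Lemma ipDr n v w : ip n (v + w) = ip n v + ip n w.
Proof. by rewrite /ip !mxE; ring. Qed.

Lemma ipNr n v : ip n (- v) = - ip n v.
Proof. by rewrite /ip !mxE; ring. Qed.

Lemma ipBr n v w : ip n (v - w) = ip n v - ip n w.
Proof. by rewrite ipDr ipNr. Qed.

Lemma ipZr n (a : int) v : ip n (a *: v) = a * ip n v.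
Proof. by rewrite /ip !mxE; ring. Qed.

Lemma ipDl n m v : ip (n + m) v = ip n v + ip m v.
Proof. by rewrite /ip !mxE; ring. Qed.

Lemma ipNl n v : ip (- n) v = - ip n v.
Proof. by rewrite /ip !mxE; ring. Qed.

Lemma ipZl n (a : int) v : ip (a *: n) v = a * ip n v.
Proof. by rewrite /ip !mxE; ring. Qed.

Lemma mulz_eq1 (a b : int) : a * b = 1 -> a = 1 \/ a = -1.
Proof.
rewrite mulrC => /intUnitRing.unitzPl; rewrite qualifE /=.
by case/orP => /eqP; [left|right].
Qed.

Lemma primitive_neq0 n : primitive n -> n != 0.
Proof.
by case=> m nm; apply: contra_eq_neq nm => ->; rewrite /ip !mxE; lia.
Qed.

(** The normal is the quarter turn of [d] divided by the gcd [g] of its coordinates; the Bezout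
    coefficients give the vector on which it takes the value 1. *)
Lemma primitive_perp d : d != 0 ->
  exists n g, [/\ 0 < g, primitive n &
    forall v, g * ip n v = d 0 0 * v 0 1 - d 0 1 * v 0 0].
Proof.
move=> d0; have [a [b ab]] := Bezoutz (d 0 0) (d 0 1).
set g := gcdz _ _ in ab.
have /dvdzP[s sE] := dvdz_gcdl (d 0 0) (d 0 1).
have /dvdzP[t tE] := dvdz_gcdr (d 0 0) (d 0 1).
rewrite -/g in sE tE.
have g0 : 0 < g.
  rewrite lt_neqAle eq_sym gcdz_eq0 lez_nat andbT.
  by apply: contra d0 => /andP[/eqP h0 /eqP h1]; apply/eqP/rV2P; rewrite mxE.
exists (\row_j [:: - t; s]`_j), g; split=> //.
  exists (\row_j [:: - b; a]`_j); rewrite /ip !mxE /=.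
  apply: (mulfI (lt0r_neq0 g0)); rewrite mulr1 -[RHS]ab sE tE; ring.
by move=> v; rewrite /ip !mxE /= sE tE; ring.
Qed.

(** Proportionality makes [n'] the multiple of [n] by [ip n' m], and this integer has the inverse
    [ip n m']. *)
Lemma primitive_det0 n n' : primitive n -> primitive n' ->
  n 0 0 * n' 0 1 = n 0 1 * n' 0 0 -> n' = n \/ n' = - n.
Proof.
move=> [m nm] [m' nm'] det0.
have n'E : n' = ip n' m *: n.
  apply/rV2P; rewrite !mxE -[LHS]mulr1 -nm /ip mulrDr mulrDl.
    by rewrite [n' 0 1 * _ * _]mulrAC [n' 0 1 * _]mulrC det0; ring.
  rewrite [n' 0 0 * _ * _]mulrAC [n' 0 0 * _]mulrC -det0; ring.
have : ip n' m * ip n m' = 1 by rewrite -ipZl -n'E.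
by case/mulz_eq1 => e; rewrite n'E e ?scale1r ?scaleN1r; [left|right].
Qed.

Lemma primitive_parallel n n' d : primitive n -> primitive n' -> d != 0 ->
ip n d = 0 -> ip n' d = 0 -> n' = n \/ n' = - n.
Proof.
move=> pn pn' d0 nd nd'; apply: primitive_det0 => //.
have e0 : (n 0 0 * n' 0 1 - n 0 1 * n' 0 0) * d 0 0 = 0.
  have -> : (n 0 0 * n' 0 1 - n 0 1 * n' 0 0) * d 0 0 =
    n' 0 1 * ip n d - n 0 1 * ip n' d by rewrite /ip; ring.
  by rewrite nd nd' !mulr0 subrr.
have e1 : (n 0 0 * n' 0 1 - n 0 1 * n' 0 0) * d 0 1 = 0.
  have -> : (n 0 0 * n' 0 1 - n 0 1 * n' 0 0) * d 0 1 =
    n 0 0 * ip n' d - n' 0 0 * ip n d by rewrite /ip; ring.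
  by rewrite nd nd' !mulr0 subrr.
apply/eqP; rewrite -subr_eq0; apply: contraNT d0 => ne.
move/eqP: e0; move/eqP: e1; rewrite !mulf_eq0 (negPf ne) /=.
by move=> /eqP h1 /eqP h0; apply/eqP/rV2P; rewrite mxE.
Qed.

End IntegerPlane.

(** * Uniqueness of the dimension *)

Section Dimension.
Variable R : realType.

Lemma has_dim_inj n (S : set 'rV[R]_n) d d' :
  has_dim S d -> has_dim S d' -> d = d'.
Proof.
suff le (x x' : 'rV[R]_n) (U U' : {vspace 'rV[R]_n}) :
    aff_hull S = [set x + u | u in [set u | u \in U]] ->
    aff_hull S = [set x' + u | u in [set u | u \in U']] ->
    (U <= U')%VS.
  move=> [x [U [<- hU]]] [x' [U' [<- hU']]]; congr (\dim _).
  by apply/eqP; rewrite eqEsubv (le _ _ _ _ hU hU') (le _ _ _ _ hU' hU).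
move=> hU hU'; apply/subvP => u uU.
have [a /= aU' xE] : [set x' + u | u in [set u | u \in U']] x.
  by rewrite -hU' hU; exists 0; rewrite /= ?mem0v ?addr0.
have [b /= bU' uE] : [set x' + u | u in [set u | u \in U']] (x + u).
  by rewrite -hU' hU; exists u.
rewrite (_ : u = b - a) ?memvB //.
by apply: (addrI x); rewrite -uE -xE [_ + a + _]addrAC -addrA subrK // addrA.
Qed.

(** A form constant on [S] is constant on the affine hull, here the whole plane; comparing the
    points [l] and 0 gives [dot l l = 0]. *)
Lemma has_dim2_noncollinear (S : set 'rV[R]_2) : has_dim S 2 -> noncollinear S.
Proof.
move=> [x [U [dU SU]]] l c l0; apply: contrapT => h.
have hS y : S y -> dot l y = c.
  by move=> Sy; apply/eqP; apply: contrapT => /negP ne; apply: h; exists y.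
have ST y : aff_hull S y.
  have UE : U = fullv.
    by apply/eqP; rewrite eqEdim subvf dimvf dU dim_matrix.
  by rewrite SU; exists (y - x); rewrite /= ?UE ?memvf // addrC subrK.
have := dot_gt0 l0; rewrite (aff_hull_dot hS (ST l)).
by rewrite -(aff_hull_dot hS (ST 0)) dot0r ltxx.
Qed.
End Dimension.

(** * Edges of lattice polygons *)

Section Edges.
Variable R : realType.
Local Notation E := 'rV[R]_2.
Local Notation Z := 'rV[int]_2.
Implicit Types (m n v w : Z) (x y l : E) (P F : set E) (c : int).

Lemma embE v i : emb R v 0 i = (v 0 i)%:~R.
Proof. by rewrite mxE. Qed.

Lemma embD v w : emb R (v + w) = emb R v + emb R w.
Proof. by apply/rowP => i; rewrite !mxE rmorphD. Qed.

Lemma embN v : emb R (- v) = - emb R v.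
Proof. by apply/rowP => i; rewrite !mxE rmorphN. Qed.

Lemma embB v w : emb R (v - w) = emb R v - emb R w.
Proof. by rewrite embD embN. Qed.

Lemma embZ (a : int) v : emb R (a *: v) = a%:~R *: emb R v.
Proof. by apply/rowP => i; rewrite !mxE rmorphM. Qed.

Lemma emb_inj : injective (@emb R 2).
Proof.
by move=> v w /rowP h; apply/rowP => i; have := h i; rewrite !mxE => /intr_inj.
Qed.

Lemma emb_eq0 v : (emb R v == 0) = (v == 0).
Proof.
rewrite -(inj_eq emb_inj) (_ : emb R 0 = 0) //.
by apply/rowP => i; rewrite !mxE.
Qed.

Lemma dot_emb n v : dot (emb R n) (emb R v) = (ip n v)%:~R.
Proof. by rewrite dot2 !embE /ip rmorphD !rmorphM. Qed.

Definition edge_normal P n : Prop :=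
  primitive n /\
  exists x y, [/\ x != y, min_face P (emb R n) x & min_face P (emb R n) y].

(** The same notion with the level [c] recorded and with lattice points on the edge, for integer
    arithmetic. [edge_normal], which asks for real points only, is the form that is transported
    along affine maps and normal fans. *)
Definition edge P n c : Prop :=
  [/\ primitive n,
      exists v w, [/\ v != w, P (emb R v), P (emb R w), ip n v = c & ip n w = c]
    & forall x, P x -> c%:~R <= dot (emb R n) x].

Lemma conv_hull_const (S : set E) x y :
  (forall z, S z -> z = y) -> conv_hull S x -> x = y.
Proof.
move=> Sy [k [a [p [_ a1 Sp ->]]]].
under eq_bigr do rewrite (Sy _ (Sp _)).
by rewrite -scaler_suml a1 scale1r.
Qed.

Lemma min_face_lat P l x : (exists V : seq Z, P = conv_lat V) -> min_face P l x ->
  exists v, min_face P l (emb R v).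
Proof.
move=> [V ->] /min_face_conv /conv_hull_sub_aff hx.
have [y [[v _ <-] hv]] := aff_hull_neq0 (ex_intro _ x hx).
by exists v.
Qed.

(** A face is the hull of the generators on it, so a face with a single lattice point would be a
    single point. *)
Lemma min_face_lat2 P l x y : (exists V : seq Z, P = conv_lat V) -> x != y ->
  min_face P l x -> min_face P l y ->
  exists v w, [/\ v != w, min_face P l (emb R v) & min_face P l (emb R w)].
Proof.
move=> PV xy lx ly; have [v lv] := min_face_lat PV lx.
case: PV lx ly lv => V -> lx ly lv; apply: contrapT => nw.
have hv z : ([set emb R v | v in [set` V]] `&` min_face (conv_lat V) l) z ->
    z = emb R v.
  move=> [[w wV <-] lw]; congr emb; apply/eqP; rewrite eq_sym.
  by apply: contrapT => /negP vw; apply: nw; exists v, w.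
move/eqP: xy; apply.
by rewrite (conv_hull_const hv (min_face_conv lx))
  (conv_hull_const hv (min_face_conv ly)).
Qed.

Lemma edge_normalP P n : (exists V : seq Z, P = conv_lat V) ->
  edge_normal P n <-> exists c, edge P n c.
Proof.
move=> PV; split=> [[pn [x [y [xy nx ny]]]]|[c [pn [v [w [vw Pv Pw vc wc]]] cmin]]].
  have [v [w [vw nv nw]]] := min_face_lat2 PV xy nx ny.
  exists (ip n v); split=> //; last by case: nv => _ h z /h; rewrite dot_emb.
  exists v, w; split=> //; [by case: nv|by case: nw|].
  apply/eqP; rewrite -(eqr_int R) -!dot_emb eq_le.
  by case: nv => Pv hv; case: nw => Pw hw; rewrite hv ?hw.
split=> //; exists (emb R v), (emb R w).
split; rewrite ?(inj_eq emb_inj) //; split=> // z; rewrite dot_emb ?vc ?wc.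
- exact: cmin.
- exact: cmin.
Qed.

Lemma edge_min_face P n c x : edge P n c ->
  min_face P (emb R n) x <-> P x /\ dot (emb R n) x = c%:~R.
Proof.
move=> [_ [v [_ [_ Pv _ vc _]]] cmin]; split=> [[Px h]|[Px xc]].
  split=> //; apply/eqP; rewrite eq_le cmin // andbT.
  by rewrite -vc -dot_emb h.
by split=> // y /cmin; rewrite xc.
Qed.

Lemma edge_lat P n c v : edge P n c -> P (emb R v) -> c <= ip n v.
Proof. by move=> [_ _ h] /h; rewrite dot_emb ler_int. Qed.

Lemma edge_inj P n c c' : edge P n c -> edge P n c' -> c = c'.
Proof.
move=> e e'; have [_ [v [_ [_ Pv _ vc _]]] _] := e.
have [_ [w [_ [_ Pw _ wc _]]] _] := e'.
by apply/eqP; rewrite eq_le -{1}wc (edge_lat e) // -vc (edge_lat e').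
Qed.

(** Otherwise all generators, hence [P], would lie on the line of the edge. *)
Lemma edge_interior P n c : noncollinear P -> (exists V : seq Z, P = conv_lat V) ->
  edge P n c -> exists2 v, P (emb R v) & c < ip n v.
Proof.
move=> nc [V PV] e; apply: contrapT => nv.
have [|x Px /eqP] := nc (emb R n) c%:~R.
  by rewrite emb_eq0; case: e => /primitive_neq0.
case; rewrite PV in Px; apply: aff_hull_dot (conv_hull_sub_aff Px) => _ [v vV <-].
have Pv : P (emb R v) by rewrite PV; apply: sub_conv_hull; exists v.
apply/eqP; rewrite dot_emb eqr_int eq_le (edge_lat e) // andbT leNgt.
by apply/negP => cv; apply: nv; exists v.
Qed.

(** A point outside [P] is cut off by the line through two generators; the primitive inner normal of
    that line is an edge normal, and its inequality fails at the point. *)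
Lemma mem_edges P x : noncollinear P -> (exists V : seq Z, P = conv_lat V) ->
  (forall n c, edge P n c -> c%:~R <= dot (emb R n) x) -> P x.
Proof.
move=> nc [V PV] hx; apply: contrapT => nPx.
have V0 : V != [::].
  have [|y + _] := nc (emb R (pt 1 0)) 0.
    by rewrite emb_eq0; apply/eqP => /rowP/(_ 0); rewrite !mxE /=.
  rewrite PV => /conv_hull_sub_aff Py.
  have [_ [v vV _]] := aff_hull_neq0 (ex_intro (aff_hull _) y Py).
  by apply/eqP => V0; move: vV; rewrite V0.
have PVE : P = conv_hull [set` [seq emb R v | v <- V]].
  rewrite PV /conv_lat; congr conv_hull; apply/seteqP; split=> y /=.
    by move=> [v vV <-]; exact: map_f.
  by move=> /mapP[v vV ->]; exists v.
rewrite PVE in nPx nc.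
have [|p [q [/mapP[v vV ->] /mapP[w wV ->] hV sep]]] := edge_separation _ nc nPx.
  by rewrite -size_eq0 size_map size_eq0.
have d0 : w - v != 0.
  apply: contraTneq sep => /subr0_eq ->.
  by rewrite -leNgt subrr /det2 !mxE !mul0r subrr.
have [n [g [g0 pn gE]]] := primitive_perp d0.
have gR : 0 < g%:~R :> R by rewrite ltr0z.
(* The side of the line on which [y] lies is thus the sign of an integral form, since the factor [g]
   is positive. *)
have gdot y : det2 (emb R w - emb R v) (y - emb R v) =
    g%:~R * dot (emb R n) (y - emb R v).
  have gn0 : g * n 0 0 = - (w - v) 0 1.
    by have := gE (pt 1 0); rewrite /ip !mxE /= !mulr1 !mulr0 addr0 sub0r.
  have gn1 : g * n 0 1 = (w - v) 0 0.
    by have := gE (pt 0 1); rewrite /ip !mxE /= !mulr1 !mulr0 add0r subr0.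
  rewrite dot2 !embE mulrDr !mulrA -!intrM gn0 gn1 -embB /det2 !embE.
  by rewrite rmorphN /=; ring.
have Vn u : u \in V -> ip n v <= ip n u.
  move=> uV; have := hV _ (map_f _ uV).
  by rewrite gdot pmulr_rge0 // dotBr !dot_emb subr_ge0 ler_int.
have VP u : u \in V -> P (emb R u).
  by move=> uV; rewrite PV; apply: sub_conv_hull; exists u.
have wn : ip n w = ip n v.
  apply/eqP; rewrite -subr_eq0 -ipBr -(mulrI_eq0 _ (mulfI (lt0r_neq0 g0))) gE.
  by apply/eqP; ring.
have e : edge P n (ip n v).
  split=> //.
    exists v, w; split=> //; [|exact: VP|exact: VP].
    by apply: contra d0 => /eqP ->; rewrite subrr.
  move=> y; rewrite PV; apply: conv_hull_dot_ge => _ [u uV <-].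
  by rewrite dot_emb ler_int Vn.
have := hx _ _ e; rewrite leNgt => /negP; apply.
by move: sep; rewrite gdot pmulr_rlt0 // dotBr dot_emb subr_lt0.
Qed.

End Edges.

(** * Facets as edges, and relations between two edges *)

Section Facets.
Variables (R : realType) (P : set 'rV[R]_2).
Local Notation E := 'rV[R]_2.
Local Notation Z := 'rV[int]_2.
Implicit Types (m n v w : Z) (x y l : E) (F : set E) (c : int).
Hypothesis PV : exists V : seq Z, P = conv_lat V.
Hypothesis dimP : has_dim P 2.

Let ncP : noncollinear P := has_dim2_noncollinear dimP.

(** A one-dimensional face contains two lattice points, so the real form defining it is
    perpendicular to a lattice vector and hence a real multiple of a primitive integral form. *)
Lemma facetP F :
  facet P F <-> exists n c, edge P n c /\ F = min_face P (emb R n).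
Proof.
split=> [[[l ->] [d [dP dF]]]|[n [c [e ->]]]].
  have [d1] : d.+1 = 2%N := has_dim_inj dP dimP.
  move: dF; rewrite d1; set F0 := min_face P l => dF.
  have [u F0u] : F0 !=set0.
    apply: aff_hull_neq0; case: dF => x [U [_ ->]].
    by exists (x + 0); exists 0; rewrite //= mem0v.
  have [v [w [vw lv lw]]] : exists v w,
      [/\ v != w, F0 (emb R v) & F0 (emb R w)].
    have [xy|xy] := pselect (exists x y, [/\ x != y, F0 x & F0 y]).
      by case: xy => x [y [xy lx ly]]; exact: min_face_lat2 xy lx ly.
    have F0E y : F0 y -> y = u.
      move=> F0y; apply: contrapT => /eqP yu.
      by apply: xy; exists y, u.
    case: dF => x [U [dU xU]].
    have U0 : U = 0%VS.
      apply/eqP; rewrite -subv0; apply/subvP => z zU.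
      have aE y : aff_hull F0 y -> y = u.
        move=> [k [a [p [a1 Sp ->]]]].
        under eq_bigr do rewrite (F0E _ (Sp _)).
        by rewrite -scaler_suml a1 scale1r.
      have /aE xu : aff_hull F0 (x + 0) by rewrite xU; exists 0; rewrite //= mem0v.
      have /aE : aff_hull F0 (x + z) by rewrite xU; exists z.
      by rewrite -xu => /addrI ->; rewrite mem0v.
    by move: dU; rewrite U0 dimv0.
  (* For [l = 0] the face would be all of [P], whose dimension is 2 and not 1. *)
  have l0 : l != 0.
    apply/eqP => l0; suff F0P : F0 = P.
      by have := has_dim_inj dF; rewrite F0P => /(_ _ dimP).
    apply/seteqP; split=> [x [] //|x Px]; split=> // y _.
    by rewrite l0 !dot0l.
  have d0 : w - v != 0 by rewrite subr_eq0 eq_sym.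
  have [n [g [g0 pn gE]]] := primitive_perp d0.
  have nd : ip n (w - v) = 0.
    apply/eqP; rewrite -(mulrI_eq0 _ (mulfI (lt0r_neq0 g0))) gE.
    by apply/eqP; ring.
  have ld : dot l (emb R (w - v)) = 0.
    rewrite embB dotBr; apply/eqP; rewrite subr_eq0 eq_le.
    by case: lv => Pv hv; case: lw => Pw hw; rewrite hv ?hw.
  have [t lE] : exists t, l = t *: emb R n.
    apply: (@perp_colinear R (emb R (w - v))).
    - by rewrite emb_eq0.
    - by rewrite emb_eq0 primitive_neq0.
    - by rewrite dot_emb /ip mulrC [X in _ + X]mulrC -/(ip n _) nd.
    - by rewrite -ld !dot2; ring.
  have {}F0E s m : 0 < s -> l = s *: emb R m -> F0 = min_face P (emb R m).
    move=> s0 lsm; apply/seteqP; split=> x [Px hx]; split=> // y Py.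
      by have := hx y Py; rewrite lsm !dotZl ler_pM2l.
    by rewrite lsm !dotZl ler_pM2l // hx.
  have edgeN m : F0 = min_face P (emb R m) -> primitive m ->
      exists n c, edge P n c /\ F0 = min_face P (emb R n).
    move=> Fm pm; have [c e] : exists c, edge P m c.
      apply/edge_normalP => //; split=> //; exists (emb R v), (emb R w).
      by rewrite -Fm; split=> //; rewrite (inj_eq (@emb_inj R)).
    by exists m, c.
  (* Only the sign of the factor matters: it decides between the inner normals [n] and [- n]. *)
  have [t0|t0|t0] := ltgtP 0 t.
  - by apply: (edgeN n) => //; exact: F0E lE.
  - apply: (edgeN (- n)); last first.
      by case: pn => m nm; exists (- m); rewrite ipNl ipNr opprK.
    by apply: (F0E (- t)); rewrite ?oppr_gt0 // embN scalerN scaleNr opprK.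
  - by move: l0; rewrite lE -t0 scale0r eqxx.
split; first by exists (emb R n).
exists 1%N; split=> //.
have [pn [v [w [vw Pv Pw vc wc]]] _] := e.
set d := emb R (w - v).
have d0 : d != 0 by rewrite emb_eq0 subr_eq0 eq_sym.
exists (emb R v), <[d]>%VS; split; first by rewrite dim_vline d0.
have nd : dot (emb R n) d = 0 by rewrite /d embB dotBr !dot_emb vc wc subrr.
have fv : min_face P (emb R n) (emb R v) by apply/(edge_min_face _ e); rewrite dot_emb vc.
have fw : min_face P (emb R n) (emb R w) by apply/(edge_min_face _ e); rewrite dot_emb wc.
apply/seteqP; split=> [x hx|_ [_ /vlineP[t ->] <-]].
  have xc : dot (emb R n) x = c%:~R.
    by apply: aff_hull_dot hx => y /(edge_min_face _ e)[].
  have [||t xE] := @perp_colinear R (emb R n) d (x - emb R v) _ d0 nd.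
  - by rewrite emb_eq0 primitive_neq0.
  - by rewrite dotBr xc dot_emb vc subrr.
  by exists (x - emb R v); rewrite /= ?xE ?memvZ ?memv_line // -xE addrC subrK.
exists 2%N, (fun i => if i == 0 then 1 - t else t),
  (fun i => if i == 0 then emb R v else emb R w); split.
- by rewrite sum_ord2 /= subrK.
- by move=> i; case: ifP.
- rewrite sum_ord2 /= /d embB scalerBl scale1r scalerBr.
  by rewrite addrA addrAC.
Qed.

Lemma edge_opp_neq n c c' : edge P n c -> edge P (- n) c' -> forall v w,
  P (emb R v) -> P (emb R w) -> ip n v = c -> ip n w = c -> 
  ip (- n) v = c' -> False.
Proof.
move=> e e' v w Pv Pw vc wc vc'.
have [u Pu cu] := edge_interior ncP PV e.
by have := edge_lat e' Pu; rewrite -vc' !ipNl vc lerN2 leNgt cu.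
Qed.

(** This is the source of test points. If both lattice points of the second edge lay on the first,
    the normals would be equal or opposite, and [edge_opp_neq] excludes the latter. *)
Lemma edge_cross n c n' c' : edge P n c -> edge P n' c' -> n != n' ->
  exists v, [/\ P (emb R v), ip n' v = c' & c < ip n v].
Proof.
move=> e e' nn'; have [pn _ _] := e.
have [pn' [v [w [vw Pv Pw vc' wc']]] _] := e'.
have [vc|vc] := eqVneq (ip n v) c; last first.
  by exists v; split=> //; rewrite lt_neqAle eq_sym vc (edge_lat e).
have [wc|wc] := eqVneq (ip n w) c; last first.
  by exists w; split=> //; rewrite lt_neqAle eq_sym wc (edge_lat e).
have d0 : w - v != 0 by rewrite subr_eq0 eq_sym.
have [] := primitive_parallel pn pn' d0.
- by rewrite ipBr vc wc subrr.
- by rewrite ipBr vc' wc' subrr.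
- by move/eqP; rewrite eq_sym (negPf nn').
move=> n'E; rewrite n'E in e' vc'.
by have := edge_opp_neq e e' Pv Pw vc wc vc'.
Qed.

Lemma dot_bounded l : exists B, forall x, P x -> dot l x <= B.
Proof.
case: PV => V ->; have [B hB] : exists B, forall v, v \in V -> dot l (emb R v) <= B.
  elim: V => [|v V [B hB]]; first by exists 0.
  exists (Num.max B (dot l (emb R v))) => w; rewrite inE le_max.
  by case/orP => [/eqP ->|/hB ->//]; rewrite lexx orbT.
exists B => x Px; rewrite -[leLHS]opprK lerNl.
rewrite -dotNl; apply: conv_hull_dot_ge Px => _ [v vV <-].
by rewrite dotNl lerN2 hB.
Qed.

(** All [w + k v] with [k] a natural number would satisfy the edge inequalities and lie in [P], but
    the form of [v] is bounded on [P]. *)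
Lemma edges_recession v : (forall n c, edge P n c -> 0 <= ip n v) -> v = 0.
Proof.
move=> hv; apply/eqP; apply: contrapT => /negP; rewrite -(emb_eq0 R).
move=> /dot_gt0 vv; have [B hB] := dot_bounded (emb R v).
have [w Pw] : exists w, P (emb R w).
  have [|x Px _] := ncP (l := emb R (pt 1 0)) 0.
    by rewrite emb_eq0; apply/eqP => /rowP/(_ 0); rewrite !mxE /=.
  have [] := @min_face_lat _ P 0 x PV; last by move=> w [Pw _]; exists w.
  by split=> // y _; rewrite !dot0l.
have Pk k : P (emb R (w + k%:Z *: v)).
  apply: mem_edges => // n c e; rewrite dot_emb ler_int ipDr ipZr.
  by rewrite (le_trans (edge_lat e Pw)) // lerDl mulr_ge0 // (hv _ c).
set D := (B - dot (emb R v) (emb R w)) / dot (emb R v) (emb R v).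
have := hB _ (Pk (Num.truncn `|D|).+1); apply/negP; rewrite -ltNge.
rewrite embD embZ dotDr dotZr -ltrBlDl -ltr_pdivrMr // -/D.
by rewrite (le_lt_trans (ler_norm D)) // truncnS_gt.
Qed.

End Facets.

(** * Column vectors *)

Definition base_normal (R : realType) (P : set 'rV[R]_2) (n v : 'rV[int]_2) :=
  [/\ edge_normal P n, ip n v = -1
    & forall m, edge_normal P m -> m != n -> 0 <= ip m v].

(** The standing assumptions apart from the existence of a column vector, which for the examples is
    known only once their column vectors have been computed. *)
Definition lattice_polygon (R : realType) (P : set 'rV[R]_2) : Prop :=
  [/\ exists V : seq 'rV[int]_2, P = conv_lat V, has_dim P 2 &
      forall M, affine_lattice M -> [set emb R x | x in lat P] `<=` M ->
        range (@emb R 2) `<=` M].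

Lemma zmod_morphism_scale (h : 'rV[int]_2 -> int) (a : int) v :
  zmod_morphism h -> h (a *: v) = a * h v.
Proof.
move=> hB.
have h0 : h 0 = 0 by rewrite -(subrr 0) hB subrr.
have hN x : h (- x) = - h x by rewrite -sub0r hB h0 sub0r.
have hD x y : h (x + y) = h x + h y by rewrite -{1}[y]opprK hB hN opprK.
elim/int_ind: a => [|k IH|k IH].
- by rewrite scale0r h0 mul0r.
- by rewrite intS scalerDl scale1r hD IH mulrDl mul1r.
- by rewrite intS opprD scalerDl scaleN1r hD hN IH mulrDl mulN1r.
Qed.

Lemma emb_norm_ge1 (R : realType) (g : 'rV[int]_2) :
  g != 0 -> 1 <= `|emb R g|.
Proof.
move=> g0; have ne : `|emb R g| != 0 by rewrite normr_eq0 emb_eq0.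
have [[i j] /= gE] := mx_norm_neq0 ne.
rewrite [leRHS]gE mxE -intr_norm ler1z.
suff : g i j != 0 by lia.
by apply: contraNneq ne => e; rewrite [X in X == _]gE mxE e normr0.
Qed.

Section Columns.
Variables (R : realType) (P : set 'rV[R]_2).
Local Notation E := 'rV[R]_2.
Local Notation Z := 'rV[int]_2.
Implicit Types (m n v w u x : Z) (F : set E) (c : int).
Hypothesis hP : lattice_polygon P.

Let PV : exists V : seq Z, P = conv_lat V. Proof. by case: hP. Qed.
Let dimP : has_dim P 2. Proof. by case: hP. Qed.
Let ncP : noncollinear P := has_dim2_noncollinear dimP.

Lemma min_face_normal_inj n m : edge_normal P n -> edge_normal P m ->
  min_face P (emb R n) = min_face P (emb R m) -> n = m.
Proof.
move=> /(edge_normalP _ PV)[c e] /(edge_normalP _ PV)[c' e'] fE.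
apply/eqP; apply: contrapT => /negP nm.
have [v [Pv vc' cv]] := edge_cross PV dimP e e' nm.
have : min_face P (emb R m) (emb R v).
  by apply/(edge_min_face _ e'); rewrite dot_emb vc'.
rewrite -fE => /(edge_min_face _ e)[_ /eqP]; rewrite dot_emb eqr_int => /eqP vc.
by rewrite vc ltxx in cv.
Qed.

(** A height kills the direction of the edge, hence every [u] with [ip n u = 0], hence is a multiple
    of [ip n]; surjectivity and the minimum on the edge fix the factor. *)
Lemma heightE n v : edge_normal P n ->
  height P (min_face P (emb R n)) v = ip n v.
Proof.
move=> /(edge_normalP _ PV)[c e].
suff -> : height P (min_face P (emb R n)) = ip n by [].
have [[m nm] [p [q [pq Pp Pq pc qc]]] cmin] := e.
apply: xget_unique => [|h [hB hs hF hmin]].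
  split=> [x y||x y Fx Fy|x y Px /(edge_min_face _ e)[_ xc] Py].
  - exact: ipBr.
  - by apply/seteqP; split=> // a _; exists (a *: m) => //; rewrite ipZr nm mulr1.
  - have aff z : aff_hull (min_face P (emb R n)) (emb R z) -> ip n z = c.
      move=> hz; apply/eqP; rewrite -(eqr_int R) -dot_emb; apply/eqP.
      by apply: aff_hull_dot hz => y' /(edge_min_face _ e)[].
    by rewrite ipBr !aff // subrr.
  - by rewrite -(ler_int R) -!dot_emb xc cmin.
have face z : P (emb R z) -> ip n z = c -> min_face P (emb R n) (emb R z).
  by move=> Pz zc; apply/(edge_min_face _ e); rewrite dot_emb zc.
have d0 : q - p != 0 by rewrite subr_eq0 eq_sym.
have nd : ip n (q - p) = 0 by rewrite ipBr qc pc subrr.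
have hd : h (q - p) = 0 by apply: hF; apply: sub_aff_hull; exact: face.
have hperp u : ip n u = 0 -> h u = 0.
  move=> nu.
  have det0 : (q - p) 0 0 * u 0 1 = (q - p) 0 1 * u 0 0.
    apply/eqP; rewrite -subr_eq0; set D := _ - _.
    have : ip n m * D = ip n (q - p) * (m 0 0 * u 0 1 - m 0 1 * u 0 0)
       - ip n u * (m 0 0 * (q - p) 0 1 - m 0 1 * (q - p) 0 0).
      by rewrite /D /ip; ring.
    by rewrite nm nd nu mul1r !mul0r subrr => ->.
  (* Division is avoided: the multiples of [u] by the coordinates of [q - p] are multiples of
     [q - p], and one of these coordinates is nonzero. *)
  have e0 : (q - p) 0 0 *: u = u 0 0 *: (q - p).
    by apply/rV2P; rewrite [LHS]mxE [RHS]mxE ?det0 mulrC.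
  have e1 : (q - p) 0 1 *: u = u 0 1 *: (q - p).
    by apply/rV2P; rewrite [LHS]mxE [RHS]mxE -?det0 mulrC.
  have := zmod_morphism_scale ((q - p) 0 0) u hB.
  have := zmod_morphism_scale ((q - p) 0 1) u hB.
  rewrite e0 e1 !zmod_morphism_scale // hd !mulr0.
  move=> /esym/eqP; rewrite mulf_eq0 => /orP[/eqP h1|/eqP -> //].
  move=> /esym/eqP; rewrite mulf_eq0 => /orP[/eqP h0|/eqP -> //].
  by case/eqP: d0; apply/rV2P; rewrite [RHS]mxE.
have hE u : h u = ip n u * h m.
  rewrite -zmod_morphism_scale //; apply/eqP; rewrite -subr_eq0 -hB.
  by rewrite hperp // ipBr ipZr nm mulr1 subrr.
have [a _ ha] : range h 1 by rewrite hs.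
(* Surjectivity leaves the factors 1 and -1; with -1 the edge would carry the maximum instead of the
   minimum. *)
move: ha; rewrite hE mulrC => /mulz_eq1[hm|hm].
  by apply/funext => u; rewrite hE hm mulr1.
have [u Pu cu] := edge_interior ncP PV e.
have := hmin p u Pp (face _ Pp pc) Pu.
by rewrite (hE p) (hE u) hm !mulrN1 lerN2 pc leNgt cu.
Qed.

Lemma edge_normal_recession v :
  (forall n, edge_normal P n -> 0 <= ip n v) -> v = 0.
Proof.
move=> hv; apply: (edges_recession PV dimP) => n c e.
by apply: hv; apply/(edge_normalP _ PV); exists c.
Qed.

(* The lattice generation hypothesis forces a column vector to lower the
   height over its base by exactly [1]: all heights are multiples of the
   height of [v]. *)
Lemma is_baseP n v : edge_normal P n -> v != 0 ->
  is_base P v (min_face P (emb R n)) <-> base_normal P n v.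
Proof.
move=> en v0; have [c e] := (edge_normalP n PV).1 en.
have [[k nk] [p [_ [_ Pp _ pc _]]] _] := e.
have offP (x : Z) : P (emb R x) ->
    ~ min_face P (emb R n) (emb R x) <-> c < ip n x.
  move=> Px; rewrite (edge_min_face _ e) dot_emb; split=> [xc|cx [_ /eqP]].
    rewrite lt_neqAle (edge_lat e) // andbT; apply/eqP => cE.
    by apply: xc; rewrite cE.
  by rewrite eqr_int gt_eqF.
split=> [[_ hv]|[_ nv hv]]; last first.
  split=> [|x Px /(offP _ Px) cx].
    by apply/(facetP PV dimP); exists n, c.
  apply: (mem_edges ncP PV) => m d em; rewrite dot_emb ler_int ipDr.
  have [mE|mn] := eqVneq m n; last first.
    rewrite (le_trans (edge_lat em Px)) // lerDl hv //.
    by apply/(edge_normalP _ PV); exists d.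
  by rewrite mE in em *; rewrite (edge_inj em e) nv; lia.
(* A lattice point on the edge of [m] and off the edge of [n] may be translated by [v], and it must
   not cross the edge of [m]. *)
have hm m : edge_normal P m -> m != n -> 0 <= ip m v.
  move=> /(edge_normalP _ PV)[d em] mn.
  have [|x [Px xd cx]] := edge_cross PV dimP e em; first by rewrite eq_sym.
  have := edge_lat em (hv x Px ((offP _ Px).2 cx)).
  by rewrite ipDr xd lerDl.
split=> //; have nv : ip n v < 0.
  rewrite ltNge; apply: contra v0 => nv; apply/eqP.
  by apply: edge_normal_recession => m em; have [->//|/hm] := eqVneq m n; apply.
(* Translating by [v] lowers the height by a fixed amount until the base edge is reached exactly, by
   induction on a bound [j] for the height above the edge. *)
have step : forall j (x : Z), P (emb R x) -> ip n x - c <= j%:Z ->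
    (ip n v %| ip n x - c)%Z.
  elim=> [|j IH] x Px hj; have [xc|xc] := eqVneq (ip n x) c.
  - by rewrite xc subrr dvdz0.
  - by have := edge_lat e Px; move/eqP: xc; lia.
  - by rewrite xc subrr dvdz0.
  have cx : c < ip n x by rewrite lt_neqAle eq_sym xc (edge_lat e Px).
  have Pxv := hv x Px ((offP _ Px).2 cx).
  have /dvdzP[q qE] : (ip n v %| ip n (x + v) - c)%Z.
    by apply: IH Pxv _; rewrite ipDr; lia.
  apply/dvdzP; exists (q - 1); rewrite mulrBl mul1r -qE ipDr; ring.
(* The translate of [G] by [p] contains all lattice points of [P], so it contains [p + k], whose
   height above the edge is 1; thus [ip n v] divides 1. *)
pose G : set E := [set emb R g | g in [set g : Z | (ip n v %| ip n g)%Z]].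
have [_ _ gen] := hP.
have [|||_ [g ng <-] gE] := gen [set emb R p + g | g in G] _ _ (emb R (p + k)).
- exists (emb R p), G; split=> //.
  + exists 0; last by apply/rowP => i; rewrite !mxE.
    by rewrite /= [ip _ 0]/ip !mxE !mulr0 addr0 dvdz0.
  + move=> _ _ [g ng <-] [h nh <-]; exists (g - h); rewrite ?embB //=.
    move: ng nh; rewrite /= ipBr => /dvdzP[a ->] /dvdzP[b ->].
    by apply/dvdzP; exists (a - b); ring.
  + by exists 1 => // _ [g _ <-]; rewrite emb_eq0; exact: emb_norm_ge1.
- move=> _ [x Px <-]; exists (emb R (x - p)); last by rewrite embB addrC subrK.
  exists (x - p) => //=; rewrite ipBr pc.
  by apply: (step `|ip n x - c|%N) => //; lia.
- by exists (p + k).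
have kE : g = k by move: gE; rewrite embD => /addrI /emb_inj.
move: ng; rewrite /= kE nk dvdz1; lia.
Qed.

Lemma base_normal_neq0 n v : base_normal P n v -> v != 0.
Proof.
case=> _ nv _; apply: contra_eq_neq nv => ->.
by rewrite /ip !mxE !mulr0.
Qed.

Lemma base_normal_inj n m v :
  base_normal P n v -> base_normal P m v -> n = m.
Proof.
move=> [en nv _] [em _ mv]; apply/eqP; apply: contrapT => /negP nm.
by have := mv n en nm; rewrite nv.
Qed.

Lemma ColP v : Col P v <-> exists n, base_normal P n v.
Proof.
split=> [[v0 [F hF]]|[n bn]]; last first.
  have v0 := base_normal_neq0 bn; split=> //; exists (min_face P (emb R n)).
  by apply/is_baseP => //; case: bn.
have [n [c [e FE]]] := (facetP PV dimP F).1 hF.1.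
have en : edge_normal P n by apply/(edge_normalP _ PV); exists c.
by exists n; apply/is_baseP; rewrite -?FE.
Qed.

Lemma baseE n v : base_normal P n v -> base P v = min_face P (emb R n).
Proof.
move=> bn; have v0 := base_normal_neq0 bn.
have hb : is_base P v (min_face P (emb R n)) by apply/is_baseP => //; case: bn.
apply: get_unique => // F hF.
have [m [c [e FE]]] := (facetP PV dimP F).1 hF.1.
have em : edge_normal P m by apply/(edge_normalP _ PV); exists c.
have bm : base_normal P m v by apply/is_baseP; rewrite -?FE.
by rewrite FE (base_normal_inj bn bm).
Qed.

Lemma height_base n w v : base_normal P n w -> height P (base P w) v = ip n v.
Proof. by move=> bn; rewrite (baseE bn) heightE //; case: bn. Qed.

Lemma base_eqP n m u v : base_normal P n u -> base_normal P m v ->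
  base P u = base P v <-> n = m.
Proof.
move=> bn bm; rewrite (baseE bn) (baseE bm); split=> [|-> //].
by apply: min_face_normal_inj; [case: bn|case: bm].
Qed.

(** If [ip m u] is positive, then translation by [u] moves points strictly off the edge of [m].
    Conversely, for [m = n] repeated translation by [u] reaches height 1 over the base and the next
    step lands on it, so no product exists; for [m] different from [n] and [ip m u = 0], a point on
    the edge of [m] and off the edge of [n] stays on the edge of [m]. *)
Lemma prod_existsP n m u v : base_normal P n u -> base_normal P m v ->
  prod_exists P u v <-> u + v != 0 /\ 0 < ip m u.
Proof.
move=> bn bm; have [en nu hu] := bn; have [em mv hv] := bm.
have Cu : Col P u by apply/ColP; exists n.
have Cv : Col P v by apply/ColP; exists m.
have [c e] := (edge_normalP n PV).1 en; have [d f] := (edge_normalP m PV).1 em.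
rewrite /prod_exists (baseE bn) (baseE bm).
have offN x : P (emb R x) -> ~ min_face P (emb R n) (emb R x) -> c < ip n x.
  move=> Px nx; rewrite lt_neqAle (edge_lat e) // andbT; apply/eqP => cx.
  by apply: nx; apply/(edge_min_face _ e); rewrite dot_emb cx.
have onN x : c < ip n x -> ~ min_face P (emb R n) (emb R x).
  by move=> cx /(edge_min_face _ e)[_ /eqP]; rewrite dot_emb eqr_int gt_eqF.
split=> [[_ _ uv0 h]|[uv0 mu]]; split=> //; last first.
  move=> x Px nx /(edge_min_face _ f)[_ /eqP]; rewrite dot_emb eqr_int ipDr.
  by have := edge_lat f Px; lia.
have move_u x : P (emb R x) -> c < ip n x -> P (emb R (x + u)).
  move=> Px cx; apply: (mem_edges ncP PV) => k b ek; rewrite dot_emb ler_int ipDr.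
  have [kE|kn] := eqVneq k n; last first.
    rewrite (le_trans (edge_lat ek Px)) // lerDl hu //.
    by apply/(edge_normalP _ PV); exists b.
  by rewrite kE in ek *; rewrite (edge_inj ek e) nu; lia.
have hit x : P (emb R x) -> c < ip n x -> ip m (x + u) = d -> False.
  move=> Px cx mx; apply: (h x Px (onN x cx)).
  by apply/(edge_min_face _ f); rewrite dot_emb mx; split=> //; exact: move_u.
have [mE|mn] := eqVneq m n.
  have [x Px cx] := edge_interior ncP PV e; rewrite mE in f hit.
  have := edge_inj e f => cd; rewrite -cd {d cd f} in hit.
  suff /(_ `|ip n x - c|%N x Px cx) [] : forall j x, P (emb R x) -> c < ip n x ->
    ip n x - c <= j%:Z -> False by lia.
  elim=> [|j IH] {}x {}Px {}cx hj; first lia.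
  have [c1|c1] := eqVneq (ip n x) (c + 1).
    by apply: (hit x) => //; rewrite ipDr nu c1 addrK.
  by apply: (IH (x + u)); rewrite ?ipDr ?nu; [exact: move_u|lia|lia].
rewrite lt_neqAle hu // andbT eq_sym; apply/eqP => mu.
have [|x [Px xd cx]] := edge_cross PV dimP e f; first by rewrite eq_sym.
by apply: (hit x) => //; rewrite ipDr mu addr0.
Qed.

Lemma lat_finite : finite_set (lat P).
Proof.
have [B0 h0] := dot_bounded PV (emb R (pt 1 0)).
have [B1 h1] := dot_bounded PV (emb R (pt 0 1)).
have [B2 h2] := dot_bounded PV (emb R (- pt 1 0)).
have [B3 h3] := dot_bounded PV (emb R (- pt 0 1)).
pose N := (Num.truncn (`|B0| + `|B1| + `|B2| + `|B3|)).+1.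
have small (a : int) (B : R) : a%:~R <= B ->
    `|B| <= `|B0| + `|B1| + `|B2| + `|B3| -> a <= N%:Z.
  move=> aB BN; rewrite -(ler_int R) (le_trans aB) // (le_trans (ler_norm B)) //.
  by rewrite (le_trans BN) // ltW // truncnS_gt.
have n0 := normr_ge0 B0; have n1 := normr_ge0 B1.
have n2 := normr_ge0 B2; have n3 := normr_ge0 B3.
pose f (q : 'I_(2 * N).+1 * 'I_(2 * N).+1) : Z :=
  pt (q.1%:Z - N%:Z) (q.2%:Z - N%:Z).
apply: (sub_finite_set (B := f @` setT)); last exact/finite_image/finite_finset.
move=> x Px.
have x0 : x 0 0 <= N%:Z.
  apply: (small _ B0); last lra.
  by have := h0 _ Px; rewrite dot_emb /ip !mxE /= mul1r mul0r addr0.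
have x1 : x 0 1 <= N%:Z.
  apply: (small _ B1); last lra.
  by have := h1 _ Px; rewrite dot_emb /ip !mxE /= mul1r mul0r add0r.
have x2 : - x 0 0 <= N%:Z.
  apply: (small _ B2); last lra.
  by have := h2 _ Px; rewrite dot_emb ipNl /ip !mxE /= mul1r mul0r addr0.
have x3 : - x 0 1 <= N%:Z.
  apply: (small _ B3); last lra.
  by have := h3 _ Px; rewrite dot_emb ipNl /ip !mxE /= mul1r mul0r add0r.
have lt0 : (absz (x 0 0 + N%:Z)%R < (2 * N).+1)%N by lia.
have lt1 : (absz (x 0 1 + N%:Z)%R < (2 * N).+1)%N by lia.
exists (Ordinal lt0, Ordinal lt1) => //.
by apply/rV2P; rewrite !mxE /=; lia.
Qed.

(** For a fixed lattice point [x] off the common base, [x + v] is a lattice point of [P] for every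
    column vector [v]. This provides the number in case (d). *)
Lemma single_base_finite n :
  (forall m v, base_normal P m v -> m = n) -> finite_set (Col P).
Proof.
move=> hn; have [[v0 Cv0]|nC] := pselect (Col P !=set0); last first.
  rewrite (_ : Col P = set0) // -subset0 => v Cv.
  by apply: nC; exists v.
have [m bm] := (ColP v0).1 Cv0; have mn := hn _ _ bm; rewrite mn {m mn} in bm.
have [en _ _] := bm; have [c e] := (edge_normalP n PV).1 en.
have [x Px cx] := edge_interior ncP PV e.
apply: (sub_finite_set (B := (fun y => y - x) @` lat P)); last first.
  exact/finite_image/lat_finite.
move=> v Cv; have [k bk] := (ColP v).1 Cv; have kn := hn _ _ bk; rewrite kn {k kn} in bk.
exists (x + v); last by rewrite addrAC subrr add0r.
have [_ h] := (is_baseP en (base_normal_neq0 bk)).2 bk.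
apply: h => // /(edge_min_face _ e)[_ /eqP].
by rewrite dot_emb eqr_int gt_eqF.
Qed.

End Columns.

(** * Columns in unimodular coordinates *)

Section Unimodular.
Local Notation Z := 'rV[int]_2.
Implicit Types (f g n x y : Z) (c : int * int).

Definition unimodular f g : Prop :=
  f 0 0 * g 0 1 - f 0 1 * g 0 0 = 1 \/ f 0 0 * g 0 1 - f 0 1 * g 0 0 = -1.

Definition comb f g c : Z := c.1 *: f + c.2 *: g.

Definition pairing c (a : int * int) : int := c.1 * a.1 + c.2 * a.2.

Definition coords f g x : int * int := (ip f x, ip g x).

Lemma ip_comb f g c x : ip (comb f g c) x = pairing c (coords f g x).
Proof. by rewrite /comb ipDl !ipZl. Qed.

Lemma unimodular_sqr f g : unimodular f g ->
  (f 0 0 * g 0 1 - f 0 1 * g 0 0) * (f 0 0 * g 0 1 - f 0 1 * g 0 0) = 1.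
Proof. by case=> ->. Qed.

Lemma unimodular_surj f g a b : unimodular f g ->
  exists x, coords f g x = (a, b).
Proof.
move=> /unimodular_sqr; set D := _ - _ => D1.
exists (\row_j [:: D * (a * g 0 1 - b * f 0 1); D * (b * f 0 0 - a * g 0 0)]`_j).
by rewrite /coords /ip !mxE /=; congr pair;
  [rewrite -[RHS]mulr1 -D1|rewrite -[RHS]mulr1 -D1]; rewrite /D; ring.
Qed.

Lemma unimodular_inj f g : unimodular f g -> injective (coords f g).
Proof.
move=> /unimodular_sqr; set D := _ - _ => D1 x y [xy xy'].
apply/rV2P; rewrite -[LHS]mul1r -[RHS]mul1r -D1 -!mulrA; congr (D * _).
  transitivity (g 0 1 * ip f x - f 0 1 * ip g x); first by rewrite /D /ip; ring.
  by rewrite xy xy' /D /ip; ring.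
transitivity (f 0 0 * ip g x - g 0 0 * ip f x); first by rewrite /D /ip; ring.
by rewrite xy xy' /D /ip; ring.
Qed.

Lemma unimodular_comb f g n : unimodular f g -> exists c, n = comb f g c.
Proof.
move=> /unimodular_sqr; set D := _ - _ => D1.
exists (D * (n 0 0 * g 0 1 - n 0 1 * g 0 0), D * (f 0 0 * n 0 1 - f 0 1 * n 0 0)).
by apply/rV2P; rewrite !mxE /= -[LHS]mul1r -D1 /D; ring.
Qed.

Lemma comb_inj f g : unimodular f g -> injective (comb f g).
Proof.
move=> fg [a b] [a' b'] cE.
have [x [fx gx]] := unimodular_surj 1 0 fg.
have [y [fy gy]] := unimodular_surj 0 1 fg.
have := congr1 (ip^~ x) cE; have := congr1 (ip^~ y) cE.
rewrite /= !ip_comb /coords /pairing fx gx fy gy /=.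
by rewrite !mulr0 !mulr1 !addr0 !add0r => -> ->.
Qed.

Lemma comb10 f g : comb f g (1, 0) = f.
Proof. by rewrite /comb scale1r scale0r addr0. Qed.

Lemma comb01 f g : comb f g (0, 1) = g.
Proof. by rewrite /comb scale1r scale0r add0r. Qed.

Lemma comb0N1 f g : comb f g (0, -1) = - g.
Proof. by rewrite /comb scaleN1r scale0r add0r. Qed.

Lemma unimodular_of_pairing f g x y :
  ip f x * ip g y - ip f y * ip g x = 1 -> unimodular f g.
Proof.
move=> h; have /mulz_eq1 : (f 0 0 * g 0 1 - f 0 1 * g 0 0) *
    (x 0 0 * y 0 1 - x 0 1 * y 0 0) = 1 by rewrite -h /ip; ring.
by case; [left|right].
Qed.

Lemma unimodular_sym f g : unimodular f g -> unimodular g f.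
Proof.
rewrite /unimodular (_ : g 0 0 * _ - _ = - (f 0 0 * g 0 1 - f 0 1 * g 0 0)).
  by case=> ->; [right|left].
by ring.
Qed.

(** The determinant of [n] and the quarter turn of [v] is [ip n v]. The quarter turn vanishes on
    [v], which makes it the natural second form when [v] is a column vector. *)
Lemma unimodular_rot n v : ip n v = -1 ->
  unimodular n (\row_j [:: - v 0 1; v 0 0]`_j).
Proof.
by move=> nv; right; rewrite !mxE /= -nv /ip; ring.
Qed.

Lemma unimodularN f g : unimodular f g -> unimodular f (- g).
Proof.
rewrite /unimodular !mxE (_ : f 0 0 * - _ - _ = - (f 0 0 * g 0 1 - f 0 1 * g 0 0)).
  by case=> ->; [right|left].
by ring.
Qed.

End Unimodular.

Definition normals (R : realType) (P : set 'rV[R]_2) f g (L : seq (int * int)) :=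
  unimodular f g /\
  forall n, edge_normal P n <-> exists2 c, c \in L & n = comb f g c.

(* A pair (a, c) of [L] stands for a column vector v with base normal n, where
   a = (<f, v>, <g, v>) and n = c.1 f + c.2 g. *)
Definition columns (R : realType) (P : set 'rV[R]_2) f g
    (L : seq ((int * int) * (int * int))) :=
  unimodular f g /\
  forall n v, base_normal P n v <->
    exists2 e, e \in L & coords f g v = e.1 /\ n = comb f g e.2.

Definition triangle_normals : seq (int * int) := [:: (1, 0); (0, 1); (-1, -1)].
(** [m] measures how far the last side is from being parallel to the first. For [m] nonnegative,
    balancedness allows only 0 and 1. *)
Definition quad_normals (m : int) : seq (int * int) :=
  [:: (1, 0); (0, 1); (0, -1); (-1, - m)].

Definition columns_a : seq ((int * int) * (int * int)) :=
  [:: ((-1, 0), (1, 0)); ((-1, 1), (1, 0)); ((0, -1), (0, 1));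
      ((1, -1), (0, 1)); ((1, 0), (-1, -1)); ((0, 1), (-1, -1))].
Definition columns_b : seq ((int * int) * (int * int)) :=
  [:: ((-1, 0), (1, 0)); ((0, -1), (0, 1)); ((1, -1), (0, 1)); ((1, 0), (-1, -1))].
Definition columns_c : seq ((int * int) * (int * int)) :=
  [:: ((-1, 0), (1, 0)); ((-1, 1), (1, 0)); ((0, -1), (0, 1))].
Definition columns_e : seq ((int * int) * (int * int)) :=
  [:: ((-1, 0), (1, 0)); ((0, -1), (0, 1)); ((0, 1), (0, -1)); ((1, 0), (-1, 0))].
Definition columns_f : seq ((int * int) * (int * int)) :=
  [:: ((-1, 0), (1, 0)); ((0, -1), (0, 1))].

(** * From edge normals to column vectors *)

Section ColumnsOfNormals.
Variables (R : realType) (P : set 'rV[R]_2).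
Implicit Types (f g n v : 'rV[int]_2).

Lemma base_normalP f g L n v : normals P f g L ->
  base_normal P n v <-> exists2 c, c \in L & [/\ n = comb f g c,
    pairing c (coords f g v) = -1 &
    forall c', c' \in L -> c' != c -> 0 <= pairing c' (coords f g v)].
Proof.
move=> [fg hL]; split=> [[/hL[c cL nE] nv hm]|[c cL [nE nv hm]]].
  exists c => //; split=> // [|c' c'L cc']; first by rewrite -ip_comb -nE.
  rewrite -ip_comb; apply: hm; first by apply/hL; exists c'.
  by rewrite nE (inj_eq (comb_inj fg)).
split=> [||m /hL[c' c'L ->]]; first by apply/hL; exists c.
  by rewrite nE ip_comb.
by rewrite nE (inj_eq (comb_inj fg)) ip_comb; exact: hm.
Qed.

(** Reduces the determination of all column vectors to inequalities between pairs of integers, which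
    linear arithmetic settles for concrete lists. *)
Lemma normals_columns f g L C : normals P f g L ->
  (forall a c, c \in L -> pairing c a = -1 ->
    (forall c', c' \in L -> c' != c -> 0 <= pairing c' a) -> (a, c) \in C) ->
  (forall e, e \in C -> [/\ e.2 \in L, pairing e.2 e.1 = -1 &
    forall c', c' \in L -> c' != e.2 -> 0 <= pairing c' e.1]) ->
  columns P f g C.
Proof.
move=> hL h1 h2; split=> [|n v]; first by case: hL.
rewrite (base_normalP _ _ hL); split=> [[c cL [-> nv hm]]|[e /h2[eL ev em] [vE ->]]].
  by exists (coords f g v, c) => //; exact: h1.
by exists e.2; rewrite ?vE.
Qed.

Lemma columns_triangle f g :
  normals P f g triangle_normals -> columns P f g columns_a.
Proof.
move=> hL; apply: normals_columns hL _ _; last first.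
  by move=> e; rewrite !inE; repeat (case/orP); move=> /eqP -> /=; split=> // c';
    rewrite !inE; repeat (case/orP); move=> /eqP ->.
move=> [a b] c; rewrite !inE => cL ca hm.
have := hm (1, 0) isT; have := hm (0, 1) isT; have := hm (-1, -1) isT.
move: cL ca; rewrite /pairing /= => cL ca h1 h2 h3.
by case/or3P: cL ca h1 h2 h3 => /eqP -> /=; rewrite !xpair_eqE /=; lia.
Qed.

Lemma columns_trapezoid f g :
  normals P f g (quad_normals 1) -> columns P f g columns_b.
Proof.
move=> hL; apply: normals_columns hL _ _; last first.
  by move=> e; rewrite !inE; repeat (case/orP); move=> /eqP -> /=; split=> // c';
    rewrite !inE; repeat (case/orP); move=> /eqP ->.
move=> [a b] c; rewrite !inE => cL ca hm.
have := hm (1, 0) isT; have := hm (0, 1) isT; have := hm (0, -1) isT.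
have := hm (-1, -1) isT; move: cL ca; rewrite /pairing /= => cL ca h1 h2 h3 h4.
by case/or4P: cL ca h1 h2 h3 h4 => /eqP -> /=; rewrite !xpair_eqE /=; lia.
Qed.

Lemma columns_square f g :
  normals P f g (quad_normals 0) -> columns P f g columns_e.
Proof.
move=> hL; apply: normals_columns hL _ _; last first.
  by move=> e; rewrite !inE; repeat (case/orP); move=> /eqP -> /=; split=> // c';
    rewrite !inE; repeat (case/orP); move=> /eqP ->.
move=> [a b] c; rewrite !inE => cL ca hm.
have := hm (1, 0) isT; have := hm (0, 1) isT; have := hm (0, -1) isT.
have := hm (-1, 0) isT; move: cL ca; rewrite /pairing /= => cL ca h1 h2 h3 h4.
by case/or4P: cL ca h1 h2 h3 h4 => /eqP -> /=; rewrite !xpair_eqE /=; lia.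
Qed.

End ColumnsOfNormals.

(** * Classification *)

Section Classification.
Variables (R : realType) (P : set 'rV[R]_2).
Implicit Types (f g n m k u v w x : 'rV[int]_2).

Lemma balanced_lattice : balanced P -> lattice_polygon P.
Proof. by case=> -[]. Qed.

Hypothesis bP : balanced P.

Let hP : lattice_polygon P := balanced_lattice bP.
Let PV : exists V : seq 'rV[int]_2, P = conv_lat V. Proof. by case: hP. Qed.

Lemma balanced_ip n m u v : base_normal P n u -> base_normal P m v -> ip n v <= 1.
Proof.
move=> bn bm; case: bP => _ /(_ u v); rewrite (height_base hP _ bn); apply.
  by apply/(ColP hP); exists n.
by apply/(ColP hP); exists m.
Qed.

(** [u + v] is nonnegative on every edge normal: on [n] and [m] the two values cancel, and on all
    others both are nonnegative. *)
Lemma opposite_of_pairing n m u v : base_normal P n u -> base_normal P m v ->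
  n != m -> ip n v = 1 -> ip m u = 1 -> v = - u.
Proof.
move=> [en nu hu] [em mv hv] nm nv mu; apply/eqP; rewrite -addr_eq0; apply/eqP.
apply: (edge_normal_recession hP) => k ek; rewrite ipDr.
have [->|kn] := eqVneq k n; first by rewrite nu nv.
have [->|km] := eqVneq k m; first by rewrite mu mv.
by rewrite addr_ge0 ?hv ?hu.
Qed.

(** Edges other than the two bases have normals vanishing on [v], so at most four normals occur:
    [n], [n'], [g] and [- g]. Boundedness tells which of them must be present, and balancedness
    bounds the slope [m]. *)
Lemma opposite_columns n n' v : base_normal P n v -> base_normal P n' (- v) ->
  exists f g, [\/ normals P f g triangle_normals,
    normals P f g (quad_normals 0) | normals P f g (quad_normals 1)].
Proof.
move=> bn bn'; have [en nv hv] := bn; have [en' nv' hv'] := bn'.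
(* The second form is the quarter turn of [v] or its negative; the sign is chosen to make [m]
   nonnegative. *)
have [g [m [ng gv m0 n'E]]] : exists g (m : int),
    [/\ unimodular n g, ip g v = 0, 0 <= m & n' = comb n g (-1, - m)].
  have uq := unimodular_rot nv; set q := \row_j _ in uq.
  have qv : ip q v = 0 by rewrite /ip !mxE /=; ring.
  have [[a b] n'E] := unimodular_comb n' uq.
  have a1 : a = -1.
    move: nv'; rewrite ipNr n'E ip_comb /pairing /= nv qv; lia.
  rewrite a1 in n'E; have [b0|b0] := lerP b 0.
    by exists q, (- b); rewrite oppr_ge0 opprK.
  exists (- q), b; rewrite ipNl qv oppr0 ltW //; split=> //.
    exact: unimodularN.
  by rewrite n'E /comb /= scalerN [(- b) *: q]scaleNr opprK.
have other k : edge_normal P k -> [\/ k = n, k = n', k = g | k = - g].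
  move=> ek; have [kn|kn] := eqVneq k n; first by constructor 1.
  have [kn'|kn'] := eqVneq k n'; first by constructor 2.
  have [[a b] kE] := unimodular_comb k ng.
  have := hv k ek kn; have := hv' k ek kn'.
  rewrite ipNr kE ip_comb /pairing /= nv gv => h1 h2.
  have a0 : a = 0 by lia.
  case: ek => -[x kx] _; move: kx; rewrite kE a0 ip_comb /pairing /= mul0r add0r.
  case/mulz_eq1 => b1; rewrite b1.
    by constructor 3; rewrite comb01.
  by constructor 4; rewrite comb0N1.
(* No nonzero direction is nonnegative on all normals. The directions with coordinates (0, -1) and,
   for [m = 0], (0, 1) then force [g] and [- g] to be edge normals. *)
have rec a b : (a, b) != 0 -> 0 <= a -> 0 <= - a - m * b ->
    (edge_normal P g -> 0 <= b) -> (edge_normal P (- g) -> 0 <= - b) -> False.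
  move=> ab0 a0 n'0 g0 g'0; have [x xE] := unimodular_surj a b ng.
  have [fx gx] : ip n x = a /\ ip g x = b by case: xE.
  have : x = 0.
    apply: (edge_normal_recession hP) => k ek.
    case: (other k ek) => kE; rewrite kE ?fx //.
    - by rewrite n'E ip_comb xE /pairing /= mulN1r mulNr.
    - by rewrite gx g0 // -kE.
    - by rewrite ipNl gx g'0 // -kE.
  move=> x0; case/eqP: ab0.
  by rewrite -xE x0 /coords /ip !mxE !mulr0 addr0.
have eg : edge_normal P g.
  by apply: contrapT => ng'; apply: (rec 0 (-1)) => //; rewrite oppr0 mulrN1 opprK add0r.
have gE c : edge_normal P (comb n g c) <->
    c = (1, 0) \/ c = (-1, - m) \/ c = (0, 1) \/ (c = (0, -1) /\ edge_normal P (- g)).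
  split=> [ec|].
    case: (other _ ec) => cE.
    - by left; apply: (comb_inj ng); rewrite cE comb10.
    - by right; left; apply: (comb_inj ng); rewrite cE n'E.
    - by right; right; left; apply: (comb_inj ng); rewrite cE comb01.
    - right; right; right; split; last by rewrite -cE.
      by apply: (comb_inj ng); rewrite cE comb0N1.
  case=> [->|[->|[->|[-> eg']]]]; by rewrite ?comb10 ?comb01 ?comb0N1 -?n'E.
have nrm L : (forall c, c \in L <-> edge_normal P (comb n g c)) -> normals P n g L.
  move=> hL; split=> // k; split=> [ek|[c /hL cL ->] //].
  have [c kE] := unimodular_comb k ng; exists c => //.
  by apply/hL; rewrite -kE.
exists n, g; have [m00|mn0] := eqVneq m 0.
  have eg' : edge_normal P (- g).
    apply: contrapT => ng'; apply: (rec 0 1) => //; by rewrite m00.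
  constructor 2; apply: nrm => c; rewrite gE !inE m00 oppr0.
  split=> [/or4P[] /eqP ->|]; try tauto.
  by case=> [->|[->|[->|[-> _]]]]; rewrite eqxx ?orbT.
(* This direction is parallel to the edge of [n']. It is a column vector with base normal [g], and
   its height over the edge of [n] is [m], so that balancedness gives [m = 1]. *)
have [x xE] := unimodular_surj m (-1) ng.
have [fx gx] : ip n x = m /\ ip g x = -1 by case: xE.
have bx : base_normal P g x.
  split=> // k ek; case: (other k ek) => -> kg.
  - by rewrite fx.
  - by rewrite n'E ip_comb xE /pairing /=; lia.
  - by rewrite eqxx in kg.
  - by rewrite ipNl gx.
have m1 : m = 1.
  by have := balanced_ip bn bx; rewrite fx; move/eqP: mn0; lia.
have [eg'|neg'] := pselect (edge_normal P (- g)).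
  constructor 3; apply: nrm => c; rewrite gE !inE m1.
  split=> [/or4P[] /eqP ->|]; try tauto.
  by case=> [->|[->|[->|[-> _]]]]; rewrite eqxx ?orbT.
constructor 1; apply: nrm => c; rewrite gE !inE m1.
split=> [/or3P[] /eqP ->|]; try tauto.
by case=> [->|[->|[->|[_ //]]]]; rewrite eqxx ?orbT.
Qed.

(** * Polygons without opposite column vectors *)

Section NoOpposite.
Hypothesis noopp : forall n m v, base_normal P n v -> ~ base_normal P m (- v).

Lemma not_both_pairings n m u v : base_normal P n u -> base_normal P m v ->
  n != m -> ip n v = 1 -> ip m u = 1 -> False.
Proof.
move=> bn bm nm nv mu; apply: (noopp (n := n) (m := m) bn).
by rewrite -(opposite_of_pairing bn bm nm nv mu).
Qed.

(* A cycle of three products would make the third vector opposite to the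
   product of the first two. *)
Lemma no_cycle n1 n2 n3 v1 v2 v3 : base_normal P n1 v1 -> base_normal P n2 v2 ->
  base_normal P n3 v3 -> n1 != n2 -> n2 != n3 ->
  ip n1 v2 = 1 -> ip n2 v1 = 0 -> ip n2 v3 = 1 -> ip n3 v1 = 1 -> ip n3 v2 = 0 ->
  False.
Proof.
move=> b1 b2 b3 n12 n23 x12 x21 x23 x31 x32.
have b12 : base_normal P n2 (v1 + v2).
  have [_ x11 h1] := b1; have [e2 x22 h2] := b2.
  split=> // [|k ek k2]; rewrite ipDr ?x21 ?x22 //.
  have [->|k1] := eqVneq k n1; first by rewrite x11 x12.
  by rewrite addr_ge0 ?h1 ?h2.
by apply: (not_both_pairings b12 b3 n23) => //; rewrite ipDr x31 x32.
Qed.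

Lemma pairing01 n m u v : base_normal P n u -> base_normal P m v -> n != m ->
  ip n v = 0 \/ ip n v = 1.
Proof.
move=> bn bm nm; have := balanced_ip bn bm.
by case: bm => _ _ /(_ n); case: bn => en _ _ /(_ en nm); lia.
Qed.

(* The matrix (<n_i, v_j>) has rank at most 2, so its determinant vanishes. *)
Lemma no_three_bases n1 n2 n3 v1 v2 v3 : base_normal P n1 v1 ->
  base_normal P n2 v2 -> base_normal P n3 v3 ->
  n1 != n2 -> n2 != n3 -> n1 != n3 -> False.
Proof.
move=> b1 b2 b3 n12 n23 n13.
have n21 : n2 != n1 by rewrite eq_sym.
have n32 : n3 != n2 by rewrite eq_sym.
have n31 : n3 != n1 by rewrite eq_sym.
have c1 := no_cycle b1 b2 b3 n12 n23; have c2 := no_cycle b1 b3 b2 n13 n32.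
have o12 := not_both_pairings b1 b2 n12; have o23 := not_both_pairings b2 b3 n23.
have o13 := not_both_pairings b1 b3 n13.
have det0 : ip n1 v1 * (ip n2 v2 * ip n3 v3 - ip n2 v3 * ip n3 v2)
  - ip n1 v2 * (ip n2 v1 * ip n3 v3 - ip n2 v3 * ip n3 v1)
  + ip n1 v3 * (ip n2 v1 * ip n3 v2 - ip n2 v2 * ip n3 v1) = 0.
  by rewrite /ip; ring.
move: det0; have [_ -> _] := b1; have [_ -> _] := b2; have [_ -> _] := b3.
(* With -1 on the diagonal the determinant is -1 plus the products of pairings over the three
   2-cycles and the two 3-cycles, so one of these products is 1: [not_both_pairings] excludes the
   former and [no_cycle] the latter. *)
have [x12|x12] := pairing01 b1 b2 n12; have [x21|x21] := pairing01 b2 b1 n21;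
have [x13|x13] := pairing01 b1 b3 n13; have [x31|x31] := pairing01 b3 b1 n31;
have [x23|x23] := pairing01 b2 b3 n23; have [x32|x32] := pairing01 b3 b2 n32;
rewrite x12 x21 x13 x31 x23 x32 => // _;
solve [exact: o12|exact: o13|exact: o23|exact: c1|exact: c2].
Qed.

Lemma two_bases n1 n2 v1 v2 : base_normal P n1 v1 -> base_normal P n2 v2 ->
  n1 != n2 ->
  exists f g, columns P f g columns_c \/ columns P f g columns_f.
Proof.
move=> b1 b2 n12; have n21 : n2 != n1 by rewrite eq_sym.
have only n v : base_normal P n v -> n = n1 \/ n = n2.
  move=> bn; have [->|nn1] := eqVneq n n1; first by left.
  have [->|nn2] := eqVneq n n2; first by right.
  by case: (no_three_bases b1 b2 bn); rewrite // eq_sym.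
(* The matrix of pairings has -1 on the diagonal and at most one nonzero entry off it, so its
   determinant is 1. *)
have un : unimodular n1 n2.
  have [_ x11 _] := b1; have [_ x22 _] := b2.
  apply: (@unimodular_of_pairing _ _ v1 v2); rewrite x11 x22.
  have [x12|x12] := pairing01 b1 b2 n12; have [x21|x21] := pairing01 b2 b1 n21;
  rewrite x12 x21 //; by case: (not_both_pairings b1 b2).
(* Because [u] has pairing 1 with [m], columns over [m] have pairing 0 with [n]. Columns over [n]
   have pairing 0 or 1 with [m], and both values occur, at [u + v] and at [u]. *)
have caseC n m u v : unimodular n m ->
    (forall k w, base_normal P k w -> k = n \/ k = m) ->
    base_normal P n u -> base_normal P m v -> n != m -> ip m u = 1 ->
    columns P n m columns_c.
  move=> nm hk bn bm nm' mu; have mn' : m != n by rewrite eq_sym.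
  have nv w : base_normal P m w -> ip n w = 0.
    move=> bw; case: (pairing01 bn bw nm') => // nw.
    by case: (not_both_pairings bn bw).
  have coordsE w a b : ip n w = a -> ip m w = b -> coords n m w = (a, b).
    by move=> <- <-.
  have buv : base_normal P n (u + v).
    have [en nu hu] := bn; have [em mv hv] := bm.
    split=> // [|k ek kn]; rewrite ipDr ?nu ?(nv v bm) //.
    have [->|km] := eqVneq k m; first by rewrite mu mv.
    by rewrite addr_ge0 ?hu ?hv.
  have [_ nu _] := bn; have [_ mv _] := bm.
  split=> // k w; split=> [bw|[e]]; last first.
    rewrite !inE => /or3P[] /eqP -> /= [wE ->]; rewrite ?comb10 ?comb01.
    - by rewrite (_ : w = u + v) //; apply: (unimodular_inj nm);
        rewrite wE (coordsE _ (-1) 0) // ipDr ?nu ?mu ?mv ?nv.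
    - by rewrite (_ : w = u) //; apply: (unimodular_inj nm);
        rewrite wE (coordsE _ (-1) 1).
    - by rewrite (_ : w = v) //; apply: (unimodular_inj nm);
        rewrite wE (coordsE _ 0 (-1)) // nv.
  have [kE|kE] := hk _ _ bw; rewrite kE in bw *.
    have [_ nw _] := bw.
    have [mw|mw] := pairing01 bm bw mn'.
      by exists ((-1, 0), (1, 0)) => //; rewrite comb10 (coordsE _ (-1) 0).
    by exists ((-1, 1), (1, 0)) => //; rewrite comb10 (coordsE _ (-1) 1).
  have [_ mw _] := bw.
  by exists ((0, -1), (0, 1)) => //; rewrite comb01 (coordsE _ 0 (-1)) // nv.
have [[u bu mu]|nu] := pselect (exists2 u, base_normal P n1 u & ip n2 u = 1).
  by exists n1, n2; left; apply: (caseC n1 n2 u v2).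
have [[u bu mu]|nu'] := pselect (exists2 u, base_normal P n2 u & ip n1 u = 1).
  exists n2, n1; left; apply: (caseC n2 n1 u v1) => //; first exact: unimodular_sym.
  by move=> k w /only; tauto.
(* Now all pairings across the two bases are 0, so coordinates determine the column vector over each
   base. *)
exists n1, n2; right.
have c1 w : base_normal P n1 w -> coords n1 n2 w = (-1, 0).
  move=> bw; have [_ x1 _] := bw; rewrite /coords x1.
  by case: (pairing01 b2 bw n21) => [->//|x2]; case: nu; exists w.
have c2 w : base_normal P n2 w -> coords n1 n2 w = (0, -1).
  move=> bw; have [_ x2 _] := bw; rewrite /coords x2.
  by case: (pairing01 b1 bw n12) => [->//|x1]; case: nu'; exists w.
split=> // k w; split=> [bw|[e]].
  have [kE|kE] := only _ _ bw; rewrite kE in bw *.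
    by exists ((-1, 0), (1, 0)); rewrite ?comb10 ?c1.
  by exists ((0, -1), (0, 1)); rewrite ?comb01 ?c2.
rewrite !inE => /orP[] /eqP -> /= [wE ->]; rewrite ?comb10 ?comb01.
  by rewrite (_ : w = v1) //; apply: (unimodular_inj un); rewrite wE c1.
by rewrite (_ : w = v2) //; apply: (unimodular_inj un); rewrite wE c2.
Qed.

End NoOpposite.

Lemma balanced_classification :
  (exists f g, [\/ normals P f g triangle_normals,
    normals P f g (quad_normals 0) | normals P f g (quad_normals 1)]) \/
  (exists f g, columns P f g columns_c \/ columns P f g columns_f) \/
  exists n, forall m v, base_normal P m v -> m = n.
Proof.
have [[n [n' [v [bn bn']]]]|no] := pselect (exists n n' v,
    base_normal P n v /\ base_normal P n' (- v)).
  by left; exact: opposite_columns bn bn'.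
right; have noopp n m v : base_normal P n v -> ~ base_normal P m (- v).
  by move=> bn bm; apply: no; exists n, m, v.
have [[n [m [u [v [bn bm nm]]]]]|one] := pselect (exists n m u v,
    [/\ base_normal P n u, base_normal P m v & n != m]).
  by left; exact: two_bases bn bm nm.
right; have [v Cv] : Col P !=set0 by case: bP => -[].
have [n bn] := (ColP hP v).1 Cv; exists n => m w bm.
by apply/eqP; apply: contrapT => /negP mn; apply: one; exists m, n, w, v.
Qed.

End Classification.

(** * The cases and E-equivalence *)

(** The criterion of [prod_existsP] evaluated on coordinates. *)
Definition products (L : seq ((int * int) * (int * int))) :
    seq ((int * int) * (int * int)) :=
  [seq (p.1.1, p.2.1) | p <- [seq (d, e) | d <- L, e <- L]
     & (p.1.1 + p.2.1 != 0) && (0 < pairing p.2.2 p.1.1)].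

Section Coordinates.
Variables (f g : 'rV[int]_2) (fg : unimodular f g).
Implicit Types (a b : int * int) (x y : 'rV[int]_2).

Definition vector_of a : 'rV[int]_2 := sval (cid (unimodular_surj a.1 a.2 fg)).

Lemma vector_ofK : cancel vector_of (coords f g).
Proof. by move=> [a b]; rewrite /vector_of; case: cid. Qed.

Lemma coordsK : cancel (coords f g) vector_of.
Proof. by move=> x; apply: (unimodular_inj fg); rewrite vector_ofK. Qed.

Lemma coordsD x y : coords f g (x + y) = coords f g x + coords f g y.
Proof. by rewrite /coords !ipDr. Qed.

Lemma vector_ofD a b : vector_of (a + b) = vector_of a + vector_of b.
Proof. by apply: (unimodular_inj fg); rewrite coordsD !vector_ofK. Qed.

Lemma vector_ofN a : vector_of (- a) = - vector_of a.
Proof.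
apply/eqP; rewrite -subr_eq0 opprK -vector_ofD addNr; apply/eqP.
by apply: (unimodular_inj fg); rewrite vector_ofK /coords /ip !mxE !mulr0.
Qed.

Lemma vector_ofB a b : vector_of (a - b) = vector_of a - vector_of b.
Proof. by rewrite vector_ofD vector_ofN. Qed.

Lemma vector_of_inj : injective vector_of.
Proof. exact: can_inj vector_ofK. Qed.

Lemma mem_vector_of x (s : seq (int * int)) :
  (x \in map vector_of s) = (coords f g x \in s).
Proof. by rewrite -{1}[x]coordsK (mem_map vector_of_inj). Qed.

End Coordinates.

(** * Column vectors and relations in each case *)

Section ColCases.
Variables (R : realType) (P : set 'rV[R]_2).
Implicit Types (f g u v n m : 'rV[int]_2).
Hypothesis hP : lattice_polygon P.

Lemma Col_columns f g (fg : unimodular f g) L s : columns P f g L ->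
  perm_eq (map fst L) s -> Col P = [set` map (vector_of fg) s].
Proof.
move=> [_ hL] /perm_mem Ls; apply/seteqP; split=> v /=.
  by move=> /(ColP hP)[n /hL[e eL [vE _]]]; rewrite mem_vector_of vE -Ls map_f.
rewrite mem_vector_of -Ls => /mapP[e eL vE]; apply/(ColP hP).
by exists (comb f g e.2); apply/hL; exists e.
Qed.

(** On a concrete list [products] computes, so the relations of each case are read off by
    evaluation. *)
Lemma relations_columns f g (fg : unimodular f g) L : columns P f g L ->
  relations P = [set` [seq (vector_of fg p.1, vector_of fg p.2,
                            vector_of fg (p.1 + p.2)) | p <- products L]].
Proof.
move=> [_ hL]; apply/seteqP; split=> -[[u v] w] /=.
  move=> [/= puv ->]; have [/(ColP hP)[n bn] /(ColP hP)[m bm] _ _] := puv.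
  have [uv mu] := (prod_existsP hP bn bm).1 puv.
  have /hL[d dL [dE _]] := bn; have /hL[e eL [eE mE]] := bm.
  apply/mapP; exists (d.1, e.1); last first.
    by rewrite /= vector_ofD -dE -eE !coordsK.
  apply/mapP; exists (d, e) => //; rewrite mem_filter /= -dE -eE -ip_comb -mE mu.
  rewrite andbT allpairs_f // andbT.
  rewrite -coordsD; apply: contra uv => /eqP c0.
  by rewrite -[u + v](coordsK fg) c0 -(subrr 0) vector_ofB subrr.
move=> /mapP[_ /mapP[[d e] +] -> [-> -> ->]] /=; rewrite mem_filter /=.
move=> /andP[/andP[de0 pos] /allpairsP[[d' e'] /= [dL eL [dE eE]]]].
rewrite -{d'}dE -{e'}eE in dL eL; split=> //=; last by rewrite vector_ofD.
have bn : base_normal P (comb f g d.2) (vector_of fg d.1).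
  by apply/hL; exists d; rewrite ?vector_ofK.
have bm : base_normal P (comb f g e.2) (vector_of fg e.1).
  by apply/hL; exists e; rewrite ?vector_ofK.
apply/(prod_existsP hP bn bm); rewrite ip_comb vector_ofK; split=> //.
apply: contra de0 => /eqP de0; rewrite -[_ + _](vector_ofK fg) vector_ofD de0.
by rewrite /coords /ip !mxE !mulr0.
Qed.

Lemma case_a_columns f g : columns P f g columns_a -> col_case case_a P.
Proof.
move=> hc; have fg := hc.1; pose V := vector_of fg.
exists (V (0, 0)), (V (1, 0)), (V (0, 1)).
pose s : seq (int * int) := [:: (1, 0); (-1, 0); (-1, 1); (1, -1); (0, 1); (0, -1)].
lazy zeta; rewrite -!vector_ofB -!vector_ofN (_ : [:: _; _; _; _; _; _] = map V s) //.
split; first by rewrite /V (map_inj_uniq (vector_of_inj (fg := fg))).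
  exact: (Col_columns fg hc).
rewrite (relations_columns fg hc).
pose q := tnth [tuple ((0, 0) : int * int); (1, 0); (0, 1)].
have qE i : tnth [tuple V (0, 0); V (1, 0); V (0, 1)] i = V (q i).
  by case: i => -[|[|[|//]]] ?.
apply/seteqP; split=> t.
  pose o (i : nat) (lti : (i < 3)%N) := Ordinal lti.
  move=> /mapP[p + ->]; rewrite (_ : products _ = [:: ((-1, 0), (0, 1));
    ((-1, 1), (0, -1)); ((0, -1), (1, 0)); ((1, -1), (-1, 0)); ((1, 0), (-1, 1));
    ((0, 1), (1, -1))]) // !inE.
  do 5?case/orP; move=> /eqP ->; [exists (o 1 isT), (o 0 isT), (o 2 isT)
  |exists (o 1 isT), (o 2 isT), (o 0 isT)|exists (o 2 isT), (o 0 isT), (o 1 isT)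
  |exists (o 2 isT), (o 1 isT), (o 0 isT)|exists (o 0 isT), (o 1 isT), (o 2 isT)
  |exists (o 0 isT), (o 2 isT), (o 1 isT)]; split=> //; by rewrite !qE -!vector_ofB.
move=> [i [j [k [ij jk ik ->]]]]; rewrite !qE -!vector_ofB; apply/mapP.
exists (q j - q i, q k - q j); last first.
  by congr (_, _, vector_of _ _); rewrite [RHS]addrC addrA subrK.
by move: ij jk ik; case: i => -[|[|[|//]]] ?; case: j => -[|[|[|//]]] ?;
case: k => -[|[|[|//]]] ?.
Qed.

Lemma case_b_columns f g : columns P f g columns_b -> col_case case_b P.
Proof.
move=> hc; have fg := hc.1; pose V := vector_of fg.
exists (V (0, -1)), (V (1, 0)), (V (1, -1)).
pose s : seq (int * int) := [:: (0, -1); (1, 0); (-1, 0); (1, -1)].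
lazy zeta; rewrite -vector_ofN (_ : [:: _; _; _; _] = map V s) //.
split; first by rewrite /V (map_inj_uniq (vector_of_inj (fg := fg))).
  exact: (Col_columns fg hc).
by rewrite (relations_columns fg hc).
Qed.

Lemma case_c_columns f g : columns P f g columns_c -> col_case case_c P.
Proof.
move=> hc; have fg := hc.1; pose V := vector_of fg.
exists (V (-1, 1)), (V (0, -1)), (V (-1, 0)).
pose s : seq (int * int) := [:: (-1, 1); (0, -1); (-1, 0)].
lazy zeta; rewrite (_ : [:: _; _; _] = map V s) //.
split; first by rewrite /V (map_inj_uniq (vector_of_inj (fg := fg))).
  exact: (Col_columns fg hc).
by rewrite (relations_columns fg hc).
Qed.

Lemma case_e_columns f g : columns P f g columns_e -> col_case case_e P.
Proof.
move=> hc; have fg := hc.1; pose V := vector_of fg.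
exists (V (1, 0)), (V (0, 1)).
pose s : seq (int * int) := [:: (1, 0); (-1, 0); (0, 1); (0, -1)].
lazy zeta; rewrite -!vector_ofN (_ : [:: _; _; _; _] = map V s) //.
split; first by rewrite /V (map_inj_uniq (vector_of_inj (fg := fg))).
  exact: (Col_columns fg hc).
by rewrite (relations_columns fg hc); apply/seteqP; split.
Qed.

Lemma case_f_columns f g : columns P f g columns_f -> col_case case_f P.
Proof.
move=> hc; have fg := hc.1; have hb := hc.2; pose V := vector_of fg.
exists (V (-1, 0)), (V (0, -1)); split.
- exact: (@Col_columns f g fg columns_f [:: (-1, 0); (0, -1)]).
- have b1 : base_normal P (comb f g (1, 0)) (V (-1, 0)).
    by apply/hb; exists ((-1, 0), (1, 0)); rewrite ?vector_ofK.
  have b2 : base_normal P (comb f g (0, 1)) (V (0, -1)).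
    by apply/hb; exists ((0, -1), (0, 1)); rewrite ?vector_ofK.
  by move=> /(base_eqP hP b1 b2) /(comb_inj fg).
- by rewrite (relations_columns fg hc); apply/seteqP; split.
Qed.

Lemma case_d_single n k : (forall m v, base_normal P m v -> m = n) ->
  (Col P #= `I_k)%card -> col_case (case_d k) P.
Proof.
move=> hn Ck; split=> //.
  exists (min_face P (emb R n)) => v /(ColP hP)[m bm].
  by rewrite (baseE hP bm) (hn _ _ bm).
apply/seteqP; split=> // -[[u v] w] [/= puv _].
have [/(ColP hP)[m bm] /(ColP hP)[m' bm'] _ _] := puv.
have [_] := (prod_existsP hP bm bm').1 puv.
by have [_ mu _] := bm; rewrite (hn _ _ bm') -(hn _ _ bm) mu.
Qed.

End ColCases.

(* Unlike [col_case], this determines the matrix of heights. *)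
Definition config (R : realType) (t : polygon_case) (P : set 'rV[R]_2) : Prop :=
  match t with
  | case_a => exists f g, columns P f g columns_a
  | case_b => exists f g, columns P f g columns_b
  | case_c => exists f g, columns P f g columns_c
  | case_d k => (Col P #= `I_k)%card /\ exists n, forall m v, base_normal P m v -> m = n
  | case_e => exists f g, columns P f g columns_e
  | case_f => exists f g, columns P f g columns_f
  end.

Lemma config_col_case (R : realType) t (P : set 'rV[R]_2) :
  lattice_polygon P -> config t P -> col_case t P.
Proof.
move=> hP; case: t => [|||k||] /=.
- by move=> [f [g]]; exact: case_a_columns.
- by move=> [f [g]]; exact: case_b_columns.
- by move=> [f [g]]; exact: case_c_columns.
- by move=> [Ck [n hn]]; exact: case_d_single hn Ck.
- by move=> [f [g]]; exact: case_e_columns.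
- by move=> [f [g]]; exact: case_f_columns.
Qed.

(** * E-equivalence within a case and between cases *)

Section EEquivalence.
Variable R : realType.
Implicit Types (P Q : set 'rV[R]_2) (f g u v n m : 'rV[int]_2).

(** The bijection is the restriction of the lattice isomorphism that preserves coordinates. Base
    normals correspond to base normals with the same coefficients, so heights and products agree. *)
Lemma columns_E_equiv P Q f g f' g' L : lattice_polygon P -> lattice_polygon Q ->
  columns P f g L -> columns Q f' g' L -> E_equiv P Q.
Proof.
move=> hP hQ [fg hPL] [fg' hQL].
pose mu v := vector_of fg' (coords f g v).
have muK v : coords f' g' (mu v) = coords f g v by rewrite vector_ofK.
have muD u v : mu (u + v) = mu u + mu v.
  by apply: (unimodular_inj fg'); rewrite coordsD !muK coordsD.
have mu_inj : injective mu.
  by move=> u v /(congr1 (coords f' g')); rewrite !muK; exact: unimodular_inj.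
have mu0 : mu 0 = 0 by apply: (addrI (mu 0)); rewrite -muD !addr0.
have muC c v : base_normal P (comb f g c) v <-> base_normal Q (comb f' g' c) (mu v).
  rewrite hPL hQL muK; split=> -[e eL [vE /comb_inj ->]] //; by exists e.
have normalE n v : base_normal P n v -> exists c, n = comb f g c.
  by move=> /hPL[e _ [_ ->]]; exists e.2.
have height_mu n w v : base_normal P n w ->
    exists2 m, base_normal Q m (mu w) & forall v, ip n v = ip m (mu v).
  move=> bn; have [c nE] := normalE _ _ bn; rewrite nE in bn *.
  exists (comb f' g' c); first exact/muC.
  by move=> x; rewrite !ip_comb muK.
exists mu; split.
- split=> [v /(ColP hP)[n bn]|u v _ _ /mu_inj //|w /(ColP hQ)[m /[dup] bm]].
    by have [m bm _] := height_mu _ _ v bn; apply/(ColP hQ); exists m.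
  move=> /hQL[e eL [wE mE]]; exists (vector_of fg e.1).
    by apply/(ColP hP); exists (comb f g e.2); apply/hPL; exists e; rewrite ?vector_ofK.
  by apply: (unimodular_inj fg'); rewrite muK vector_ofK.
- move=> v w _ /(ColP hP)[n bn]; have [m bm nm] := height_mu _ _ v bn.
  by rewrite (height_base hP _ bn) (height_base hQ _ bm).
- move=> u v /(ColP hP)[n bn] /(ColP hP)[m bm].
  have [n' bn' _] := height_mu _ _ v bn; have [m' bm' mm'] := height_mu _ _ v bm.
  rewrite (prod_existsP hP bn bm) (prod_existsP hQ bn' bm') mm' -muD.
  suff -> : (mu (u + v) == 0) = (u + v == 0) by [].
  by rewrite -{1}mu0 (inj_eq mu_inj).
- by move=> u v _; exact: muD.
Qed.

(** With one base all heights are -1 and no products exist, so any bijection of the column vectors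
    will do. *)
Lemma single_E_equiv P Q n m k : lattice_polygon P -> lattice_polygon Q ->
  (Col P #= `I_k)%card -> (Col Q #= `I_k)%card ->
  (forall n' v, base_normal P n' v -> n' = n) ->
  (forall m' v, base_normal Q m' v -> m' = m) -> E_equiv P Q.
Proof.
move=> hP hQ Pk Qk Pn Qm.
have [mu muB] : exists mu, set_bij (Col P) (Col Q) mu.
  have /card_set_bijP[h [hC hI hS]] := Pk; have /card_set_bijP[h' [hC' hI' hS']] := Qk.
  have ex v : Col P v -> exists2 w, Col Q w & h' w = h v by move=> /hC/hS'.
  pose S v := [set w | Col Q w /\ h' w = h v]; pose mu v := xget 0 (S v).
  have muP v : Col P v -> Col Q (mu v) /\ h' (mu v) = h v.
    by move=> /ex[w Qw hw]; apply: (@xgetPex _ 0 (S v)); exists w.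
  exists mu; split=> [v /muP[] //|u v /[!inE] Cu Cv uv|w Cw].
    by apply: hI; rewrite ?inE // -(muP u Cu).2 uv (muP v Cv).2.
  have [v Cv vw] := hS _ (hC' _ Cw); exists v => //.
  have [Cmu hmu] := muP v Cv.
  by apply: hI'; rewrite ?inE // hmu vw.
have single (S : set 'rV[R]_2) s : lattice_polygon S ->
    (forall n' v, base_normal S n' v -> n' = s) ->
    (forall v w, Col S v -> Col S w -> height S (base S w) v = -1) /\
    forall v w, ~ prod_exists S v w.
  move=> hS hs; split=> [v w /(ColP hS)[a ba] /(ColP hS)[b bb]|v w pvw].
    by have [_ av _] := ba; rewrite (height_base hS _ bb) (hs _ _ bb) -(hs _ _ ba).
  have [/(ColP hS)[a ba] /(ColP hS)[b bb] _ _] := pvw.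
  have [_] := (prod_existsP hS ba bb).1 pvw.
  by have [_ av _] := ba; rewrite (hs _ _ bb) -(hs _ _ ba) av.
have [P1 P2] := single P n hP Pn; have [Q1 Q2] := single Q m hQ Qm.
have muC v : Col P v -> Col Q (mu v) by case: muB => + _ _; apply.
exists mu; split=> // [v w Cv Cw|u v Cu Cv|u v /P2 //].
  by rewrite P1 // Q1 //; exact: muC.
by split=> [/P2|/Q2].
Qed.

Lemma config_E_equiv t P Q : lattice_polygon P -> lattice_polygon Q ->
  config t P -> config t Q -> E_equiv P Q.
Proof.
move=> hP hQ; case: t => [|||k||] /=; try by
  move=> [f [g hf]] [f' [g' hf']]; exact: (columns_E_equiv hP hQ hf hf').
by move=> [Pk [n hn]] [Qk [m hm]]; exact: (single_E_equiv hP hQ Pk Qk hn hm).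
Qed.

(** With this, [E_equiv_case] also shows that one polygon cannot lie in two cases. *)
Lemma E_equiv_refl P : E_equiv P P.
Proof. by exists id; split=> //; split=> // v Cv; exists v. Qed.

Lemma seq_card (s : seq 'rV[int]_2) : uniq s -> ([set` s] #= `I_(size s))%card.
Proof.
move=> us; have -> : [set` s] = nth 0 s @` `I_(size s).
  apply/seteqP; split=> x /=.
    by move=> xs; exists (index x s); rewrite /= ?index_mem ?nth_index.
  by move=> [i /= lti <-]; exact: mem_nth.
apply: inj_card_eq => i j; rewrite !inE /= => lti ltj /eqP.
by rewrite nth_uniq // => /eqP.
Qed.

Definition case_size t : nat :=
  match t with case_a => 6 | case_b => 4 | case_c => 3 | case_d k => k
  | case_e => 4 | case_f => 2 end.

Lemma col_case_size t P : col_case t P -> (Col P #= `I_(case_size t))%card.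
Proof.
case: t => [|||k||].
- by move=> [p0 [p1 [p2 [us -> _]]]]; exact: seq_card us.
- by move=> [u [v [w [us -> _]]]]; exact: seq_card us.
- by move=> [u [v [w [us -> _]]]]; exact: seq_card us.
- by case.
- by move=> [u [v [us -> _]]]; exact: seq_card us.
- move=> [u [v [-> uv _]]]; apply: (@seq_card [:: u; v]); rewrite /= inE andbT.
  by apply: contra_not_neq uv => ->.
Qed.

Definition same_base P := forall u v, Col P u -> Col P v -> base P u = base P v.

(* Together with the number of column vectors these properties, all invariant
   under E-equivalence, separate the cases. *)
Definition case_kind t P : Prop :=
  match t with
  | case_a | case_b | case_c => relations P <> set0
  | case_d _ => relations P = set0 /\ same_base P
  | case_e | case_f => relations P = set0 /\ ~ same_base P
  end.

Lemma col_case_kind t P : lattice_polygon P -> col_case t P -> case_kind t P.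
Proof.
move=> hP; case: t => [|||k||] /=.
- move=> [p0 [p1 [p2 [_ _ ->]]]] /seteqP[h _].
  pose o (i : nat) (lti : (i < 3)%N) := Ordinal lti.
  by apply: (h (p1 - p0, p2 - p1, p2 - p0)); exists (o 0 isT), (o 1 isT), (o 2 isT).
- by move=> [u [v [w [_ _ ->]]]] /seteqP[h _]; apply: (h (u, v, w)); rewrite /= mem_head.
- by move=> [u [v [w [_ _ ->]]]] /seteqP[h _]; apply: (h (u, v, w)); rewrite /= mem_head.
- by move=> [_ [F hF] ->]; split=> // u v /hF -> /hF ->.
- move=> [u [v [_ CP ->]]]; split=> // hs.
  have Cu : Col P u by rewrite CP /= mem_head.
  have Cu' : Col P (- u) by rewrite CP /= !inE eqxx orbT.
  have [n bn] := (ColP hP _).1 Cu; have [m bm] := (ColP hP _).1 Cu'.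
  have nm := (base_eqP hP bn bm).1 (hs _ _ Cu Cu').
  have [_ nu _] := bn; have [_ + _] := bm.
  by rewrite -nm ipNr nu.
- move=> [u [v [CP uv ->]]]; split=> // hs; apply: uv; apply: hs;
  by rewrite CP /= !inE eqxx ?orbT.
Qed.

Lemma E_equiv_case t t' P Q : lattice_polygon P -> lattice_polygon Q ->
  E_equiv P Q -> col_case t P -> col_case t' Q -> t = t'.
Proof.
move=> hP hQ [mu [muB muH muP muD]] ht ht'.
have [muC muI muS] := muB.
have sz : case_size t = case_size t'.
  have : (`I_(case_size t) #= `I_(case_size t'))%card.
    rewrite (card_eq_trans (B := Col P)) //.
      by rewrite card_eq_sym; exact: col_case_size.
    rewrite (card_eq_trans (B := Col Q)) //; last exact: col_case_size.
    by case: (bijPex.2 (ex_intro _ mu muB)) => h; exact: pcard_eq h.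
  by move/card_eq_II.
have rel0 (S : set 'rV[R]_2) : relations S = set0 <-> forall u v, ~ prod_exists S u v.
  split=> [h u v puv|h]; first by have : relations S (u, v, u + v) by []; rewrite h.
  by apply/seteqP; split=> // -[[u v] w] [/h].
have relE : relations P = set0 <-> relations Q = set0.
  rewrite !rel0; split=> h u v puv.
    have [Cu Cv _ _] := puv.
    have [x Px xu] := muS u Cu; have [y Py yv] := muS v Cv.
    by apply: (h x y); apply/muP => //; rewrite xu yv.
  by have [Cu Cv _ _] := puv; apply: (h (mu u) (mu v)); apply/muP.
(* An edge normal other than the base normal is nonnegative on a column vector, so height -1 occurs
   exactly for equal bases: the matrix of heights determines which bases coincide. *)
have baseH (S : set 'rV[R]_2) u v : lattice_polygon S -> Col S u -> Col S v ->
    base S u = base S v <-> height S (base S u) v = -1.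
  move=> hS /(ColP hS)[n bn] /(ColP hS)[m bm].
  rewrite (base_eqP hS bn bm) (height_base hS _ bn).
  have [en _ _] := bn; have [_ mv hv] := bm; split=> [-> //|nv].
  by apply/eqP; apply: contrapT => /negP /(hv _ en); rewrite nv.
have sameE : same_base P <-> same_base Q.
  split=> h u v Cu Cv.
    have [x Px xu] := muS u Cu; have [y Py yv] := muS v Cv.
    by apply/(baseH Q) => //; rewrite -xu -yv -muH //; apply/(baseH P) => //; exact: h.
  apply/(baseH P) => //; rewrite muH //; apply/(baseH Q) => //; try exact: muC.
  by apply: h; exact: muC.
have := col_case_kind hP ht; have := col_case_kind hQ ht'.
(* Different cases have equal sizes only for (b) against (e), which differ in having relations, or
   when one of them is (d), singled out by having no relations and a common base. *)
move: sz; case: t {ht} => [|||k||]; case: t' {ht'} => [|||k'||] //= sz; try tauto.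
by rewrite sz.
Qed.

End EEquivalence.

(** * Normal fans and affine maps *)

Section Normals.
Variable R : realType.
Local Notation E := 'rV[R]_2.
Local Notation Z := 'rV[int]_2.
Implicit Types (X P Q : set E) (x y l : E) (n v w f g : Z) (c : int * int).

Definition std1 : Z := pt 1 0.
Definition std2 : Z := pt 0 1.

Lemma std_unimodular : unimodular std1 std2.
Proof. by left; rewrite !mxE /=. Qed.

Lemma comb_std c : comb std1 std2 c = pt c.1 c.2.
Proof. by apply/rV2P; rewrite !mxE /=; ring. Qed.

(** Finitely many strict inequalities survive a small displacement. Adding 1 to the norm of [b j]
    avoids a zero denominator. *)
Lemma small_perturbation (T : eqType) (s : seq T) (a b : T -> R) :
  (forall i, i \in s -> 0 < a i) ->
  exists2 e, 0 < e & forall i, i \in s -> 0 <= a i + e * b i.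
Proof.
elim: s => [|j s IH] as0; first by exists 1.
have [|e e0 he] := IH; first by move=> i si; rewrite as0 // inE si orbT.
have aj : 0 < a j by rewrite as0 // mem_head.
have d0 : 0 < `|b j| + 1 by rewrite ltr_wpDl.
exists (Num.min e (a j / (`|b j| + 1))); first by rewrite lt_min e0 divr_gt0.
set t := Num.min _ _; have t0 : 0 < t by rewrite lt_min e0 divr_gt0.
have te : t <= e by rewrite ge_min lexx.
have tj : t * (`|b j| + 1) <= a j.
  by rewrite -ler_pdivlMr // ge_min lexx orbT.
have bj : - `|b j| <= b j by rewrite lerNl -normrN ler_norm.
move=> i; rewrite inE => /orP[/eqP -> | si]; first nra.
have := he i si; have := as0 i; rewrite inE si orbT => /(_ isT); nra.
Qed.

(* A point strictly inside all the half-planes can be moved down along [n], so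
   the midpoint of two points of an edge lies on the boundary of one of them. *)
Lemma halfplanes_normals X (L : seq ((int * int) * int)) :
  (forall x, X x <-> forall p, p \in L ->
    p.2%:~R <= dot (emb R (pt p.1.1 p.1.2)) x) ->
  (forall p, p \in L -> exists v w u, [/\ v != w,
    X (emb R v), X (emb R w), X (emb R u) &
    [/\ primitive (pt p.1.1 p.1.2), ip (pt p.1.1 p.1.2) v = p.2,
        ip (pt p.1.1 p.1.2) w = p.2 & p.2 < ip (pt p.1.1 p.1.2) u]]) ->
  normals X std1 std2 (map fst L).
Proof.
move=> XL hL; split; first exact: std_unimodular.
move=> n; split=> [[pn [x [y [xy nx ny]]]]|[_ /mapP[p pL ->] ->]]; last first.
  have [v [w [u [vw Xv Xw Xu [pp vc wc _]]]]] := hL p pL.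
  rewrite comb_std; split=> //; exists (emb R v), (emb R w).
  split; rewrite ?(inj_eq (@emb_inj R)) //; split=> // z /XL /(_ p pL).
    by rewrite dot_emb vc.
  by rewrite dot_emb wc.
pose z := 2^-1 *: (x + y).
have [Xx xmin] := nx; have [Xy ymin] := ny.
have dxy : dot (emb R n) x = dot (emb R n) y.
  by apply/eqP; rewrite eq_le xmin // ymin.
have dz l : dot l z = 2^-1 * (dot l x + dot l y) by rewrite dotZr dotDr.
have [[p pL pz]|npz] := pselect (exists2 p, p \in L &
    dot (emb R (pt p.1.1 p.1.2)) z = p.2%:~R).
  have [v [w [u [vw Xv Xw Xu [pp vc wc uc]]]]] := hL p pL.
  set k := pt p.1.1 p.1.2 in pz pp vc wc uc.
  have kx : p.2%:~R <= dot (emb R k) x by exact: (XL x).1.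
  have ky : p.2%:~R <= dot (emb R k) y by exact: (XL y).1.
  (* Equality at the midpoint forces equality at both ends, so [n] and [k] are perpendicular to the
     same segment; the point [u] off the edge then rules out [n = - k]. *)
  have kxy : dot (emb R k) x = p.2%:~R /\ dot (emb R k) y = p.2%:~R.
    by move: pz; rewrite dz; split; lra.
  have det0 : k 0 0 * n 0 1 = k 0 1 * n 0 0.
    have [||||t] := @perp_colinear R (x - y) (emb R k) (emb R n).
    - by rewrite subr_eq0.
    - by rewrite emb_eq0 primitive_neq0.
    - by rewrite -[RHS](subrr (p.2%:~R : R)) -{1}kxy.1 -kxy.2 !dot2 !mxE; ring.
    - by rewrite -[RHS](subrr (dot (emb R n) x)) {2}dxy !dot2 !mxE; ring.
    - move=> /rowP nE; have := nE 0; have := nE 1; rewrite !mxE => n1 n0.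
      by apply/eqP; rewrite -(eqr_int R) !intrM n0 n1; apply/eqP; ring.
  have kn : n = k.
    case: (primitive_det0 pp pn det0) => // nk.
    have := xmin _ Xu; rewrite nk embN !dotNl kxy.1 dot_emb lerN2 ler_int.
    by rewrite leNgt uc.
  by exists p.1; [exact: map_f|rewrite comb_std; exact: kn].
pose a (p : (int * int) * int) := dot (emb R (pt p.1.1 p.1.2)) z - p.2%:~R.
pose b (p : (int * int) * int) := - dot (emb R (pt p.1.1 p.1.2)) (emb R n).
have [p pL|e e0 he] := @small_perturbation _ L a b.
  have [v [w [u [_ _ _ _ _]]]] := hL p pL.
  rewrite subr_gt0 lt_neqAle eq_sym; apply/andP; split.
    by apply/eqP => pz; apply: npz; exists p.
  by have := (XL x).1 Xx p pL; have := (XL y).1 Xy p pL; rewrite dz; lra.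
have /xmin : X (z - e *: emb R n).
  apply/XL => p pL; rewrite dotBr [dot _ (e *: _)]dotZr.
  by move: (he p pL); rewrite /a /b => h; lra.
rewrite dotBr [dot _ (e *: _)]dotZr dz -dxy; have := @dot_gt0 R (emb R n).
rewrite emb_eq0 primitive_neq0 // => /(_ isT) nn; nra.
Qed.

Definition ray n : set E := [set t *: emb R n | t in [set t | 0 <= t]].

(** A form that is minimal at two points where [n] is minimal is a multiple of [n], so the cone of
    an edge is a ray. Conversely, if [n] had its minimum at a single vertex, small perturbations of
    [n] would stay in the cone, which would not be a ray. Finite sets of real points are the form in
    which [aff_int_conv] gives affine images. *)
Lemma fan_edge_normal X (W : seq E) n : X = conv_hull [set` W] ->
  noncollinear X -> primitive n -> edge_normal X n <-> normal_fan X (ray n).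
Proof.
move=> XW nc pn; have n0 : emb R n != 0 by rewrite emb_eq0 primitive_neq0.
have nn := dot_gt0 n0.
split=> [[_ [x [y [xy nx ny]]]]|[F [l FE] FR]].
  exists (min_face X (emb R n)); first by exists (emb R n).
  have [Xx xmin] := nx; have [Xy ymin] := ny.
  apply/seteqP; split=> [l hl|_ [t /= t0 <-] z [Xz zmin]]; last first.
    by split=> // u Xu; rewrite !dotZl ler_wpM2l // zmin.
  have [_ lx] := hl _ nx; have [_ ly] := hl _ ny.
  have [|||t lE] := @perp_colinear R (x - y) (emb R n) l _ n0.
  - by rewrite subr_eq0.
  - rewrite -[RHS](subrr (dot (emb R n) x)).
    rewrite {2}(_ : dot _ x = dot (emb R n) y); last first.
      by apply/eqP; rewrite eq_le xmin // ymin.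
    by rewrite !dot2 !mxE; ring.
  - rewrite -[RHS](subrr (dot l x)).
    rewrite {2}(_ : dot _ x = dot l y); last by apply/eqP; rewrite eq_le lx // ly.
    by rewrite !dot2 !mxE; ring.
  exists t; last by rewrite lE.
  have [z Xz] := nc _ (dot (emb R n) x) n0.
  rewrite /= neq_lt => /orP[|nz]; first by rewrite ltNge xmin.
  by have := lx z Xz; rewrite lE !dotZl -subr_ge0 -mulrBr pmulr_lge0 // subr_gt0.
apply: contrapT => ne.
have uniq_min x y : min_face X (emb R n) x -> min_face X (emb R n) y -> x = y.
  move=> nx ny; apply: contrapT => /eqP xy; apply: ne; split=> //.
  by exists x, y.
have [u0 Xu0 _] := nc _ 0 n0.
have [w0 w0W] : exists w : E, w \in W.
  move: Xu0; rewrite XW => /conv_hull_sub_aff hu0.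
  by have [w wW] := aff_hull_neq0 (ex_intro (aff_hull _) u0 hu0); exists w.
have [w wW wmin] := arg_min_seq (fun w : E => dot l w) w0W.
have Xhull (v : E) : v \in W -> X v by rewrite XW => vW; exact: sub_conv_hull.
have Fw : F w.
  rewrite FE; split; first exact: Xhull.
  by move=> y; rewrite XW; apply: conv_hull_dot_ge => v; exact: wmin.
have rn : normal_cone X F (emb R n).
  by rewrite FR; exists 1; rewrite /= ?scale1r.
have Fsub : F `<=` min_face X (emb R n) := rn.
have [Xw nw] := Fsub _ Fw.
(* Perpendicular to [n] and nonzero, so that [emb R n + e *: m] leaves the ray for every positive
   [e]. *)
pose m : E := \row_j [:: - emb R n 0 1; emb R n 0 0]`_j.
have [v|e e0 he] := @small_perturbation _ [seq v : E <- W | v != w]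
    (fun v : E => dot (emb R n) (v - w)) (fun v : E => dot m (v - w)).
  rewrite mem_filter => /andP[vw vW].
  rewrite dotBr subr_gt0 lt_neqAle nw; last exact: Xhull.
  rewrite andbT; apply: contra vw => /eqP nvw; apply/eqP.
  apply: uniq_min => //; split=> [|y Xy]; first exact: Xhull.
  by rewrite -nvw nw.
have : normal_cone X F (emb R n + e *: m).
  move=> y /Fsub ny; rewrite (uniq_min y w ny (Fsub _ Fw)).
  split=> // z; rewrite XW; apply: conv_hull_dot_ge => v /= vW.
  have [->//|vw] := eqVneq v w.
  have := he v; rewrite mem_filter vw vW => /(_ isT).
  by rewrite -dotZl !dot2 !mxE; lra.
rewrite FR => -[t /= t0 tE].
have : dot m (t *: emb R n) = dot m (emb R n + e *: m) by rewrite tE.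
have mm : dot m m = dot (emb R n) (emb R n) by rewrite !dot2 !mxE /=; ring.
have mn : dot m (emb R n) = 0 by rewrite !dot2 !mxE /=; ring.
rewrite dotDr !dotZr mm mn mulr0 add0r; nra.
Qed.

End Normals.

(** * Edge normals under affine-integral equivalence *)

Section AffineMaps.
Variable R : realType.
Local Notation E := 'rV[R]_2.
Local Notation Z := 'rV[int]_2.
Implicit Types (P Q : set E) (x y l : E) (n v w f g : Z) (c : int * int).

Lemma dot_mulmx (A : 'M[R]_2) l x : dot l (x *m A) = dot (l *m A^T) x.
Proof. by rewrite !dot2 !mxE !sum_ord2 !mxE; ring. Qed.

Lemma aff_int_noncollinear P Q : aff_int_equiv P Q -> noncollinear P ->
  noncollinear Q.
Proof.
move=> [A [b [uA _ <-]]] nc l c l0.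
have [|x Px xc] := nc (l *m A^T) (c - dot l b).
  apply: contra l0 => /eqP lA; apply/eqP.
  have uAT : A^T \in unitmx by rewrite unitmx_tr.
  by rewrite -[l](mulmxK uAT) lA mul0mx.
exists (x *m A + b); first by exists x.
by apply: contra xc => /eqP <-; rewrite dotDr dot_mulmx addrK.
Qed.

Lemma aff_int_conv P Q : aff_int_equiv P Q -> (exists V : seq Z, P = conv_lat V) ->
  exists W : seq E, Q = conv_hull [set` W].
Proof.
move=> [A [b [uA _ <-]]] [V ->]; pose F x := x *m A + b.
have Fsum k (a : 'I_k -> R) (p : 'I_k -> E) : \sum_i a i = 1 ->
    F (\sum_i a i *: p i) = \sum_i a i *: F (p i).
  move=> a1; rewrite /F mulmx_suml -[b in LHS]scale1r -a1 scaler_suml -big_split.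
  by apply: eq_bigr => i _; rewrite scalerDr -scalemxAl.
exists [seq F (emb R v) | v <- V]; apply/seteqP; split.
  move=> _ [_ [k [a [p [a0 a1 Vp ->]]]] <-].
  exists k, a, (F \o p); split=> //; last exact: Fsum.
  by move=> i; have [v vV /= <-] := Vp i; exact: map_f.
move=> _ [k [a [p [a0 a1 Vp ->]]]].
exists (\sum_i a i *: ((p i - b) *m invmx A)); last first.
  rewrite -[LHS]/(F _) Fsum //; apply: eq_bigr => i _.
  by rewrite /F mulmxKV // subrK.
exists k, a, (fun i => (p i - b) *m invmx A); split=> // i.
by have /mapP[v vV ->] := Vp i; exists v; rewrite //= /F addrK mulmxK.
Qed.

(** An affine map preserving the lattice has an integral linear part, and its transpose pulls back
    normals. The new forms are the pullbacks of [std1] and [std2], so the list of coefficients is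
    unchanged. *)
Lemma aff_int_normals P Q L : aff_int_equiv P Q -> normals Q std1 std2 L ->
  exists f g, normals P f g L.
Proof.
move=> [A [b [uA fZ fP]]] [_ hL]; pose F x := x *m A + b.
have FZ v : exists w, emb R w = F (emb R v).
  have [w _ wE] : range (@emb R 2) (F (emb R v)) by rewrite -fZ; exists (emb R v).
  by exists w.
have ZF w : exists v, F (emb R v) = emb R w.
  have [_ [v _ <-] vE] : [set x *m A + b | x in range (@emb R 2)] (emb R w).
    by rewrite fZ; exists w.
  by exists v.
have [b0 b0E] := FZ 0; have {}b0E : emb R b0 = b.
  by rewrite b0E /F (_ : emb R 0 = 0) ?mul0mx ?add0r //; apply/rowP => i; rewrite !mxE.
have [r0 r0E] := FZ std1; have [r1 r1E] := FZ std2.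
(* Its rows are the images of the unit vectors minus the image of the origin; they are integral and
   are the rows of [A]. *)
pose A0 : 'M[int]_2 := \matrix_(i, j) (if i == 0 then r0 - b0 else r1 - b0) 0 j.
have A0E j : ((A0 0 j)%:~R = A 0 j) * ((A0 1 j)%:~R = A 1 j).
  have e0 : emb R (r0 - b0) 0 j = A 0 j.
    by rewrite embB r0E b0E /F addrK !mxE sum_ord2 !mxE /= mul1r mul0r addr0.
  have e1 : emb R (r1 - b0) 0 j = A 1 j.
    by rewrite embB r1E b0E /F addrK !mxE sum_ord2 !mxE /= mul1r mul0r add0r.
  by split; rewrite mxE /= -?e0 -?e1 embE.
have embM v : emb R (v *m A0) = emb R v *m A.
  by apply/rV2P; rewrite !mxE !sum_ord2 !embE rmorphD !rmorphM /= !A0E.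
have surj w : exists v, v *m A0 = w.
  have [v vE] := ZF (w + b0); exists v; apply: (@emb_inj R).
  by apply: (addIr b); rewrite embM -b0E -embD -vE b0E.
pose T n : Z := n *m A0^T.
have ipT n v : ip (T n) v = ip n (v *m A0) by rewrite /ip !mxE !sum_ord2 !mxE; ring.
have dotT n x : dot (emb R (T n)) x = dot (emb R n) (x *m A).
  rewrite !dot2 !embE !mxE !sum_ord2 ![A0^T _ _]mxE !rmorphD !rmorphM /= !A0E.
  by ring.
have F_inj : injective F by move=> x y /addIr /(can_inj (mulmxK uA)).
have mfT n x : min_face Q (emb R n) (F x) <-> min_face P (emb R (T n)) x.
  have dF z : dot (emb R n) (F z) = dot (emb R (T n)) z + dot (emb R n) b.
    by rewrite dotDr dotT.
  rewrite -fP; split=> [[[x' Px' /F_inj xx'] xmin]|[Px xmin]].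
    rewrite xx' in Px'; split=> // y Py; rewrite -(lerD2r (dot (emb R n) b)) -!dF.
    by apply: xmin; exists y.
  split=> [|_ [y Py <-]]; first by exists x.
  by rewrite [X in _ <= dot _ X]/(F y) !dF lerD2r xmin.
have edgeT n : edge_normal Q n <-> edge_normal P (T n).
  split=> [[[m nm] [x [y [xy nx ny]]]]|[[m nm] [x [y [xy nx ny]]]]].
    have [k kE] := surj m; split; first by exists k; rewrite ipT kE.
    have [x' _ xE] : [set x *m A + b | x in P] x by rewrite fP; case: nx.
    have [y' _ yE] : [set x *m A + b | x in P] y by rewrite fP; case: ny.
    exists x', y'; split; [|by apply/mfT; rewrite /F xE|by apply/mfT; rewrite /F yE].
    by apply: contra xy => /eqP e; rewrite -xE -yE e.
  split; first by exists (m *m A0); rewrite -ipT.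
  by exists (F x), (F y); split; rewrite ?(inj_eq F_inj) //; exact/mfT.
have Tcomb c : T (comb std1 std2 c) = comb (T std1) (T std2) c.
  by rewrite /T /comb mulmxDl -!scalemxAl.
(* Preimages of the unit vectors under [A0] pair with the two forms to the identity matrix. *)
have uT : unimodular (T std1) (T std2).
  have [x0 x0E] := surj std1; have [x1 x1E] := surj std2.
  apply: (@unimodular_of_pairing _ _ x0 x1).
  by rewrite !ipT x0E x1E /ip !mxE.
exists (T std1), (T std2); split=> // k.
have [c0 kE] := unimodular_comb k uT; rewrite -Tcomb in kE; rewrite kE -edgeT hL.
split=> -[c cL cE]; exists c => //; first by rewrite -Tcomb cE.
by move: cE; rewrite Tcomb => /(comb_inj uT) ->.
Qed.
End AffineMaps.

(** * Shapes *)

Section Shapes.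
Variable R : realType.
Local Notation E := 'rV[R]_2.
Local Notation Z := 'rV[int]_2.
Implicit Types (P Q : set E) (x y l : E) (n v w f g : Z) (c : int * int).

(** The coordinates with respect to [f] and [g], shifted by integers: the map that brings a polygon
    into standard position. *)
Definition form_map f g (a b : int) x : E :=
  \row_j [:: dot (emb R f) x + a%:~R; dot (emb R g) x + b%:~R]`_j.

Lemma form_mapE f g a b x : (form_map f g a b x 0 0 = dot (emb R f) x + a%:~R) *
  (form_map f g a b x 0 1 = dot (emb R g) x + b%:~R).
Proof. by rewrite !mxE. Qed.

Lemma form_map_aff f g a b P : unimodular f g ->
  aff_int_equiv P (form_map f g a b @` P).
Proof.
move=> fg; have := unimodular_sqr fg; set D := _ - _ => D1.
pose A : 'M[R]_2 := \matrix_(i, j) emb R (if j == 0 then f else g) 0 i.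
(* The inverse of [A]: its adjugate times the determinant [D], which is its own inverse. *)
pose B : 'M[R]_2 := \matrix_(i, j) (D * (if i == 0 then [:: g 0 1; - g 0 0]
   else [:: - f 0 1; f 0 0])`_j)%:~R.
have FE x : x *m A + emb R (pt a b) = form_map f g a b x.
  apply/rV2P; rewrite !form_mapE !mxE !sum_ord2 !mxE /=.
    by rewrite dot2 !embE; ring.
  by rewrite dot2 !embE; ring.
have intE (p q r s : int) : p%:~R * q%:~R + r%:~R * s%:~R = (p * q + r * s)%:~R :> R.
  by rewrite rmorphD !rmorphM.
exists A, (emb R (pt a b)); split.
- have [] // := @mulmx1_unit _ _ A B; apply/matrixP.
  have ord2 (i : 'I_2) : i = 0 \/ i = 1.
    by case: i => -[|[|//]] ?; [left|right]; exact: val_inj.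
  move=> i j; have [->|->] := ord2 i; have [->|->] := ord2 j;
  rewrite !mxE !sum_ord2 !mxE /= intE ?(_ : _ == _ = false) //.
  + by rewrite mulr1n -[RHS](congr1 intr D1) /D; congr intr; ring.
  + by rewrite mulr0n -[RHS](rmorph0 intr); congr intr; ring.
  + by rewrite mulr0n -[RHS](rmorph0 intr); congr intr; ring.
  + by rewrite mulr1n -[RHS](congr1 intr D1) /D; congr intr; ring.
- have embF v : form_map f g a b (emb R v) = emb R (pt (ip f v + a) (ip g v + b)).
    by apply/rV2P; rewrite form_mapE dot_emb embE [pt _ _ _ _]mxE /= [RHS]intrD.
  apply/seteqP; split=> [_ [_ [v _ <-] <-]|_ [v _ <-]].
    by rewrite FE embF; exists (pt (ip f v + a) (ip g v + b)).
  have [w [fw gw]] := unimodular_surj (v 0 0 - a) (v 0 1 - b) fg.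
  exists (emb R w); first by exists w.
  by rewrite FE embF fw gw !subrK; congr emb; apply/rV2P; rewrite !mxE.
- by apply: eq_imagel => x _; rewrite FE.
Qed.

Lemma form_map_surj f g a b y : unimodular f g -> exists x, form_map f g a b x = y.
Proof.
move=> /unimodular_sqr; set D := _ - _ => D1.
have DR : (D%:~R : R) * D%:~R = 1 by rewrite -intrM D1.
pose p := y 0 0 - a%:~R; pose q := y 0 1 - b%:~R.
exists (D%:~R *: \row_j [:: (g 0 1)%:~R * p - (f 0 1)%:~R * q;
  (f 0 0)%:~R * q - (g 0 0)%:~R * p]`_j).
have DE : (D%:~R : R) = (f 0 0)%:~R * (g 0 1)%:~R - (f 0 1)%:~R * (g 0 0)%:~R.
  by rewrite /D rmorphB !rmorphM.
apply/rV2P; rewrite form_mapE dotZr dot2 !embE !mxE /=.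
  transitivity (D%:~R * D%:~R * p + a%:~R); first by rewrite {3}DE; ring.
  by rewrite DR mul1r subrK.
transitivity (D%:~R * D%:~R * q + b%:~R); first by rewrite {3}DE; ring.
by rewrite DR mul1r subrK.
Qed.

Lemma dot_comb f g c x :
  dot (emb R (comb f g c)) x = c.1%:~R * dot (emb R f) x + c.2%:~R * dot (emb R g) x.
Proof.
by rewrite !dot2 !embE !mxE !rmorphD !rmorphM /=; ring.
Qed.

Lemma dot_pt (a b : int) x : dot (emb R (pt a b)) x = a%:~R * x 0 0 + b%:~R * x 0 1.
Proof. by rewrite dot2 !embE !mxE. Qed.

Lemma ip_pt (a b c d : int) : ip (pt a b) (pt c d) = a * c + b * d.
Proof. by rewrite /ip !mxE. Qed.

Lemma normals_halfplanes P f g L : lattice_polygon P -> normals P f g L ->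
  exists o : int * int -> int, (forall c, c \in L -> edge P (comb f g c) (o c)) /\
  forall x, P x <-> forall c, c \in L -> (o c)%:~R <= dot (emb R (comb f g c)) x.
Proof.
move=> [PV dimP _] [fg hL].
pose S c : set int := [set k | edge P (comb f g c) k].
pose o c := xget 0 (S c).
have ho c : c \in L -> edge P (comb f g c) (o c).
  move=> cL; apply: (@xgetPex _ 0 (S c)); apply/(edge_normalP _ PV)/hL.
  by exists c.
exists o; split=> // x; split=> [Px c /ho[_ _ h]|h]; first exact: h.
apply: (mem_edges (has_dim2_noncollinear dimP) PV) => n k e.
have [|c cL nE] := (hL n).1; first by apply/(edge_normalP _ PV); exists k.
by rewrite nE in e *; rewrite (edge_inj e (ho _ cL)); exact: h.
Qed.

Lemma Delta2E x : Delta2 R x <-> [/\ 0 <= x 0 0, 0 <= x 0 1 & x 0 0 + x 0 1 <= 1].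
Proof.
split=> [hx|[x0 x1 x01]].
  have h (a b k : int) : k <= 0 -> k <= a -> k <= b ->
      k%:~R <= a%:~R * x 0 0 + b%:~R * x 0 1.
    move=> k0 ka kb; rewrite -dot_pt; apply: conv_hull_dot_ge hx => _ [v + <-].
    rewrite /= !inE dot_emb ler_int => /or3P[] /eqP ->;
    by rewrite ip_pt ?mulr0 ?mulr1 ?addr0 ?add0r.
  have := h 1 0 0 isT isT isT; have := h 0 1 0 isT isT isT.
  by have := h (-1) (-1) (-1) isT isT isT; rewrite rmorphN /= => *; split; lra.
have := @conv_hull_seq R 2 [set emb R v | v in [set` [:: pt 0 0; pt 1 0; pt 0 1]]]
  [:: (1 - x 0 0 - x 0 1, emb R (pt 0 0)); (x 0 0, emb R (pt 1 0));
      (x 0 1, emb R (pt 0 1))].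
rewrite !big_cons !big_nil /= (_ : _ *: _ + _ = x); last first.
  by apply/rV2P; rewrite !mxE /=; ring.
apply; last by ring.
move=> w; rewrite !inE => /or3P[] /eqP -> /=; split; try lra;
by eexists; last reflexivity; rewrite /= !inE eqxx ?orbT.
Qed.

Lemma triangle_shape P f g : lattice_polygon P -> normals P f g triangle_normals ->
  exists2 c : nat, (0 < c)%N & aff_int_equiv P [set c%:R *: x | x in Delta2 R].
Proof.
move=> hP hN; have [fg hL] := hN; have [lev [ho Po]] := normals_halfplanes hP hN.
have e1 := ho (1, 0) isT; have e2 := ho (0, 1) isT; have e3 := ho (-1, -1) isT.
set a := lev (1, 0) in e1; set b := lev (0, 1) in e2; set d := lev (-1, -1) in e3.
(* Two lattice points on the first edge differ in the form [g], whose values there lie between [b]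
   and [- d - a]. *)
have pos : 0 < - d - a - b.
  have [_ [v [w [vw Pv Pw va wa]]] _] := e1.
  have := edge_lat e2 Pv; have := edge_lat e2 Pw.
  have := edge_lat e3 Pv; have := edge_lat e3 Pw.
  move: va wa; rewrite !ip_comb /pairing /= => va wa.
  have : ip g v != ip g w.
    apply: contra vw => /eqP gvw; apply/eqP/(unimodular_inj fg).
    by rewrite /coords gvw; congr pair; lia.
  by lia.
(* After the shift that brings the first two levels to 0, the third inequality bounds the sum of the
   coordinates by this number. *)
pose N := absz (- d - a - b)%R; exists N; first by rewrite /N; lia.
have cE : N%:R = - d%:~R - a%:~R - b%:~R :> R.
  by rewrite natr_absz gtr0_norm // !rmorphB rmorphN.
suff -> : [set N%:R *: x | x in Delta2 R] =
    form_map f g (- a) (- b) @` P by exact: form_map_aff.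
have c0 : 0 < N%:R :> R by rewrite ltr0n /N; lia.
rewrite cE in c0 *; apply/seteqP; split=> [_ [x /Delta2E[x0 x1 x01] <-]|_ [x /Po Px <-]].
  have [y yE] := form_map_surj (- a) (- b) ((- d%:~R - a%:~R - b%:~R) *: x) fg.
  exists y => //; apply/Po => c.
  have := form_mapE f g (- a) (- b) y; rewrite yE !mxE => -[fy gy].
  rewrite !inE dot_comb => /or3P[] /eqP -> /=; rewrite -/a -/b -/d ?rmorphN /=.
  - by rewrite rmorphN /= in fy; nra.
  - by rewrite rmorphN /= in gy; nra.
  - by rewrite rmorphN /= in fy gy; nra.
have := Px (1, 0) isT; have := Px (0, 1) isT; have := Px (-1, -1) isT.
rewrite !dot_comb /= -/a -/b -/d => h3 h2 h1.
exists ((- d%:~R - a%:~R - b%:~R)^-1 *: form_map f g (- a) (- b) x); last first.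
  by rewrite scalerA mulfV ?scale1r // gt_eqF.
apply/Delta2E; rewrite ![(_ *: form_map _ _ _ _ _) _ _]mxE !form_mapE -mulrDr !rmorphN /=.
move: h1 h2 h3; rewrite rmorphN /= => h1 h2 h3.
split; last by rewrite mulrC ler_pdivrMr //; lra.
  by apply: mulr_ge0; [rewrite invr_ge0 ltW|lra].
by apply: mulr_ge0; [rewrite invr_ge0 ltW|lra].
Qed.

(* A trapezoid if m = 1, a rectangle if m = 0. *)
Definition quad (m a b d e : R) : set E :=
  [set x | [/\ a <= x 0 0, b <= x 0 1, x 0 1 <= d & x 0 0 + m * x 0 1 <= e]].

Definition rpt (a b : R) : E := \row_j [:: a; b]`_j.

Definition quad_vertices (m a b d e : R) : seq E :=
  [:: rpt a b; rpt (e - m * b) b; rpt (e - m * d) d; rpt a d].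

Lemma quad_conv m a b d e : 0 <= m -> b < d -> a < e - m * d ->
  quad m a b d e = conv_hull [set` quad_vertices m a b d e].
Proof.
move=> m0 bd ad; have md : m * b <= m * d by rewrite ler_wpM2l // ltW.
apply/seteqP; split=> [x [x0 x1 x2 x3]|x hx]; last first.
  have h (l : E) k : (forall v : E, v \in quad_vertices m a b d e -> k <= dot l v) ->
      k <= l 0 0 * x 0 0 + l 0 1 * x 0 1.
    by move=> hk; rewrite -dot2; apply: conv_hull_dot_ge hx.
  have h4 p q k : k <= p * a + q * b -> k <= p * (e - m * b) + q * b ->
      k <= p * (e - m * d) + q * d -> k <= p * a + q * d ->
      k <= p * x 0 0 + q * x 0 1.
    move=> k1 k2 k3 k4; have := h (rpt p q) k; rewrite !mxE /=; apply=> v.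
    by rewrite !inE => /or4P[] /eqP ->; rewrite dot2 !mxE.
  have k1 : a <= x 0 0.
    by have := h4 1 0 a; rewrite !mul1r !mul0r !addr0; apply; lra.
  have k2 : b <= x 0 1.
    by have := h4 0 1 b; rewrite !mul1r !mul0r !add0r; apply; lra.
  have k3 : - d <= - x 0 1.
    by have := h4 0 (-1) (- d); rewrite !mul0r !add0r !mulN1r; apply; lra.
  have k4 : - e <= - x 0 0 - m * x 0 1.
    by have := h4 (-1) (- m) (- e); rewrite !mulN1r !mulNr; apply; lra.
  by split; lra.
have dx : 0 < e - m * x 0 1 - a by have := ler_wpM2l m0 x2; lra.
have db : 0 < d - b by lra.
(* [t] is the relative height of [x] and [s] its relative position in the horizontal section at that
   height; the vertex weights are products of [s] or [1 - s] with [t] or [1 - t]. *)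
pose t := (x 0 1 - b) / (d - b); pose s := (x 0 0 - a) / (e - m * x 0 1 - a).
have tE : t * (d - b) = x 0 1 - b by rewrite divfK // gt_eqF.
have sE : s * (e - m * x 0 1 - a) = x 0 0 - a by rewrite divfK // gt_eqF.
have t0 : 0 <= t by rewrite divr_ge0 //; lra.
have s0 : 0 <= s by rewrite divr_ge0 //; lra.
have t1 : t <= 1 by rewrite ler_pdivrMr //; lra.
have s1 : s <= 1 by rewrite ler_pdivrMr //; lra.
have := @conv_hull_seq R 2 [set` quad_vertices m a b d e]
  [:: ((1 - s) * (1 - t), rpt a b); (s * (1 - t), rpt (e - m * b) b);
      (s * t, rpt (e - m * d) d); ((1 - s) * t, rpt a d)].
rewrite !big_cons !big_nil /= (_ : _ *: _ + _ = x); last first.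
  apply/rV2P; rewrite !mxE /=.
    transitivity (a + s * (e - m * (b + t * (d - b)) - a)); first by ring.
    by rewrite tE addrC [b + _]addrC subrK sE subrK.
  transitivity (b + t * (d - b)); first by ring.
  by rewrite tE addrC subrK.
apply; last by ring.
rewrite -subr_ge0 in s1; rewrite -subr_ge0 in t1.
by move=> w; rewrite !inE => /or4P[] /eqP -> /=;
  (split; [exact: mulr_ge0|rewrite /= ?inE ?eqxx ?orbT]).
Qed.

(** The normal cone of vertex [i] in the order of [quad_vertices]; the last branch is vertex 3. Only
    [m] enters, not the position of the sides, which is why all such quadrilaterals with the same
    [m] share one fan. *)
Definition quad_min (m : R) (i : nat) (l : E) : Prop :=
  match i with
  | 0 => 0 <= l 0 0 /\ 0 <= l 0 1
  | 1 => l 0 0 <= 0 /\ m * l 0 0 <= l 0 1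
  | 2 => l 0 0 <= 0 /\ l 0 1 <= m * l 0 0
  | _ => 0 <= l 0 0 /\ l 0 1 <= 0
  end.

Lemma quad_minP m a b d e l i : 0 <= m -> b < d -> a < e - m * d -> (i < 4)%N ->
  min_face (quad m a b d e) l (nth 0 (quad_vertices m a b d e) i) <-> quad_min m i l.
Proof.
move=> m0 bd ad i4; have md : m * b <= m * d by rewrite ler_wpM2l // ltW.
have Qv (v : E) : v \in quad_vertices m a b d e -> quad m a b d e v.
  by rewrite quad_conv // => vQ; exact: sub_conv_hull.
set p := nth _ _ _.
have -> : min_face (quad m a b d e) l p <->
    forall v : E, v \in quad_vertices m a b d e -> dot l p <= dot l v.
  split=> [[_ h] v vQ|h]; first exact/h/Qv.
  split; first by apply: Qv; exact: mem_nth.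
  by move=> y; rewrite quad_conv //; exact: conv_hull_dot_ge.
have -> : (forall v : E, v \in quad_vertices m a b d e -> dot l p <= dot l v) <->
    [/\ dot l p <= dot l (rpt a b), dot l p <= dot l (rpt (e - m * b) b),
      dot l p <= dot l (rpt (e - m * d) d) & dot l p <= dot l (rpt a d)].
  split=> [h|[h1 h2 h3 h4] v]; first by split; apply: h; rewrite !inE eqxx ?orbT.
  by rewrite !inE => /or4P[] /eqP ->.
have hH : 0 < d - b by lra.
have hL : 0 < e - m * d - a by lra.
have ge0M (u v : R) : 0 < u -> 0 <= u * v -> 0 <= v by move=> u0; rewrite pmulr_rge0.
have Mge0 (u v : R) : 0 < u -> 0 <= v -> 0 <= u * v by move=> u0; rewrite pmulr_rge0.
have hL' : 0 < e - m * b - a by lra.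
rewrite {}/p; move: i i4; do 4?[case=> //] => /= _; rewrite !dot2 !mxE /=.
- split=> [[_ h2 _ h4]|[h1 h2]].
    by split; [apply: (ge0M _ _ hL'); lra|apply: (ge0M _ _ hH); lra].
  have := Mge0 _ _ hL' h1; have := Mge0 _ _ hL h1; have := Mge0 _ _ hH h2.
  by move=> *; split; lra.
- split=> [[h1 _ h3 _]|[h1 h2]].
    split; first by rewrite -oppr_ge0; apply: (ge0M _ _ hL'); lra.
    by rewrite -subr_ge0; apply: (ge0M _ _ hH); lra.
  rewrite -oppr_ge0 in h1; rewrite -subr_ge0 in h2.
  have := Mge0 _ _ hL' h1; have := Mge0 _ _ hL h1; have := Mge0 _ _ hH h2.
  by move=> *; split; lra.
- split=> [[_ h2 _ h4]|[h1 h2]].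
    split; first by rewrite -oppr_ge0; apply: (ge0M _ _ hL); lra.
    by rewrite -subr_ge0; apply: (ge0M _ _ hH); lra.
  rewrite -oppr_ge0 in h1; rewrite -subr_ge0 in h2.
  have := Mge0 _ _ hL' h1; have := Mge0 _ _ hL h1; have := Mge0 _ _ hH h2.
  by move=> *; split; lra.
- split=> [[h1 _ h3 _]|[h1 h2]].
    split; first by apply: (ge0M _ _ hL); lra.
    by rewrite -oppr_ge0; apply: (ge0M _ _ hH); lra.
  rewrite -oppr_ge0 in h2.
  have := Mge0 _ _ hL' h1; have := Mge0 _ _ hL h1; have := Mge0 _ _ hH h2.
  by move=> *; split; lra.
Qed.

(** A face is the hull of the generators on it, so inclusion of faces can be tested on
    generators. *)
Lemma min_face_sub_conv (S : set E) l l' :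
  min_face (conv_hull S) l `<=` min_face (conv_hull S) l' <->
  forall p, S p -> min_face (conv_hull S) l p -> min_face (conv_hull S) l' p.
Proof.
split=> [h p _ /h //|h x lx]; have [Sx _] := lx; split=> // y Sy.
have hx := conv_hull_sub_aff (min_face_conv lx).
have [z [Sz lz]] := aff_hull_neq0 (ex_intro (aff_hull _) x hx).
have [Cz zmin] := h z Sz lz.
rewrite (aff_hull_dot (c := dot l' z) _ hx) ?zmin // => p [Sp lp].
have [Cp pmin] := h p Sp lp.
by apply/eqP; rewrite eq_le pmin // zmin.
Qed.

(** The cone of a face consists of the forms that are minimal at each of its vertices, and
    [quad_minP] expresses this without the levels of the sides. *)
Lemma quad_fan m a b d e : 0 <= m -> b < d -> a < e - m * d ->
  normal_fan (quad m a b d e) =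
  [set [set l' | forall i, (i < 4)%N -> quad_min m i l -> quad_min m i l']
    | l in setT].
Proof.
move=> m0 bd ad.
have coneE l : normal_cone (quad m a b d e) (min_face (quad m a b d e) l) =
    [set l' | forall i, (i < 4)%N -> quad_min m i l -> quad_min m i l'].
  have minP := quad_minP _ m0 bd ad.
  apply/seteqP; split=> l' /=; rewrite /normal_cone /= {1 2}quad_conv //.
    move=> /min_face_sub_conv h i i4 /(minP l _ i4) li; apply/(minP l' _ i4).
    by rewrite quad_conv // in li *; apply: h => //=; exact: mem_nth.
  move=> h; apply/min_face_sub_conv => v /= /(nthP 0)[i i4 <-].
  by rewrite -quad_conv // => /(minP l _ i4)/(h i i4)/(minP l' _ i4).
apply/seteqP; split=> [_ [_ [l ->] <-]|_ [l _ <-]].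
  by exists l; rewrite ?coneE.
by exists (min_face (quad m a b d e) l); [exists l|rewrite coneE].
Qed.

Lemma quad_proj_equiv m a b d e a' b' d' e' : 0 <= m ->
  b < d -> a < e - m * d -> b' < d' -> a' < e' - m * d' ->
  proj_equiv (quad m a b d e) (quad m a' b' d' e').
Proof. by move=> *; rewrite /proj_equiv !quad_fan. Qed.

Lemma conv_latE (V : seq Z) : conv_lat V = conv_hull [set` map (@emb R 2) V].
Proof.
rewrite /conv_lat; congr conv_hull; apply/seteqP; split=> y /=.
  by move=> [v vV <-]; exact: map_f.
by move=> /mapP[v vV ->]; exists v.
Qed.

Lemma emb_pt (a b : int) : emb R (pt a b) = rpt a%:~R b%:~R.
Proof. by apply/rV2P; rewrite !mxE. Qed.

Lemma trapezoidE : trapezoid R = quad 1 0 0 1 2.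
Proof.
have h : (0 : R) < 2 - 1 * 1 by lra.
rewrite (quad_conv ler01 ltr01 h).
rewrite /trapezoid conv_latE (_ : map _ _ = quad_vertices 1 0 0 1 2) //.
by rewrite /quad_vertices /= !emb_pt; congr [:: _; rpt _ _; rpt _ _; _]; lra.
Qed.

Lemma unit_squareE : unit_square R = quad 0 0 0 1 1.
Proof.
have h : (0 : R) < 1 - 0 * 1 by lra.
rewrite (quad_conv (lexx 0) ltr01 h).
rewrite /unit_square conv_latE; congr (conv_hull _).
rewrite /quad_vertices /= !emb_pt !mul0r !subr0.
by apply/seteqP; split=> x /=; rewrite !inE => /or4P[] ->; rewrite ?orbT.
Qed.

Lemma quad_std_normals (m a b d e : int) : 0 <= m -> b < d -> a < e - m * d ->
  normals (quad m%:~R a%:~R b%:~R d%:~R e%:~R : set E) std1 std2 (quad_normals m).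
Proof.
move=> m0 bd ad; have md : m * b <= m * d by rewrite ler_wpM2l // ltW.
apply: (@halfplanes_normals R _
  [:: ((1, 0), a); ((0, 1), b); ((0, -1), - d); ((-1, - m), - e)]).
  move=> x; split=> [[x0 x1 x2 x3] p|h].
    by rewrite !inE => /or4P[] /eqP -> /=; rewrite dot_pt ?rmorphN /=; lra.
  have := h ((1, 0), a); have := h ((0, 1), b).
  have := h ((0, -1), - d); have := h ((-1, - m), - e).
  rewrite !inE !eqxx !orbT !dot_pt ?rmorphN /= => /(_ isT) h1 /(_ isT) h2
    /(_ isT) h3 /(_ isT) h4.
  by split; lra.
have Q (u v : int) : a <= u -> b <= v -> v <= d -> u + m * v <= e ->
    (quad m%:~R a%:~R b%:~R d%:~R e%:~R : set E) (emb R (pt u v)).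
  by move=> *; rewrite emb_pt; split; rewrite !mxE /= -?intrM -?intrD ler_int.
have ptE (u v u' v' : int) : pt u v == pt u' v' -> u = u' /\ v = v'.
  by move=> /eqP/rowP h; have := h 0; have := h 1; rewrite !mxE.
have Q1 := Q a b; have Q2 := Q (e - m * b) b; have Q3 := Q (e - m * d) d.
have Q4 := Q a d.
move=> p; rewrite !inE => /or4P[] /eqP -> /=.
- exists (pt a b), (pt a d), (pt (e - m * b) b).
  split; [by apply/negP => /ptE; lia|apply: Q1; lia|apply: Q4; lia|apply: Q2; lia|].
  by rewrite !ip_pt; split; [exists (pt 1 0); rewrite ip_pt; lia|lia|lia|lia].
- exists (pt a b), (pt (e - m * b) b), (pt a d).
  split; [by apply/negP => /ptE; lia|apply: Q1; lia|apply: Q2; lia|apply: Q4; lia|].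
  by rewrite !ip_pt; split; [exists (pt 0 1); rewrite ip_pt; lia|lia|lia|lia].
- exists (pt a d), (pt (e - m * d) d), (pt a b).
  split; [by apply/negP => /ptE; lia|apply: Q4; lia|apply: Q3; lia|apply: Q1; lia|].
  by rewrite !ip_pt; split; [exists (pt 0 (-1)); rewrite ip_pt; lia|lia|lia|lia].
- exists (pt (e - m * b) b), (pt (e - m * d) d), (pt a b).
  split; [by apply/negP => /ptE; lia|apply: Q2; lia|apply: Q3; lia|apply: Q1; lia|].
  by rewrite !ip_pt; split; [exists (pt (-1) 0); rewrite ip_pt; lia|lia|lia|lia].
Qed.

Lemma quad_shape P f g (m : int) : 0 <= m -> lattice_polygon P ->
  normals P f g (quad_normals m) ->
  exists a b d e : int, [/\ b < d, a < e - m * d &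
    aff_int_equiv P (quad m%:~R a%:~R b%:~R d%:~R e%:~R)].
Proof.
move=> m0 hP hN; have [fg hL] := hN; have [lev [ho Po]] := normals_halfplanes hP hN.
have e1 := ho (1, 0) isT; have e2 := ho (0, 1) isT; have e3 := ho (0, -1) isT.
have e4 := ho (-1, - m); rewrite !inE eqxx !orbT in e4; have {}e4 := e4 isT.
set a := lev (1, 0) in e1; set b := lev (0, 1) in e2; set d := lev (0, -1) in e3.
set e := lev (-1, - m) in e4.
(* Two lattice points on the side with normal [f] differ in the form [g], whose values lie between
   [b] and [- d]. *)
have bd : b < - d.
  have [_ [v [w [vw Pv Pw va wa]]] _] := e1.
  have := edge_lat e2 Pv; have := edge_lat e2 Pw.
  have := edge_lat e3 Pv; have := edge_lat e3 Pw.
  move: va wa; rewrite !ip_comb /pairing /= => va wa.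
  have : ip g v != ip g w.
    apply: contra vw => /eqP gvw; apply/eqP/(unimodular_inj fg).
    by rewrite /coords gvw; congr pair; lia.
  by lia.
(* The side with normal [- g] has two lattice points, so the quadrilateral does not degenerate to a
   triangle there. *)
have ad : a < - e - m * - d.
  have [_ [v [w [vw Pv Pw va wa]]] _] := e3.
  have := edge_lat e1 Pv; have := edge_lat e1 Pw.
  have := edge_lat e4 Pv; have := edge_lat e4 Pw.
  move: va wa; rewrite !ip_comb /pairing /= => va wa.
  have gv : ip g v = - d by lia.
  have gw : ip g w = - d by lia.
  have : ip f v != ip f w.
    apply: contra vw => /eqP fvw; apply/eqP/(unimodular_inj fg).
    by rewrite /coords fvw gv gw.
  by rewrite gv gw; lia.
exists a, b, (- d), (- e); split=> //.
suff -> : quad m%:~R a%:~R b%:~R (- d)%:~R (- e)%:~R = form_map f g 0 0 @` P.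
  exact: form_map_aff.
have PE x : P x <-> quad m%:~R a%:~R b%:~R (- d)%:~R (- e)%:~R (form_map f g 0 0 x).
  rewrite Po /quad /= !form_mapE !addr0 !rmorphN /=; split=> [h|[h1 h2 h3 h4] c].
    have := h (1, 0) isT; have := h (0, 1) isT; have := h (0, -1) isT.
    have := h (-1, - m); rewrite !inE eqxx !orbT => /(_ isT).
    rewrite !dot_comb /= !rmorphN /= -/a -/b -/d -/e => k4 k3 k2 k1.
    by split; lra.
  by rewrite !inE dot_comb => /or4P[] /eqP -> /=;
    rewrite ?rmorphN /= -/a -/b -/d -/e; lra.
apply/seteqP; split=> [y Qy|_ [x Px <-]]; last exact/PE.
by have [x xE] := form_map_surj 0 0 y fg; exists x => //; apply/PE; rewrite xE.
Qed.

End Shapes.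

(** * Realization *)

Section Examples.
Variable R : realType.
Local Notation E := 'rV[R]_2.
Local Notation Z := 'rV[int]_2.
Implicit Types (P Q T : set E) (x y l : E) (n v w f g : Z) (c : int * int).

(** The origin and the unit vectors span the plane affinely, and integral combinations of their
    differences give the whole lattice. *)
Lemma std_lattice_polygon (V : seq Z) :
  (conv_lat V : set E) (emb R (pt 0 0)) -> (conv_lat V : set E) (emb R (pt 1 0)) ->
  (conv_lat V : set E) (emb R (pt 0 1)) -> lattice_polygon (conv_lat V : set E).
Proof.
set P : set E := conv_lat V => P0 P1 P2; split; first by exists V.
  exists 0, fullv; split; first by rewrite dimvf dim_matrix.
  have -> : [set 0 + u | u in [set u : E | u \in fullv]] = setT.
    by apply/seteqP; split=> // u _; exists u; rewrite ?add0r //= memvf.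
  apply/seteqP; split=> // x _.
  exists 3%N, (fun i : 'I_3 => nth 0 [:: 1 - x 0 0 - x 0 1; x 0 0; x 0 1] i),
    (fun i : 'I_3 => nth 0 [:: emb R (pt 0 0); emb R (pt 1 0); emb R (pt 0 1)] i); split.
  - by rewrite !big_ord_recl big_ord0 /=; ring.
  - by case=> -[|[|[|//]]] ?.
  - by apply/rV2P; rewrite !big_ord_recl big_ord0 !mxE /=; ring.
move=> M [p [G [G0 Gsub _ ->]]] sub _ [v _ <-].
have [g0 Gg0 g0E] := sub _ (ex_intro2 _ _ (pt 0 0) P0 erefl).
have [g1 Gg1 g1E] := sub _ (ex_intro2 _ _ (pt 1 0) P1 erefl).
have [g2 Gg2 g2E] := sub _ (ex_intro2 _ _ (pt 0 1) P2 erefl).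
have GN (h : E) : G h -> G (- h) by move=> Gh; rewrite -sub0r; exact: Gsub.
have GD (h k : E) : G h -> G k -> G (h + k).
  by move=> Gh /GN Gk; rewrite -[k]opprK; exact: Gsub.
have GZ (a : int) (h : E) : G h -> G (a%:~R *: h).
  move=> Gh; elim/int_ind: a => [|k IH|k IH].
  - by rewrite scale0r.
  - by rewrite intS rmorphD scalerDl scale1r; exact: GD.
  - by rewrite intS opprD rmorphD rmorphN scalerDl scaleN1r; apply: GD => //; exact: GN.
exists (g0 + ((v 0 0)%:~R *: (g1 - g0) + (v 0 1)%:~R *: (g2 - g0))).
  by apply: (GD _ _ Gg0); apply: (GD); apply: (GZ); exact: Gsub.
have d1 : g1 - g0 = emb R (pt 1 0) - emb R (pt 0 0).
  by rewrite -g1E -g0E opprD addrACA subrr add0r.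
have d2 : g2 - g0 = emb R (pt 0 1) - emb R (pt 0 0).
  by rewrite -g2E -g0E opprD addrACA subrr add0r.
by rewrite addrA g0E d1 d2; apply/rV2P; rewrite !mxE /=; ring.
Qed.

Lemma columns_balanced P f g L : lattice_polygon P -> columns P f g L ->
  L != [::] -> (forall d e, d \in L -> e \in L -> pairing d.2 e.1 <= 1) -> balanced P.
Proof.
move=> hP hc L0 hL; have fg := hc.1.
have CE v n : base_normal P n v ->
    exists2 e, e \in L & coords f g v = e.1 /\ n = comb f g e.2.
  by move/hc.2.
split; first case: (hP) => PV dimP gen.
  split=> //; case: L L0 {hL CE} hc => // e L _ hc.
  exists (vector_of fg e.1); apply/(ColP hP); exists (comb f g e.2); apply/hc.2.
  by exists e; rewrite ?mem_head ?vector_ofK.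
move=> u v /(ColP hP)[n bn] /(ColP hP)[m bm]; rewrite (height_base hP _ bn).
have [d dL [_ ->]] := CE _ _ bn; have [e eL [vE _]] := CE _ _ bm.
by rewrite ip_comb vE; exact: hL.
Qed.

Lemma conv_lat_halfplanes (V : seq Z) (L : seq ((int * int) * int)) :
  (forall p v, p \in L -> v \in V -> p.2 <= ip (pt p.1.1 p.1.2) v) ->
  (forall x, (forall p, p \in L -> p.2%:~R <= dot (emb R (pt p.1.1 p.1.2)) x) ->
    (conv_lat V : set E) x) ->
  forall x, (conv_lat V : set E) x <->
    forall p, p \in L -> p.2%:~R <= dot (emb R (pt p.1.1 p.1.2)) x.
Proof.
move=> h1 h2 x; split=> [hx p pL|]; last exact: h2.
by apply: conv_hull_dot_ge hx => _ [v vV <-]; rewrite dot_emb ler_int h1.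
Qed.

Lemma conv_lat_seq (V : seq Z) (s : seq (R * Z)) x :
  (forall p, p \in s -> 0 <= p.1 /\ p.2 \in V) -> \sum_(p <- s) p.1 = 1 ->
  x = \sum_(p <- s) p.1 *: emb R p.2 -> (conv_lat V : set E) x.
Proof.
move=> hs s1 ->; pose s' := [seq (p.1, emb R p.2) | p <- s].
have := @conv_hull_seq R 2 [set emb R v | v in [set` V]] s'.
rewrite /s' !big_map /=; apply=> // _ /mapP[p ps ->] /=.
by have [p0 pV] := hs p ps; split=> //; exists p.2.
Qed.

Lemma vertex_conv (V : seq Z) v : v \in V -> (conv_lat V : set E) (emb R v).
Proof. by move=> vV; apply: sub_conv_hull; exists v. Qed.

Lemma aff_int_equiv_refl P : aff_int_equiv P P.
Proof.
exists 1%:M, 0; split; first exact: unitmx1.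
  by apply/seteqP; split=> [_ [x hx <-]|x hx];
    [|exists x => //]; rewrite mulmx1 addr0.
by apply/seteqP; split=> [_ [x hx <-]|x hx];
  [|exists x => //]; rewrite mulmx1 addr0.
Qed.

Lemma pt_neq (a b a' b' : int) : (a, b) != (a', b') -> pt a b != pt a' b'.
Proof.
apply: contra => /eqP/rowP h; have := h 0; have := h 1; rewrite !mxE /= => -> ->.
by [].
Qed.

Lemma scaled_Delta2_normals (k : nat) : (0 < k)%N ->
  normals [set k%:R *: x | x in Delta2 R] std1 std2 triangle_normals.
Proof.
move=> k0; have kR : (0 : R) < k%:R by rewrite ltr0n.
have kE : (k%:Z)%:~R = k%:R :> R by [].
have XE (x : E) : [set k%:R *: x | x in Delta2 R] x <->
    [/\ 0 <= x 0 0, 0 <= x 0 1 & x 0 0 + x 0 1 <= k%:R].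
  split=> [[y /Delta2E[y0 y1 y01] <-]|[x0 x1 x01]].
    rewrite !mxE; split; [exact: mulr_ge0 (ltW kR) y0|exact: mulr_ge0 (ltW kR) y1|].
    by rewrite -mulrDr -[leRHS]mulr1 ler_pM2l.
  exists (k%:R^-1 *: x); last by rewrite scalerA mulfV ?scale1r // gt_eqF.
  apply/Delta2E; rewrite !mxE; split; try by rewrite mulr_ge0 // invr_ge0 ltW.
  by rewrite -mulrDr mulrC ler_pdivrMr // mul1r.
apply: (@halfplanes_normals R _ [:: ((1, 0), 0); ((0, 1), 0); ((-1, -1), - k%:Z)]).
  move=> x; rewrite XE; split=> [[x0 x1 x01] p|h].
    by rewrite !inE => /or3P[] /eqP -> /=; rewrite dot_pt ?rmorphN /=; lra.
  have := h ((1, 0), 0) isT; have := h ((0, 1), 0) isT.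
  have := h ((-1, -1), - k%:Z); rewrite !inE !eqxx !orbT => /(_ isT).
  by rewrite !dot_pt ?rmorphN /= => h1 h2 h3; split; lra.
have X (a b : int) : 0 <= a -> 0 <= b -> a + b <= k%:Z ->
    [set k%:R *: x | x in Delta2 R] (emb R (pt a b)).
  move=> a0 b0 ab; apply/XE; rewrite !embE !mxE /= !ler0z -intrD -kE ler_int.
  by split.
move=> p; rewrite !inE => /or3P[] /eqP -> /=.
- exists (pt 0 0), (pt 0 k), (pt k 0); split; try (apply: X; lia).
    by apply: pt_neq; rewrite xpair_eqE; lia.
  by rewrite !ip_pt; split; [exists (pt 1 0); rewrite ip_pt|lia|lia|lia].
- exists (pt 0 0), (pt k 0), (pt 0 k); split; try (apply: X; lia).
    by apply: pt_neq; rewrite xpair_eqE; lia.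
  by rewrite !ip_pt; split; [exists (pt 0 1); rewrite ip_pt|lia|lia|lia].
- exists (pt k 0), (pt 0 k), (pt 0 0); split; try (apply: X; lia).
    by apply: pt_neq; rewrite xpair_eqE; lia.
  by rewrite !ip_pt; split; [exists (pt (-1) 0); rewrite ip_pt|lia|lia|lia].
Qed.

Lemma Delta2_scale1 : [set (1%N)%:R *: x | x in Delta2 R] = Delta2 R.
Proof.
apply/seteqP; split=> [_ [x hx <-]|x hx]; rewrite ?scale1r //.
by exists x; rewrite ?scale1r.
Qed.

Lemma Delta2_lattice : lattice_polygon (Delta2 R).
Proof. by apply: std_lattice_polygon; apply: vertex_conv; rewrite !inE eqxx ?orbT. Qed.

Lemma unit_square_lattice : lattice_polygon (unit_square R).
Proof. by apply: std_lattice_polygon; apply: vertex_conv; rewrite !inE eqxx ?orbT. Qed.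

Lemma trapezoid_lattice : lattice_polygon (trapezoid R).
Proof.
apply: std_lattice_polygon; try by apply: vertex_conv; rewrite !inE eqxx ?orbT.
apply: (conv_lat_seq (s := [:: (2^-1, pt 0 0); (2^-1, pt 2 0)])).
- by move=> w; rewrite !inE => /orP[] /eqP -> /=; rewrite eqxx ?orbT; split=> //; lra.
- by rewrite !big_cons big_nil /=; lra.
- by rewrite !big_cons big_nil /=; apply/rV2P; rewrite !mxE /=; lra.
Qed.

Lemma trapezoid_normals : normals (trapezoid R) std1 std2 (quad_normals 1).
Proof. by rewrite trapezoidE; exact: (@quad_std_normals R 1 0 0 1 2). Qed.

Lemma unit_square_normals : normals (unit_square R) std1 std2 (quad_normals 0).
Proof. by rewrite unit_squareE; exact: (@quad_std_normals R 0 0 0 1 1). Qed.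

(** The normals pass from [T] to [Q] through the rays of the common fan, and from [Q] to [P] by
    pullback. *)
Lemma proj_equiv_normals P Q T L : lattice_polygon P -> lattice_polygon T ->
  aff_int_equiv P Q -> proj_equiv Q T -> normals T std1 std2 L ->
  exists f g, normals P f g L.
Proof.
move=> [PV dimP _] [[V TV] dimT _] PQ QT [_ hL]; apply: (aff_int_normals PQ).
split; first exact: std_unimodular.
have [W QW] := aff_int_conv PQ PV.
have ncQ := aff_int_noncollinear PQ (has_dim2_noncollinear dimP).
have ncT := has_dim2_noncollinear dimT.
rewrite conv_latE in TV.
move=> n; rewrite -hL; split=> en; have pn := en.1.
  by apply/(fan_edge_normal TV ncT pn); rewrite -QT; apply/(fan_edge_normal QW ncQ pn).
by apply/(fan_edge_normal QW ncQ pn); rewrite QT; apply/(fan_edge_normal TV ncT pn).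
Qed.

Lemma case_a_config P : lattice_polygon P -> in_case case_a P -> config case_a P.
Proof.
move=> hP [k k0 Pk]; have [f [g hN]] := aff_int_normals Pk (scaled_Delta2_normals k0).
by exists f, g; exact: columns_triangle.
Qed.

Lemma case_b_config P : lattice_polygon P -> in_case case_b P -> config case_b P.
Proof.
move=> hP [Q PQ QT].
have [f [g hN]] := proj_equiv_normals hP trapezoid_lattice PQ QT trapezoid_normals.
by exists f, g; exact: columns_trapezoid.
Qed.

Lemma case_e_config P : lattice_polygon P -> in_case case_e P -> config case_e P.
Proof.
move=> hP [Q PQ QT].
have [f [g hN]] := proj_equiv_normals hP unit_square_lattice PQ QT unit_square_normals.
by exists f, g; exact: columns_square.
Qed.

Lemma balanced_in_case P : balanced P -> exists t, config t P /\ in_case t P.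
Proof.
move=> bP; have hP := balanced_lattice bP.
have [[f [g [hN|hN|hN]]]|[[f [g [hc|hc]]]|[n hn]]] := balanced_classification bP.
- exists case_a; split; first by exists f, g; exact: columns_triangle.
  exact: triangle_shape hP hN.
- exists case_e; split; first by exists f, g; exact: columns_square.
  have [a [b [d [e [bd ad PQ]]]]] := quad_shape (lexx 0) hP hN.
  exists (quad 0%:~R a%:~R b%:~R d%:~R e%:~R) => //.
  have bdR : b%:~R < d%:~R :> R by rewrite ltr_int.
  have adR : a%:~R < e%:~R - 0%:~R * d%:~R :> R by rewrite -intrM -intrB ltr_int.
  have h : (0 : R) < 1 - 0 * 1 by lra.
  by rewrite unit_squareE; exact: (quad_proj_equiv (lexx 0) bdR adR ltr01 h).
- exists case_b; split; first by exists f, g; exact: columns_trapezoid.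
  have [a [b [d [e [bd ad PQ]]]]] := quad_shape (ler01 : (0 : int) <= 1) hP hN.
  exists (quad 1%:~R a%:~R b%:~R d%:~R e%:~R) => //.
  have bdR : b%:~R < d%:~R :> R by rewrite ltr_int.
  have adR : a%:~R < e%:~R - 1%:~R * d%:~R :> R by rewrite -intrM -intrB ltr_int.
  have h : (0 : R) < 2 - 1 * 1 by lra.
  by rewrite trapezoidE; exact: (quad_proj_equiv ler01 bdR adR ltr01 h).
- have cP : config case_c P by exists f, g.
  by exists case_c; split=> //; exact: config_col_case.
- have cP : config case_f P by exists f, g.
  by exists case_f; split=> //; exact: config_col_case.
- have [k Ck] := single_base_finite hP hn.
  have cP : config (case_d k) P by split=> //; exists n.
  by exists (case_d k); split=> //; exact: config_col_case cP.
Qed.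

Lemma in_case_col_case t P : lattice_polygon P -> in_case t P -> col_case t P.
Proof.
move=> hP; case: t => [|||k||] // h; apply: config_col_case => //.
- exact: case_a_config.
- exact: case_b_config.
- exact: case_e_config.
Qed.

(** In cases (c), (d), (f) the hypothesis gives no coordinates. The classification supplies a case
    with coordinates, and the exclusivity of the cases identifies it with [t]. *)
Lemma in_case_config t P : balanced P -> in_case t P -> config t P.
Proof.
move=> bP tP; have hP := balanced_lattice bP.
have [t' [ct' t'P]] := balanced_in_case bP.
suff -> : t = t' by [].
exact: (E_equiv_case hP hP (E_equiv_refl P) (in_case_col_case hP tP)
  (in_case_col_case hP t'P)).
Qed.

Lemma case_a_realized : balanced (Delta2 R) /\ in_case case_a (Delta2 R).
Proof.
have hN := scaled_Delta2_normals (ltn0Sn 0); rewrite Delta2_scale1 in hN.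
split; last by exists 1%N; rewrite ?Delta2_scale1 //; exact: aff_int_equiv_refl.
apply: (columns_balanced Delta2_lattice (columns_triangle hN)) => // d e.
by rewrite !inE; do 5?[case/orP]; move=> /eqP ->; do 5?[case/orP]; move=> /eqP ->.
Qed.

Lemma case_b_realized : balanced (trapezoid R) /\ in_case case_b (trapezoid R).
Proof.
split; last by exists (trapezoid R) => //; exact: aff_int_equiv_refl.
have hc := columns_trapezoid trapezoid_normals.
apply: (columns_balanced trapezoid_lattice hc) => // d e.
by rewrite !inE => /or4P[] /eqP -> /or4P[] /eqP ->.
Qed.

Lemma case_e_realized : balanced (unit_square R) /\ in_case case_e (unit_square R).
Proof.
split; last by exists (unit_square R) => //; exact: aff_int_equiv_refl.
have hc := columns_square unit_square_normals.
apply: (columns_balanced unit_square_lattice hc) => // d e.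
by rewrite !inE => /or4P[] /eqP -> /or4P[] /eqP ->.
Qed.

(** The normal (-3, -2) is nonnegative on (-1, 0), (-1, 1) and (0, -1) but negative on (-1, 2) and
    (1, -1), and it takes no value -1 on the nonnegative quadrant; this leaves exactly the three
    columns of case (c). *)
Definition polygon_c : set E := conv_lat [:: pt 0 0; pt 2 0; pt 0 3].
Definition halfplanes_c : seq ((int * int) * int) :=
  [:: ((1, 0), 0); ((0, 1), 0); ((-3, -2), -6)].

Lemma polygon_cP x : polygon_c x <->
  forall p, p \in halfplanes_c -> p.2%:~R <= dot (emb R (pt p.1.1 p.1.2)) x.
Proof.
apply: conv_lat_halfplanes => [p v|{}x h].
  by rewrite !inE => /or3P[] /eqP -> /or3P[] /eqP -> /=; rewrite ip_pt.
have := h ((1, 0), 0) isT; have := h ((0, 1), 0) isT; have := h ((-3, -2), -6) isT.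
rewrite !dot_pt ?rmorphN /= => h1 h2 h3.
apply: (conv_lat_seq (s := [:: (1 - x 0 0 / 2 - x 0 1 / 3, pt 0 0);
  (x 0 0 / 2, pt 2 0); (x 0 1 / 3, pt 0 3)])).
- by move=> w; rewrite !inE => /or3P[] /eqP -> /=; rewrite eqxx ?orbT; split=> //; lra.
- by rewrite !big_cons big_nil /=; lra.
- by rewrite !big_cons big_nil /=; apply/rV2P; rewrite !mxE /=; lra.
Qed.

Lemma polygon_c_columns : columns polygon_c std1 std2 columns_c.
Proof.
have hN : normals polygon_c std1 std2 (map fst halfplanes_c).
  apply: halfplanes_normals polygon_cP _.
  have V (v : Z) : v \in [:: pt 0 0; pt 2 0; pt 0 3] -> polygon_c (emb R v).
    exact: vertex_conv.
  move=> p; rewrite !inE => /or3P[] /eqP -> /=.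
  - exists (pt 0 0), (pt 0 3), (pt 2 0).
    split; [exact: pt_neq|apply: V|apply: V|apply: V|]; rewrite ?inE ?eqxx ?orbT //.
    by rewrite !ip_pt; split=> //; exists (pt 1 0); rewrite ip_pt.
  - exists (pt 0 0), (pt 2 0), (pt 0 3).
    split; [exact: pt_neq|apply: V|apply: V|apply: V|]; rewrite ?inE ?eqxx ?orbT //.
    by rewrite !ip_pt; split=> //; exists (pt 0 1); rewrite ip_pt.
  - exists (pt 2 0), (pt 0 3), (pt 0 0).
    split; [exact: pt_neq|apply: V|apply: V|apply: V|]; rewrite ?inE ?eqxx ?orbT //.
    by rewrite !ip_pt; split=> //; exists (pt (-1) 1); rewrite ip_pt.
apply: normals_columns hN _ _ => [[a b] c|e].
  rewrite !inE => cL ca hm.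
  have := hm (1, 0) isT; have := hm (0, 1) isT; have := hm (-3, -2) isT.
  move: cL ca; rewrite /pairing /= => cL ca h1 h2 h3.
  by case/or3P: cL ca h1 h2 h3 => /eqP -> /=; rewrite !xpair_eqE /=; lia.
by rewrite !inE => /or3P[] /eqP -> /=; split=> // c; rewrite !inE => /or3P[] /eqP ->.
Qed.

Lemma case_c_realized : balanced polygon_c /\ in_case case_c polygon_c.
Proof.
have hP : lattice_polygon polygon_c.
  apply: std_lattice_polygon; first by apply: vertex_conv; rewrite !inE eqxx.
    apply/polygon_cP => p; rewrite !inE => /or3P[] /eqP -> /=;
    by rewrite dot_emb ip_pt ler_int.
  apply/polygon_cP => p; rewrite !inE => /or3P[] /eqP -> /=;
  by rewrite dot_emb ip_pt ler_int.
split; last first.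
  apply: (@config_col_case R case_c) => //.
  by exists std1, std2; exact: polygon_c_columns.
apply: (columns_balanced hP polygon_c_columns) => // d e.
by rewrite !inE => /or3P[] /eqP -> /or3P[] /eqP ->.
Qed.

(** Compared with the triangle for (c), the additional normal (-2, -3) is negative on (-1, 1), so
    that only (-1, 0) and (0, -1) remain. *)
Definition polygon_f : set E := conv_lat [:: pt 0 0; pt 5 0; pt 3 3; pt 0 5].
Definition halfplanes_f : seq ((int * int) * int) :=
  [:: ((1, 0), 0); ((0, 1), 0); ((-3, -2), -15); ((-2, -3), -15)].

Lemma polygon_fP x : polygon_f x <->
  forall p, p \in halfplanes_f -> p.2%:~R <= dot (emb R (pt p.1.1 p.1.2)) x.
Proof.
apply: conv_lat_halfplanes => [p v|{}x h].
  by rewrite !inE => /or4P[] /eqP -> /or4P[] /eqP -> /=; rewrite ip_pt.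
have := h ((1, 0), 0) isT; have := h ((0, 1), 0) isT.
have := h ((-3, -2), -15) isT; have := h ((-2, -3), -15) isT.
rewrite !dot_pt ?rmorphN /= => h1 h2 h3 h4.
(* The diagonal from the origin to (3, 3) cuts the polygon into two triangles, each with its
   barycentric coordinates. *)
have [xy|xy] := lerP (x 0 1) (x 0 0).
  apply: (conv_lat_seq (s := [:: (1 - (x 0 0 - x 0 1) / 5 - x 0 1 / 3, pt 0 0);
    ((x 0 0 - x 0 1) / 5, pt 5 0); (x 0 1 / 3, pt 3 3)])).
  - by move=> w; rewrite !inE => /or3P[] /eqP -> /=; rewrite eqxx ?orbT; split=> //; lra.
  - by rewrite !big_cons big_nil /=; lra.
  - by rewrite !big_cons big_nil /=; apply/rV2P; rewrite !mxE /=; lra.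
apply: (conv_lat_seq (s := [:: (1 - (x 0 1 - x 0 0) / 5 - x 0 0 / 3, pt 0 0);
  ((x 0 1 - x 0 0) / 5, pt 0 5); (x 0 0 / 3, pt 3 3)])).
- by move=> w; rewrite !inE => /or3P[] /eqP -> /=; rewrite eqxx ?orbT; split=> //; lra.
- by rewrite !big_cons big_nil /=; lra.
- by rewrite !big_cons big_nil /=; apply/rV2P; rewrite !mxE /=; lra.
Qed.

Lemma polygon_f_columns : columns polygon_f std1 std2 columns_f.
Proof.
have hN : normals polygon_f std1 std2 (map fst halfplanes_f).
  apply: halfplanes_normals polygon_fP _.
  have V (v : Z) : v \in [:: pt 0 0; pt 5 0; pt 3 3; pt 0 5] -> polygon_f (emb R v).
    exact: vertex_conv.
  move=> p; rewrite !inE => /or4P[] /eqP -> /=.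
  - exists (pt 0 0), (pt 0 5), (pt 5 0).
    split; [exact: pt_neq|apply: V|apply: V|apply: V|]; rewrite ?inE ?eqxx ?orbT //.
    by rewrite !ip_pt; split=> //; exists (pt 1 0); rewrite ip_pt.
  - exists (pt 0 0), (pt 5 0), (pt 0 5).
    split; [exact: pt_neq|apply: V|apply: V|apply: V|]; rewrite ?inE ?eqxx ?orbT //.
    by rewrite !ip_pt; split=> //; exists (pt 0 1); rewrite ip_pt.
  - exists (pt 5 0), (pt 3 3), (pt 0 0).
    split; [exact: pt_neq|apply: V|apply: V|apply: V|]; rewrite ?inE ?eqxx ?orbT //.
    by rewrite !ip_pt; split=> //; exists (pt (-1) 1); rewrite ip_pt.
  - exists (pt 0 5), (pt 3 3), (pt 0 0).
    split; [exact: pt_neq|apply: V|apply: V|apply: V|]; rewrite ?inE ?eqxx ?orbT //.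
    by rewrite !ip_pt; split=> //; exists (pt 1 (-1)); rewrite ip_pt.
apply: normals_columns hN _ _ => [[a b] c|e].
  rewrite !inE => cL ca hm.
  have := hm (1, 0) isT; have := hm (0, 1) isT.
  have := hm (-3, -2) isT; have := hm (-2, -3) isT.
  move: cL ca; rewrite /pairing /= => cL ca h1 h2 h3 h4.
  by case/or4P: cL ca h1 h2 h3 h4 => /eqP -> /=; rewrite !xpair_eqE /=; lia.
by rewrite !inE => /orP[] /eqP -> /=; split=> // c; rewrite !inE => /or4P[] /eqP ->.
Qed.

Lemma case_f_realized : balanced polygon_f /\ in_case case_f polygon_f.
Proof.
have hP : lattice_polygon polygon_f.
  apply: std_lattice_polygon; first by apply: vertex_conv; rewrite !inE eqxx.
    apply/polygon_fP => p; rewrite !inE => /or4P[] /eqP -> /=;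
    by rewrite dot_emb ip_pt ler_int.
  apply/polygon_fP => p; rewrite !inE => /or4P[] /eqP -> /=;
  by rewrite dot_emb ip_pt ler_int.
split; last first.
  apply: (@config_col_case R case_f) => //.
  by exists std1, std2; exact: polygon_f_columns.
apply: (columns_balanced hP polygon_f_columns) => // d e.
by rewrite !inE => /orP[] /eqP -> /orP[] /eqP ->.
Qed.

(** A base of length [2 * k] and an apex at height 2. A column vector over the base moves the apex
    to a lattice point at height 1, where the section has length [k] and half-integral ends, hence
    [k] lattice points. For positive [k], a column over another edge would have to be horizontal,
    which the even first coordinates of the other two normals exclude. *)
Definition polygon_d (k : nat) : set E :=
  conv_lat [:: pt 1 0; pt (1 - 2 * k%:Z) 0; pt 0 2].
Definition halfplanes_d (k : nat) : seq ((int * int) * int) :=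
  [:: ((0, 1), 0); ((-2, -1), -2); ((2, 1 - 2 * k%:Z), 2 - 4 * k%:Z)].
Definition columns_d (k : nat) : seq ((int * int) * (int * int)) :=
  [seq ((- s%:Z, -1), (0, 1)) | s <- iota 0 k].

Section CaseD.
Variables (k : nat) (k0 : (0 < k)%N).

Lemma polygon_dP x : polygon_d k x <->
  forall p, p \in halfplanes_d k -> p.2%:~R <= dot (emb R (pt p.1.1 p.1.2)) x.
Proof.
apply: conv_lat_halfplanes => [p v|{}x h].
  by rewrite !inE => /or3P[] /eqP -> /or3P[] /eqP -> /=; rewrite ip_pt; lia.
have := h ((0, 1), 0); have := h ((-2, -1), -2).
have := h ((2, 1 - 2 * k%:Z), 2 - 4 * k%:Z).
rewrite !inE !eqxx !orbT => /(_ isT) h1 /(_ isT) h2 /(_ isT) h3.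
move: h1 h2 h3; rewrite !dot_pt /= !rmorphB !rmorphN !rmorphM /=.
set K : R := k%:Z%:~R => h1 h2 h3.
have K0 : 0 < K by rewrite ltr0z; lia.
pose s := (1 - x 0 1 / 2 - x 0 0) / (2 * K).
have sE : s * (2 * K) = 1 - x 0 1 / 2 - x 0 0.
  by rewrite divfK // mulf_neq0 // gt_eqF.
have s0 : 0 <= s by rewrite divr_ge0 //; lra.
have s1 : s <= 1 - x 0 1 / 2.
  by rewrite ler_pdivrMr; lra.
apply: (conv_lat_seq (s := [:: (1 - x 0 1 / 2 - s, pt 1 0);
  (s, pt (1 - 2 * k%:Z) 0); (x 0 1 / 2, pt 0 2)])).
- by move=> w; rewrite !inE => /or3P[] /eqP -> /=; rewrite eqxx ?orbT; split=> //; lra.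
- by rewrite !big_cons big_nil /=; lra.
- rewrite !big_cons big_nil /=.
  by apply/rV2P; rewrite !mxE /= ?rmorphB ?rmorphM /=; rewrite -/K; lra.
Qed.

Lemma polygon_d_columns : columns (polygon_d k) std1 std2 (columns_d k).
Proof.
have hN : normals (polygon_d k) std1 std2 (map fst (halfplanes_d k)).
  apply: halfplanes_normals polygon_dP _.
  have V (v : Z) : v \in [:: pt 1 0; pt (1 - 2 * k%:Z) 0; pt 0 2] ->
    polygon_d k (emb R v) by exact: vertex_conv.
  move=> p; rewrite !inE => /or3P[] /eqP -> /=.
  - exists (pt 1 0), (pt (1 - 2 * k%:Z) 0), (pt 0 2).
    split; [apply: pt_neq|apply: V|apply: V|apply: V|]; rewrite ?inE ?eqxx ?orbT //.
      by rewrite xpair_eqE; lia.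
    by rewrite !ip_pt; split; [exists (pt 0 1); rewrite ip_pt|lia|lia|lia].
  - exists (pt 1 0), (pt 0 2), (pt (1 - 2 * k%:Z) 0).
    split; [apply: pt_neq|apply: V|apply: V|apply: V|]; rewrite ?inE ?eqxx ?orbT //.
    by rewrite !ip_pt; split; [exists (pt 0 (-1)); rewrite ip_pt|lia|lia|lia].
  - exists (pt (1 - 2 * k%:Z) 0), (pt 0 2), (pt 1 0).
    split; [apply: pt_neq|apply: V|apply: V|apply: V|]; rewrite ?inE ?eqxx ?orbT //.
      by rewrite xpair_eqE; lia.
    by rewrite !ip_pt; split; [exists (pt k 1); rewrite ip_pt; lia|lia|lia|lia].
apply: normals_columns hN _ _ => [[a b] c|e].
  rewrite !inE => cL ca hm.
  have := hm (0, 1) isT; have := hm (-2, -1) isT.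
  have := hm (2, 1 - 2 * k%:Z); rewrite !inE eqxx !orbT => /(_ isT).
  move: cL ca; rewrite /pairing /= => cL ca h1 h2 h3.
  case/or3P: cL ca h1 h2 h3 => /eqP -> /=.
  - move=> ba h1 h2 h3; apply/mapP; exists (absz a); first by rewrite mem_iota; nia.
    by congr (_, _, _); nia.
  - by nia.
  - by nia.
move=> /mapP[s]; rewrite mem_iota => sk -> /=; split; rewrite ?inE //.
  by rewrite /pairing /=; lia.
by move=> c; rewrite !inE /pairing => /or3P[] /eqP -> //= _; lia.
Qed.

Lemma case_d_realized : balanced (polygon_d k) /\ in_case (case_d k) (polygon_d k).
Proof.
have hc := polygon_d_columns.
have hP : lattice_polygon (polygon_d k).
  apply: std_lattice_polygon; last 2 first.
  - by apply: vertex_conv; rewrite !inE eqxx.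
  - apply/polygon_dP => p; rewrite !inE => /or3P[] /eqP -> /=;
    by rewrite dot_emb ip_pt ler_int; lia.
  - apply/polygon_dP => p; rewrite !inE => /or3P[] /eqP -> /=;
    by rewrite dot_emb ip_pt ler_int; lia.
split.
  apply: (columns_balanced hP hc) => [|d e /mapP[s _ ->] /mapP[s' _ ->]].
    by rewrite -size_eq0 size_map size_iota -lt0n.
  by rewrite /pairing /=; lia.
suff : config (case_d k) (polygon_d k) by exact: config_col_case.
split; last first.
  by exists (comb std1 std2 (0, 1)) => m v /hc.2[e /mapP[s _ ->] [_ ->]].
rewrite (Col_columns hP std_unimodular hc (perm_refl _)).
have {2}-> : k = size [seq vector_of std_unimodular i | i <- map fst (columns_d k)].
  by rewrite !size_map size_iota.
apply: seq_card; rewrite (map_inj_uniq (vector_of_inj (fg := std_unimodular))).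
rewrite -map_comp map_inj_uniq ?iota_uniq // => s s' [].
by lia.
Qed.

End CaseD.

End Examples.

Theorem theorem10p1 (R : realType) :
  [/\ (* the list is complete, and the cases exclude each other *)
      forall P : set 'rV[R]_2, balanced P -> exists! t, in_case t P,
      (* the description of the column vectors and relations in each case *)
      forall (t : polygon_case) (P : set 'rV[R]_2),
        balanced P -> in_case t P -> col_case t P,
      (* every case occurs *)
      forall t : polygon_case, (forall k, t = case_d k -> (0 < k)%N) ->
        exists2 P : set 'rV[R]_2, balanced P & in_case t P
    & (* every case is an E-equivalence class *)
      forall (t : polygon_case) (P Q : set 'rV[R]_2),
        balanced P -> in_case t P -> balanced Q ->
        (E_equiv P Q <-> in_case t Q)].
Proof.
split=> [P bP|t P bP|t ht|t P Q bP tP bQ].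
- have hP := balanced_lattice bP; have [t [_ tP]] := balanced_in_case bP.
  exists t; split=> // t' t'P.
  exact: (E_equiv_case hP hP (E_equiv_refl P) (in_case_col_case hP tP)
    (in_case_col_case hP t'P)).
- exact: in_case_col_case (balanced_lattice bP).
- case: t ht => [_|_|_|k /(_ k erefl) k0|_|_].
  + by have [bP tP] := case_a_realized R; exists (Delta2 R).
  + by have [bP tP] := case_b_realized R; exists (trapezoid R).
  + by have [bP tP] := case_c_realized R; exists (@polygon_c R).
  + by have [bP tP] := case_d_realized R k0; exists (@polygon_d R k).
  + by have [bP tP] := case_e_realized R; exists (unit_square R).
  + by have [bP tP] := case_f_realized R; exists (@polygon_f R).
have hP := balanced_lattice bP; have hQ := balanced_lattice bQ.
split=> [PQ|tQ]; last first.
  exact: (config_E_equiv hP hQ (in_case_config bP tP) (in_case_config bQ tQ)).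
have [t' [_ t'Q]] := balanced_in_case bQ.
suff -> : t = t' by [].
exact: (E_equiv_case hP hQ PQ (in_case_col_case hP tP) (in_case_col_case hQ t'Q)).
Qed.
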